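(* Let $(\rho_h,\theta_h,\eta_h)\in\Pi^1_c(\mathcal I_\tau;\mathcal V_h\times\mathcal V_h^+\times\mathcal V_h)$, $(\mu_{\rho,h},\mu_{\eta,h})\in\Pi^0(\mathcal I_\tau;\mathcal V_h\times\mathcal V_h)$ be a solution of the fully discrete problem: for all $v_{1,h},v_{2,h},\xi_h,w_{1,h},w_{2,h}\in\mathcal V_h$ and all time steps $n\ge0$, \begin{align*} &\langle d_\tau^{n+1}\rho_h,v_{1,h}\rangle+\langle\mathbf L_{11}\nabla\mu_{\rho,h}^{n+1}-\mathbf L_{12}\nabla\theta_h^{n+1}+\mu_{\eta,h}^{n+1}\mathbf L_{13},\nabla v_{1,h}\rangle=0,\\ &\langle\mu_{\rho,h}^{n+1},v_{2,h}\rangle-\gamma_\rho\langle\nabla\rho_h^{n+1},\nabla v_{2,h}\rangle-\langle\partial_\rho\psi(\rho_h,\theta_h^{n+1},\eta_h),v_{2,h}\rangle=0,\\ &\langle d_\tau^{n+1}e(\rho_h,\theta_h,\eta_h),\xi_h\rangle+\langle\mathbf L_{12}\nabla\mu_{\rho,h}^{n+1}-\mathbf L_{22}\nabla\theta_h^{n+1}+\mu_{\eta,h}^{n+1}\mathbf L_{23},\nabla\xi_h\rangle=0,\\ &\langle d_\tau^{n+1}\eta_h,w_{1,h}\rangle+\langle\mathbf L_{13}\cdot\nabla\mu_{\rho,h}^{n+1}-\mathbf L_{23}\cdot\nabla\theta_h^{n+1}+\mathbf L_{33}\mu_{\eta,h}^{n+1},w_{1,h}\rangle=0,\\ &\langle\mu_{\eta,h}^{n+1},w_{2,h}\rangle-\gamma_\eta\langle\nabla\eta_h^{n+1},\nabla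 w_{2,h}\rangle-\langle\partial_\eta\psi(\rho_h,\theta_h^{n+1},\eta_h),w_{2,h}\rangle=0. \end{align*} Let $(\hat\rho_h,\hat\theta_h,\hat\eta_h)\in\Pi^1_c(\mathcal I_\tau;\mathcal V_h\times\mathcal V_h^+\times\mathcal V_h)$ and $(\hat\mu_{\rho,h},\hat\mu_{\eta,h})\in\Pi^0(\mathcal I_\tau;\mathcal V_h\times\mathcal V_h)$ be given and let the residuals $r_{i,h}\in\Pi^0(\mathcal I_\tau;\mathcal V_h)$, $i=1,\dots,5$, be defined by requiring, for all test functions in $\mathcal V_h$, \begin{align*} &\langle d_\tau^{n+1}\hat\rho_h,v_{1,h}\rangle+\langle\mathbf L_{11}\nabla\hat\mu_{\rho,h}^{n+1}-\mathbf L_{12}\nabla\hat\theta_h^{n+1}+\hat\mu_{\eta,h}^{n+1}\mathbf L_{13},\nabla v_{1,h}\rangle=\langle r_{1,h}^{n+1},v_{1,h}\rangle,\\ &\langle\hat\mu_{\rho,h}^{n+1},v_{2,h}\rangle-\gamma_\rho\langle\nabla\hat\rho_h^{n+1},\nabla v_{2,h}\rangle-\langle\partial_\rho\psi(\hat\rho_h,\hat\theta_h^{n+1},\hat\eta_h),v_{2,h}\rangle=\langle r_{2,h}^{n+1},v_{2,h}\rangle,\\ &\langle d_\tau^{n+1}e(\hat\rho_h,\hat\theta_h,\hat\eta_h),\xi_h\rangle+\langle\mathbf L_{12}\nabla\hat\mu_{\rho,h}^{n+1}-\mathbf L_{22}\nabla\hat\theta_h^{n+1}+\hat\mu_{\eta,h}^{n+1}\mathbf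 L_{23},\nabla\xi_h\rangle=\langle r_{3,h}^{n+1},\xi_h\rangle,\\ &\langle d_\tau^{n+1}\hat\eta_h,w_{1,h}\rangle+\langle\mathbf L_{13}\cdot\nabla\hat\mu_{\rho,h}^{n+1}-\mathbf L_{23}\cdot\nabla\hat\theta_h^{n+1}+\mathbf L_{33}\hat\mu_{\eta,h}^{n+1},w_{1,h}\rangle=\langle r_{4,h}^{n+1},w_{1,h}\rangle,\\ &\langle\hat\mu_{\eta,h}^{n+1},w_{2,h}\rangle-\gamma_\eta\langle\nabla\hat\eta_h^{n+1},\nabla w_{2,h}\rangle-\langle\partial_\eta\psi(\hat\rho_h,\hat\theta_h^{n+1},\hat\eta_h),w_{2,h}\rangle=\langle r_{5,h}^{n+1},w_{2,h}\rangle. \end{align*} Assume, with $\Omega_T=\Omega\times(0,T)$ and positive constants $c_\infty,C_\infty$ independent of $h,\tau$, that $$\|(\rho_h,\theta_h,\eta_h)\|_{L^\infty(\Omega_T)}+\|(\hat\rho_h,\hat\theta_h,\hat\eta_h)\|_{L^\infty(\Omega_T)}+\|(d_\tau^{n+1}\hat\rho_h,d_\tau^{n+1}\hat\theta_h,d_\tau^{n+1}\hat\eta_h)\|_{L^\infty(\Omega_T)}\le C_\infty,\qquad\theta_h,\hat\theta_h\ge c_\infty\ \text{ for every }t\in[0,T].$$ Then, for $\lambda$ sufficiently large, there are constants $C,C(\mathbf L)>0$, independent of $h$, $\tau$, the solution and the perturbed functions except through $c_\infty,C_\infty$, such that for all time steps $n\ge 0$ \begin{align*} &\mathcal W_\lambda(\rho_h,\theta_h,\eta_h|\hat\rho_h,\hat\theta_h,\hat\eta_h)(t^{n+1})+\sum_{k=0}^n\tfrac\tau2\mathcal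 D_{\mathbf L}(\mu_{\rho,h}^{k+1}-\hat\mu_{\rho,h}^{k+1},\theta_h^{k+1}-\hat\theta_h^{k+1},\mu_{\eta,h}^{k+1}-\hat\mu_{\eta,h}^{k+1})\\ &\quad+\sum_{k=0}^n\tilde{\mathcal D}_{num}^{k+1}(\rho_h-\hat\rho_h,\theta_h-\hat\theta_h,\eta_h-\hat\eta_h)\\ &\le C\,\mathcal W_\lambda(\rho_h,\theta_h,\eta_h|\hat\rho_h,\hat\theta_h,\hat\eta_h)(0)+C\tau^2\\ &\quad+\tau\sum_{k=0}^nC(\mathbf L)\big(\|r_{1,h}^{k+1}\|_{-1}^2+\|r_{2,h}^{k+1}\|_1^2+\|r_{3,h}^{k+1}\|_{-1}^2+\|r_{4,h}^{k+1}\|_0^2+\|r_{5,h}^{k+1}\|_0^2\big). \end{align*}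
   Context: Domain and norms: $\Omega\subset\mathbb R^d$, $d\in\{2,3\}$, is a cube identified with the $d$-dimensional torus; all functions on $\Omega$ are periodic. $\langle\cdot,\cdot\rangle$ is the $L^2(\Omega)$ inner product, $\|\cdot\|_0$ the $L^2(\Omega)$ norm, $\|\cdot\|_1$ the $H^1(\Omega)$ norm, and $\|r\|_{-1}=\sup_{0\ne v\in H^1(\Omega)}\langle r,v\rangle/\|v\|_1$. Finite elements: $\mathcal T_h$ is a geometrically conforming partition of $\Omega$ into simplices which can be extended periodically; $\mathcal V_h$ is the space of continuous (periodic) functions that are affine on each $K\in\mathcal T_h$, and $\mathcal V_h^+=\{v\in\mathcal V_h: v(x)>0\ \forall x\in\Omega\}$. Time grid: $\mathcal I_\tau=\{0=t^0,t^1=\tau,\dots,t^{n_T}=T\}$ uniform, $n_T=T/\tau$; time steps $n$ range over $0\le n\le n_T-1$. $\Pi^1_c(\mathcal I_\tau;X)$, $\Pi^0(\mathcal I_\tau;X)$ are continuous piecewise linear, respectively piecewise constant, functions on the grid with values in $X$; $g^n=g(t^n)$ for $g\in\Pi^1_c$, and $g^{n+1}$ is the value on $(t^n,t^{n+1}]$ for $g\in\Pi^0$. $d^{n+1}g=g^{n+1}-g^n$, $d_\tau^{n+1}g=(g^{n+1}-g^n)/\tau$; in particular $d_\tau^{n+1}e(\rho_h,\theta_h,\eta_h)=\frac1\tau\big(e(\rho_h^{n+1},\theta_h^{n+1},\eta_h^{n+1})-e(\rho_h^n,\theta_h^n,\eta_h^n)\big)$. Parameters: $\gamma_\rho,\gamma_\eta>0$.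 Mobility: $\mathbf L_{11},\mathbf L_{12},\mathbf L_{22}$ are $d\times d$-matrix valued, $\mathbf L_{13},\mathbf L_{23}$ are $\mathbb R^d$-valued and $\mathbf L_{33}$ is scalar; all are functions of $(\rho,\nabla\rho,\theta,\eta,\nabla\eta)$; in each time step they are evaluated at a linear combination of the old ($t^n$) and new ($t^{n+1}$) time levels of the discrete solution $(\rho_h,\theta_h,\eta_h)$, identically in the scheme and in the perturbed system. The matrix $$\mathbf L=\begin{pmatrix}\mathbf L_{11}&-\mathbf L_{12}&\mathbf L_{13}\\-\mathbf L_{12}&\mathbf L_{22}&-\mathbf L_{23}\\ \mathbf L_{13}^\top&-\mathbf L_{23}^\top&\mathbf L_{33}\end{pmatrix}\in\mathbb R^{(2d+1)\times(2d+1)}$$ satisfies $\lambda_0|\xi|^2\le\xi^\top\mathbf L\xi\le\lambda_1|\xi|^2$ for all $\xi\in\mathbb R^{2d+1}$ with constants $\lambda_0,\lambda_1>0$; every component of $\mathbf L$ is $C^1$ in all arguments with first partial derivatives bounded by a constant. Define $\mathcal D_{\mathbf L}(\mu_\rho,\theta,\mu_\eta)=\int_\Omega (\nabla\mu_\rho,\nabla\theta,\mu_\eta)\,\mathbf L\,(\nabla\mu_\rho,\nabla\theta,\mu_\eta)^\top dx$, with $\mathbf L$ evaluated as in the corresponding time step. Potential: $\psi:\mathbb R\times(0,\infty)\times\mathbb R\to\mathbb R$, $(\rho,\theta,\eta)\mapsto\psi(\rho,\theta,\eta)$, is smooth; for every fixed $(\rho,\eta)$, $\psi(\rho,\cdot,\eta)$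 is strictly concave with $\psi(\rho,\theta,\eta)\to-\infty$ as $\theta\to0^+$; for every fixed $\theta>0$, $\psi(\cdot,\theta,\cdot)=\psi_{vex}(\cdot,\theta,\cdot)+\psi_{cav}(\cdot,\theta,\cdot)$ with $\psi_{vex}$ convex and $\psi_{cav}$ concave in $(\rho,\eta)$ (both smooth), with Hessians $H^{vex},H^{cav}$ with respect to $(\rho,\eta)$. There is $\alpha\in\mathbb R$ such that $(\rho,\eta)\mapsto\psi(\rho,\theta,\eta)+\frac\alpha2(\rho^2+\eta^2)$ is strictly convex for every fixed $\theta>0$. The internal energy density is $e=\partial_\theta\psi$. Convex-concave splitting: for $\zeta\in\{\rho,\eta\}$, $$\partial_\zeta\psi(\rho_h,\theta_h^{n+1},\eta_h):=\partial_\zeta\psi_{vex}(\rho_h^{n+1},\theta_h^{n+1},\eta_h^{n+1})+\partial_\zeta\psi_{cav}(\rho_h^n,\theta_h^{n+1},\eta_h^n),$$ and analogously for the hatted functions. Relative entropy (integrated over $\Omega$): \begin{align*} \mathcal W(\rho,\theta,\eta|\hat\rho,\hat\theta,\hat\eta)=\int_\Omega\Big[&\tfrac{\gamma_\rho}2|\nabla(\rho-\hat\rho)|^2+\tfrac{\gamma_\eta}2|\nabla(\eta-\hat\eta)|^2+\psi(\rho,\theta,\eta)-\psi(\hat\rho,\hat\theta,\hat\eta)-\partial_\theta\psi(\rho,\theta,\eta)(\theta-\hat\theta)\\ &-\partial_\rho\psi(\hat\rho,\hat\theta,\hat\eta)(\rho-\hat\rho)-\partial_\eta\psi(\hat\rho,\hat\theta,\hat\eta)(\eta-\hat\eta)\Big]dx,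 \end{align*} $$\mathcal W_\lambda(\rho,\theta,\eta|\hat\rho,\hat\theta,\hat\eta)=\mathcal W(\rho,\theta,\eta|\hat\rho,\hat\theta,\hat\eta)+\tfrac\lambda2\big(\|\rho-\hat\rho\|_0^2+\|\eta-\hat\eta\|_0^2\big),$$ where $\lambda\ge0$ is a fixed constant chosen sufficiently large (depending on $\alpha$). Relative numerical dissipation: with $\mathbf w=(\rho_h,\eta_h)^\top$, $\hat{\mathbf w}=(\hat\rho_h,\hat\eta_h)^\top$, \begin{align*} \tilde{\mathcal D}^{n+1}_{num}&(\rho_h-\hat\rho_h,\theta_h-\hat\theta_h,\eta_h-\hat\eta_h)=\tfrac{\gamma_\rho}2\|\nabla d^{n+1}(\rho_h-\hat\rho_h)\|_0^2+\tfrac{\gamma_\eta}2\|\nabla d^{n+1}(\eta_h-\hat\eta_h)\|_0^2\\ &-\tfrac12\langle\partial_{\theta\theta}\psi(\rho_h^n,\xi_1,\eta_h^n)d^{n+1}(\theta_h-\hat\theta_h),d^{n+1}(\theta_h-\hat\theta_h)\rangle\\ &+\tfrac12\big\langle\big(H^{vex}(\chi_3,\theta_h^{n+1},\chi_4)-H^{cav}(\chi_1,\theta_h^{n+1},\chi_2)\big)d^{n+1}(\mathbf w-\hat{\mathbf w}),d^{n+1}(\mathbf w-\hat{\mathbf w})\big\rangle\\ &+\tfrac\lambda2\|d^{n+1}(\rho_h-\hat\rho_h)\|_0^2+\tfrac\lambda2\|d^{n+1}(\eta_h-\hat\eta_h)\|_0^2\ \ge0, \end{align*} where $\xi_1$,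 $(\chi_1,\chi_2)$, $(\chi_3,\chi_4)$ are the (pointwise in $\Omega$) intermediate values of second-order Taylor expansions of, respectively, $\psi(\rho_h^n,\cdot,\eta_h^n)$ about $\theta_h^n$ evaluated at $\theta_h^{n+1}$, $\psi_{cav}(\cdot,\theta_h^{n+1},\cdot)$ about $(\rho_h^n,\eta_h^n)$ evaluated at $(\rho_h^{n+1},\eta_h^{n+1})$, and $\psi_{vex}(\cdot,\theta_h^{n+1},\cdot)$ about $(\rho_h^{n+1},\eta_h^{n+1})$ evaluated at $(\rho_h^n,\eta_h^n)$; thus $\xi_1$ lies between $\theta_h^n$ and $\theta_h^{n+1}$, $\chi_1,\chi_3$ between $\rho_h^n$ and $\rho_h^{n+1}$, $\chi_2,\chi_4$ between $\eta_h^n$ and $\eta_h^{n+1}$.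
   Formalization: Strict concavity of ψ in θ is strengthened to ∂θθψ<0 for θ>0 (the claim fails for ψ ~ −(θ−1)^4 near θ=1), and the entries of L are assumed bounded, which the two-sided bound implies when L is symmetric. *)

(* Defs.v *)
From HB Require Import structures.
From mathcomp Require Import all_boot all_order all_algebra.
From mathcomp Require Import all_classical all_reals all_analysis.

Set Implicit Arguments.
Unset Strict Implicit.
Unset Printing Implicit Defensive.

Import Order.TTheory GRing.Theory Num.Theory.
Import numFieldNormedType.Exports.

Local Open Scope classical_set_scope.
Local Open Scope ring_scope.

Section cube_measure.
Context (R : realType).

Section cons_measure.
Context (n : nat) (nu : {finite_measure set (measurableTypeR R) -> \bar R})
  (mu : {finite_measure set (n.-tuple (measurableTypeR R)) -> \bar R}).

Let tcons (p : measurableTypeR R * n.-tuple (measurableTypeR R)) :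
    n.+1.-tuple (measurableTypeR R) := [tuple of p.1 :: p.2].

Let measurable_tcons : measurable_fun setT tcons.
Proof. exact: measurable_cons. Qed.

Definition cons_measure : set (n.+1.-tuple (measurableTypeR R)) -> \bar R :=
  pushforward (nu \x mu)%E tcons.

Let cons_measure_preimage A : measurable A -> measurable (tcons @^-1` A).
Proof. by move=> mA; rewrite -[X in measurable X]setTI; exact: measurable_tcons. Qed.

Let cons_measure0 : cons_measure set0 = 0%E.
Proof. by rewrite /cons_measure /pushforward preimage_set0 measure0. Qed.

Let cons_measure_ge0 A : (0 <= cons_measure A)%E.
Proof. exact: measure_ge0. Qed.

Let cons_measure_additive : semi_sigma_additive cons_measure.
Proof.
move=> F mF tF mUF; rewrite /cons_measure /pushforward preimage_bigcup.
apply: measure_semi_sigma_additive.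
- by move=> i; exact: cons_measure_preimage.
- apply/trivIsetP => /= i j _ _ ij; rewrite -preimage_setI.
  by move/trivIsetP : tF => /(_ _ _ _ _ ij) ->//; rewrite preimage_set0.
- by rewrite -preimage_bigcup; exact: cons_measure_preimage.
Qed.

HB.instance Definition _ := isMeasure.Build _ _ _ cons_measure
  cons_measure0 cons_measure_ge0 cons_measure_additive.

Let cons_measure_fin : fin_num_fun cons_measure.
Proof.
apply: lty_fin_num_fun; change ((nu \x mu)%E setT < +oo)%E.
rewrite -setXTT product_measure1E// lte_mul_pinfty ?fin_num_measure//.
by rewrite ltey_eq fin_num_measure.
Qed.

HB.instance Definition _ := Measure_isFinite.Build _ _ _ cons_measure
  cons_measure_fin.
End cons_measure.

Section itv_measure.
Context (a b : R).
Let itv_lty : (lebesgue_measure `[a, b]%classic < +oo)%E.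
Proof.
by rewrite lebesgue_measure_itv/=; case: ifPn => // _; rewrite -EFinB ltry.
Qed.

Definition itv_measure : {finite_measure set (measurableTypeR R) -> \bar R} :=
  @mfrestr _ _ _ _ lebesgue_measure (measurable_itv `[a, b]) itv_lty.
End itv_measure.

(* Lebesgue measure of R^n restricted to the cube [0, l]^n; MathComp-Analysis
   has a product sigma-algebra on n.-tuple, but no product measure. *)
Fixpoint cube_measure (l : R) (n : nat) :
    {finite_measure set (n.-tuple (measurableTypeR R)) -> \bar R} :=
  if n is m.+1 then cons_measure (itv_measure 0 l) (cube_measure l m)
  else dirac [tuple].

End cube_measure.

Section calculus.
Context (R : realType) (n : nat).
Implicit Types (f : 'rV[R]_n -> R) (A : set 'rV[R]_n).

Definition unit_vec (i : 'I_n) : 'rV[R]_n := delta_mx 0 i.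

(* Total, like derive: it is 0 where the difference quotient has no limit, a
   Lebesgue-null set for finite element functions. *)
Definition pder (i : 'I_n) f : 'rV[R]_n -> R := fun x => 'D_(unit_vec i) f x.

Definition grad f (x : 'rV[R]_n) : 'cV[R]_n := \col_i pder i f x.

Definition dot (u v : 'cV[R]_n) : R := (u^T *m v) 0 0.

Definition smooth_on A f := forall (s : seq 'I_n) x, A x ->
  {for x, continuous (foldr pder f s)} /\
  forall i, derivable (foldr pder f s) x (unit_vec i).

Definition C1_bounded_on A f := exists B : R, forall x, A x -> forall i,
  [/\ derivable f x (unit_vec i), {for x, continuous (pder i f)} &
      `|pder i f x| <= B].

Definition strictly_convex (E : lmodType R) (D : set E) (f : E -> R) :=
  forall x y, D x -> D y -> x != y -> forall s : R, 0 < s -> s < 1 ->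
  f (s *: x + (1 - s) *: y) < s * f x + (1 - s) * f y.

End calculus.

(* The torus: functions on R^d that are l-periodic in every coordinate, with
   fundamental cell [0, l]^d. *)
Section torus.
Context (R : realType) (d : nat) (l : R).
Implicit Types (f v w : 'rV[R]_d -> R) (G : 'rV[R]_d -> 'cV[R]_d).

Definition rv (y : d.-tuple (measurableTypeR R)) : 'rV[R]_d :=
  \row_i (tnth y i : R).

Definition periodic f := forall x i, f (x + l *: unit_vec R i) = f x.

Definition tint f : R := \int[cube_measure l d]_y f (rv y).

Definition ip v w : R := tint (fun x => v x * w x).
Definition ipv G (H : 'rV[R]_d -> 'cV[R]_d) : R :=
  tint (fun x => dot (G x) (H x)).

Definition norm0 v : R := Num.sqrt (ip v v).
Definition norm0v G : R := Num.sqrt (ipv G G).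

(* G is the weak gradient of v *)
Definition norm1 v G : R := Num.sqrt (ip v v + ipv G G).

Definition L2 f := measurable_fun setT (f \o rv) /\
  (cube_measure l d).-integrable setT (fun y => (f (rv y) ^+ 2)%:E).

Definition weak_grad v G := forall (phi : 'rV[R]_d -> R) (i : 'I_d),
  smooth_on setT phi -> periodic phi ->
  ip v (pder i phi) = - ip (fun x => G x i 0) phi.

Definition H1 v G := [/\ periodic v, L2 v, forall i, L2 (fun x => G x i 0) &
  weak_grad v G].

(* v is nonzero in H^1 (as a class modulo null sets) iff its norm is *)
Definition norm_m1 (r : 'rV[R]_d -> R) : R :=
  sup [set q | exists v G, [/\ H1 v G, norm1 v G != 0 &
    q = ip r v / norm1 v G]].

End torus.

Section finite_elements.
Context (R : realType) (d : nat) (l : R).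

(* A simplex is the matrix whose rows are its d+1 vertices. *)
Definition simplex := 'M[R]_(d.+1, d).

Definition vertices (K : simplex) : set 'rV[R]_d := [set row i K | i in setT].

Definition nondegenerate (K : simplex) :=
  (row_mx (const_mx 1 : 'cV_d.+1) K : 'M[R]_d.+1) \in unitmx.

Definition convex_hull (A : set 'rV[R]_d) : set 'rV[R]_d :=
  [set x | exists m (p : 'I_m -> 'rV[R]_d) (w : 'I_m -> R),
    [/\ forall i, A (p i), forall i, 0 <= w i, \sum_i w i = 1 &
        x = \sum_i w i *: p i]].

Definition translate (z : 'rV[R]_d) (A : set 'rV[R]_d) := [set z + x | x in A].

Definition period (k : 'I_d -> int) : 'rV[R]_d := \row_i (l * (k i)%:~R).

(* k = 0 is conformity inside the cube; all k together say that the periodic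
   extension to R^d is conforming. *)
Definition triangulation (Th : seq simplex) :=
  [/\ forall K, K \in Th -> nondegenerate K,
      [set x | exists2 K, K \in Th & convex_hull (vertices K) x] =
        [set x : 'rV[R]_d | forall i, 0 <= x 0 i <= l] &
      forall K K' k, K \in Th -> K' \in Th ->
        convex_hull (vertices K) `&`
          translate (period k) (convex_hull (vertices K')) =
        convex_hull (vertices K `&` translate (period k) (vertices K'))].

Definition Vh (Th : seq simplex) : set ('rV[R]_d -> R) :=
  [set v | [/\ periodic l v, continuous v & forall K, K \in Th ->
    exists (a : 'cV[R]_d) (b : R),
      forall x, convex_hull (vertices K) x -> v x = (x *m a) 0 0 + b]].

Definition Vh_pos (Th : seq simplex) : set ('rV[R]_d -> R) :=
  [set v | Vh Th v /\ forall x, 0 < v x].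

End finite_elements.

Section time_grid.
Context (R : realType) (d : nat) (T : R) (nT : nat).
Implicit Types (X : set ('rV[R]_d -> R)) (g : R -> 'rV[R]_d -> R).

Definition tau : R := T / nT%:R.
Definition tn (n : nat) : R := n%:R * tau.

Definition Pi1c X g :=
  (forall t, 0 <= t <= T -> X (g t)) /\
  forall (n : nat) (s : R) x, (n < nT)%N -> 0 <= s <= 1 ->
    g (tn n + s * tau) x = (1 - s) * g (tn n) x + s * g (tn n.+1) x.

Definition Pi0 X g := forall n, (n < nT)%N ->
  X (g (tn n.+1)) /\ forall t, tn n < t <= tn n.+1 -> g t = g (tn n.+1).

Definition dn g (n : nat) : 'rV[R]_d -> R :=
  fun x => g (tn n.+1) x - g (tn n) x.
Definition dtau g (n : nat) : 'rV[R]_d -> R := fun x => dn g n x / tau.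

(* L^oo(Omega x (0,T)) norm of a triple, with the Euclidean norm on R^3 *)
Definition norm_oo (l : R) g1 g2 g3 : \bar R :=
  Lnorm (cube_measure l d \x itv_measure 0 T)%E +oo%E
    (fun p => (Num.sqrt (g1 p.2 (rv p.1) ^+ 2 + g2 p.2 (rv p.1) ^+ 2
       + g3 p.2 (rv p.1) ^+ 2))%:E).

End time_grid.

Section model.
Context (R : realType) (d : nat).

Definition irho : 'I_3 := @Ordinal 3 0 isT.
Definition itheta : 'I_3 := @Ordinal 3 1 isT.
Definition ieta : 'I_3 := @Ordinal 3 2 isT.

Definition st (r t e : R) : 'rV[R]_3 := \row_i [:: r; t; e]`_i.

(* position of the two components of w = (rho, eta) among (rho, theta, eta) *)
Definition iw (i : 'I_2) : 'I_3 := if i == 0 then irho else ieta.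

Definition wvec (r e : R) : 'cV[R]_2 := \col_i [:: r; e]`_i.

Definition gradw (f : 'rV[R]_3 -> R) (z : 'rV[R]_3) : 'cV[R]_2 :=
  \col_i pder (iw i) f z.

Definition hessw (f : 'rV[R]_3 -> R) (z : 'rV[R]_3) : 'M[R]_2 :=
  \matrix_(i, j) pder (iw i) (pder (iw j) f) z.

Definition mob_dim := (1 + (d + (1 + (1 + d))))%N.

Definition mob_arg (r : R) (gr : 'cV[R]_d) (t e : R) (ge : 'cV[R]_d) :
    'rV[R]_mob_dim :=
  row_mx r%:M (row_mx gr^T (row_mx t%:M (row_mx e%:M ge^T))).

Definition mob_theta (z : 'rV[R]_mob_dim) : R :=
  (lsubmx (rsubmx (rsubmx z) : 'rV_(1 + (1 + d)))) 0 0.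

Record model := Model {
  edge : R;
  gamma_rho : R;
  gamma_eta : R;
  psi : 'rV[R]_3 -> R;
  psi_vex : 'rV[R]_3 -> R;
  psi_cav : 'rV[R]_3 -> R;
  L11 : 'rV[R]_mob_dim -> 'M[R]_d;
  L12 : 'rV[R]_mob_dim -> 'M[R]_d;
  L22 : 'rV[R]_mob_dim -> 'M[R]_d;
  L13 : 'rV[R]_mob_dim -> 'cV[R]_d;
  L23 : 'rV[R]_mob_dim -> 'cV[R]_d;
  L33 : 'rV[R]_mob_dim -> R }.

Definition Lfull (M : model) (z : 'rV[R]_mob_dim) : 'M[R]_(d + (d + 1)) :=
  block_mx (L11 M z) (row_mx (- L12 M z) (L13 M z))
    (col_mx (- L12 M z) (L13 M z)^T)
    (block_mx (L22 M z) (- L23 M z) (- L23 M z)^T (L33 M z)%:M).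

(* Theta is the set of temperatures at which the mobility is given, e.g. the
   whole line or the positive half-line. *)
Record mobility_ok (M : model) (Theta : set R) : Prop := MobilityOk {
  mob_elliptic : exists lambda0 lambda1 : R, [/\ 0 < lambda0, 0 < lambda1 &
    forall z, Theta (mob_theta z) -> forall xi : 'cV[R]_(d + (d + 1)),
      lambda0 * dot xi xi <= dot xi (Lfull M z *m xi) <= lambda1 * dot xi xi];
  (* follows from the upper bound above when Lfull is symmetric; in general the
     quadratic form does not see the antisymmetric part *)
  mob_bounded : exists B : R, forall z, Theta (mob_theta z) ->
    forall i j, `|Lfull M z i j| <= B;
  mob_C1 : forall i j, C1_bounded_on [set z | Theta (mob_theta z)]
    (fun z => Lfull M z i j) }.

Definition pos_theta : set 'rV[R]_3 := [set z | 0 < z 0 itheta].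

Definition at_theta (f : 'rV[R]_3 -> R) (t : R) : 'rV[R]_2 -> R :=
  fun w => f (st (w 0 0) t (w 0 1)).

Record potential_ok (M : model) (alpha : R) : Prop := PotentialOk {
  psi_smooth : smooth_on pos_theta (psi M);
  psi_vex_smooth : smooth_on pos_theta (psi_vex M);
  psi_cav_smooth : smooth_on pos_theta (psi_cav M);
  psi_theta_concave : forall r e, strictly_convex [set t : R^o | 0 < t]
    (fun t => - psi M (st r t e));
  (* Strict concavity alone allows the second derivative to vanish at a point;
     there the relative entropy is o(|theta - theta'|^2) and a quadratic
     stability bound is impossible. *)
  psi_theta_concave2 : forall z, pos_theta z ->
    pder itheta (pder itheta (psi M)) z < 0;
  psi_theta_lim : forall r e, psi M (st r t e) @[t --> 0^'+] --> -oo;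
  psi_split : forall r t e, 0 < t ->
    psi M (st r t e) = psi_vex M (st r t e) + psi_cav M (st r t e);
  psi_vex_convex : forall t, 0 < t ->
    convex_function setT (at_theta (psi_vex M) t);
  psi_cav_concave : forall t, 0 < t ->
    convex_function setT (fun w => - at_theta (psi_cav M) t w);
  psi_alpha_convex : forall t, 0 < t ->
    strictly_convex [set: 'rV[R]_2] (fun w =>
      at_theta (psi M) t w + alpha / 2 * (w 0 0 ^+ 2 + w 0 1 ^+ 2)) }.

Record fields := Fields {
  frho : R -> 'rV[R]_d -> R;
  ftheta : R -> 'rV[R]_d -> R;
  feta : R -> 'rV[R]_d -> R;
  fmu_rho : R -> 'rV[R]_d -> R;
  fmu_eta : R -> 'rV[R]_d -> R }.

Definition state (u : fields) (t : R) (x : 'rV[R]_d) : 'rV[R]_3 :=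
  st (frho u t x) (ftheta u t x) (feta u t x).

Definition energy (M : model) (u : fields) (t : R) (x : 'rV[R]_d) : R :=
  pder itheta (psi M) (state u t x).

Definition rel_entropy (M : model) (u v : fields) (t : R) : R :=
  tint (edge M) (fun x =>
    let drho y := frho u t y - frho v t y in
    let deta y := feta u t y - feta v t y in
    gamma_rho M / 2 * dot (grad drho x) (grad drho x)
    + gamma_eta M / 2 * dot (grad deta x) (grad deta x)
    + psi M (state u t x) - psi M (state v t x)
    - pder itheta (psi M) (state u t x) * (ftheta u t x - ftheta v t x)
    - pder irho (psi M) (state v t x) * drho x
    - pder ieta (psi M) (state v t x) * deta x).

Definition rel_entropy_reg (M : model) (lambda : R) (u v : fields) (t : R) :=
  rel_entropy M u v t + lambda / 2 *
    (norm0 (edge M) (fun x => frho u t x - frho v t x) ^+ 2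
     + norm0 (edge M) (fun x => feta u t x - feta v t x) ^+ 2).

Section discrete.
Context (T : R) (nT : nat).
Local Notation tau := (tau T nT).
Local Notation tn := (tn T nT).
Local Notation dn := (dn T nT).
Local Notation dtau := (dtau T nT).

Definition fields_in (l : R) (Th : seq (simplex R d)) (u : fields) :=
  [/\ Pi1c T nT (Vh l Th) (frho u), Pi1c T nT (Vh_pos l Th) (ftheta u),
      Pi1c T nT (Vh l Th) (feta u), Pi0 T nT (Vh l Th) (fmu_rho u) &
      Pi0 T nT (Vh l Th) (fmu_eta u)].

(* Argument of the mobility in step n: the combination a n * (old) + b n * (new)
   of the two time levels. *)
Definition comb (a b : nat -> R) (g : R -> 'rV[R]_d -> R) (n : nat) :
    'rV[R]_d -> R :=
  fun x => a n * g (tn n) x + b n * g (tn n.+1) x.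

Definition mob_at (a b : nat -> R) (u : fields) (n : nat) (x : 'rV[R]_d) :
    'rV[R]_mob_dim :=
  mob_arg (comb a b (frho u) n x) (grad (comb a b (frho u) n) x)
    (comb a b (ftheta u) n x)
    (comb a b (feta u) n x) (grad (comb a b (feta u) n) x).

Definition split_der (M : model) (i : 'I_3) (u : fields) (n : nat)
    (x : 'rV[R]_d) : R :=
  pder i (psi_vex M) (state u (tn n.+1) x)
  + pder i (psi_cav M)
      (st (frho u (tn n) x) (ftheta u (tn n.+1) x) (feta u (tn n) x)).

(* The five equations of step n, with mobility argument z and right-hand sides
   F1, ..., F5. *)
Definition step_eqs (M : model) (Th : seq (simplex R d))
    (z : 'rV[R]_d -> 'rV[R]_mob_dim) (u : fields) (n : nat)
    (F1 F2 F3 F4 F5 : ('rV[R]_d -> R) -> R) :=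
  let l := edge M in
  let mr := fmu_rho u (tn n.+1) in
  let th := ftheta u (tn n.+1) in
  let me := fmu_eta u (tn n.+1) in
  forall v, Vh l Th v ->
  [/\ ip l (dtau (frho u) n) v
      + ipv l (fun x => L11 M (z x) *m grad mr x - L12 M (z x) *m grad th x
                 + me x *: L13 M (z x)) (grad v) = F1 v,
      ip l mr v - gamma_rho M * ipv l (grad (frho u (tn n.+1))) (grad v)
      - ip l (split_der M irho u n) v = F2 v,
      ip l (dtau (energy M u) n) v
      + ipv l (fun x => L12 M (z x) *m grad mr x - L22 M (z x) *m grad th x
                 + me x *: L23 M (z x)) (grad v) = F3 v,
      ip l (dtau (feta u) n) v
      + ip l (fun x => dot (L13 M (z x)) (grad mr x)
                - dot (L23 M (z x)) (grad th x) + L33 M (z x) * me x) v = F4 v &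
      ip l me v - gamma_eta M * ipv l (grad (feta u (tn n.+1))) (grad v)
      - ip l (split_der M ieta u n) v = F5 v].

Definition dissipation (M : model) (z : 'rV[R]_d -> 'rV[R]_mob_dim)
    (u v : fields) (n : nat) : R :=
  let diff (g h : R -> 'rV[R]_d -> R) x := g (tn n.+1) x - h (tn n.+1) x in
  let xi x : 'cV[R]_(d + (d + 1)) :=
    col_mx (grad (diff (fmu_rho u) (fmu_rho v)) x)
      (col_mx (grad (diff (ftheta u) (ftheta v)) x)
         (diff (fmu_eta u) (fmu_eta v) x)%:M) in
  tint (edge M) (fun x => dot (xi x) (Lfull M (z x) *m xi x)).

(* Taylor intermediate points xi_1, (chi_1, chi_2), (chi_3, chi_4) of all time
   steps, pointwise in space *)
Record taylor_points := TaylorPoints {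
  xi1 : nat -> 'rV[R]_d -> R;
  chi1 : nat -> 'rV[R]_d -> R;
  chi2 : nat -> 'rV[R]_d -> R;
  chi3 : nat -> 'rV[R]_d -> R;
  chi4 : nat -> 'rV[R]_d -> R }.

Definition on_segment (E : lmodType R) (a b c : E) :=
  exists2 s : R, 0 <= s <= 1 & c = (1 - s) *: a + s *: b.

Definition intermediate (M : model) (u : fields) (p : taylor_points) (n : nat) :=
  let measurable f := measurable_fun setT (f \o @rv R d) in
  [/\ measurable (xi1 p n), measurable (chi1 p n), measurable (chi2 p n),
      measurable (chi3 p n) & measurable (chi4 p n)] /\
  forall x,
    let r0 := frho u (tn n) x in let r1 := frho u (tn n.+1) x in
    let t0 := ftheta u (tn n) x in let t1 := ftheta u (tn n.+1) x in
    let e0 := feta u (tn n) x in let e1 := feta u (tn n.+1) x in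
    let w0 := wvec r0 e0 in let w1 := wvec r1 e1 in
    [/\ on_segment (t0 : R^o) t1 (xi1 p n x)
        /\ psi M (st r0 t1 e0) = psi M (st r0 t0 e0)
           + pder itheta (psi M) (st r0 t0 e0) * (t1 - t0)
           + 2^-1 * pder itheta (pder itheta (psi M)) (st r0 (xi1 p n x) e0)
             * (t1 - t0) ^+ 2,
        on_segment w0 w1 (wvec (chi1 p n x) (chi2 p n x))
        /\ psi_cav M (st r1 t1 e1) = psi_cav M (st r0 t1 e0)
           + dot (gradw (psi_cav M) (st r0 t1 e0)) (w1 - w0)
           + 2^-1 * dot (hessw (psi_cav M) (st (chi1 p n x) t1 (chi2 p n x))
                         *m (w1 - w0)) (w1 - w0) &
        on_segment w0 w1 (wvec (chi3 p n x) (chi4 p n x))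
        /\ psi_vex M (st r0 t1 e0) = psi_vex M (st r1 t1 e1)
           + dot (gradw (psi_vex M) (st r1 t1 e1)) (w0 - w1)
           + 2^-1 * dot (hessw (psi_vex M) (st (chi3 p n x) t1 (chi4 p n x))
                         *m (w0 - w1)) (w0 - w1)].

Definition num_dissipation (M : model) (lambda : R) (u v : fields)
    (p : taylor_points) (n : nat) : R :=
  let l := edge M in
  let drho := dn (fun t x => frho u t x - frho v t x) n in
  let dtheta := dn (fun t x => ftheta u t x - ftheta v t x) n in
  let deta := dn (fun t x => feta u t x - feta v t x) n in
  let dw x := wvec (drho x) (deta x) in
  let t1 := ftheta u (tn n.+1) in
  gamma_rho M / 2 * norm0v l (grad drho) ^+ 2
  + gamma_eta M / 2 * norm0v l (grad deta) ^+ 2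
  - 2^-1 * ip l (fun x => pder itheta (pder itheta (psi M))
                   (st (frho u (tn n) x) (xi1 p n x) (feta u (tn n) x)) * dtheta x)
             dtheta
  + 2^-1 * tint l (fun x =>
      dot ((hessw (psi_vex M) (st (chi3 p n x) (t1 x) (chi4 p n x))
            - hessw (psi_cav M) (st (chi1 p n x) (t1 x) (chi2 p n x))) *m dw x)
        (dw x))
  + lambda / 2 * norm0 l drho ^+ 2 + lambda / 2 * norm0 l deta ^+ 2.

End discrete.
End model.

(* Main.v *)
Require Import Defs.
From HB Require Import structures.
From mathcomp Require Import all_boot all_order all_algebra.
From mathcomp Require Import all_classical all_reals all_analysis.
From mathcomp Require Import measurable_realfun ring lra.
Import Defs.

Set Implicit Arguments.
Unset Strict Implicit.
Unset Printing Implicit Defensive.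

Import Order.TTheory GRing.Theory Num.Theory.
Import numFieldNormedType.Exports.

Local Open Scope classical_set_scope.
Local Open Scope ring_scope.

(** The relative entropy acts as a Lyapunov functional for the difference of the discrete solution
    and the perturbed one. The uniform bounds confine all values to a compact box of states with
    positive temperature, on which psi is uniformly concave in theta and, up to [alpha], convex in
    (rho, eta). Hence for [|alpha| + 1 <= lambda] the regularised relative entropy dominates the
    squared L2 distance [sq_dist] ([rel_entropy_ge]).

    In one time step, the increment of the entropy density plus the numerical dissipation is
    computed from the Taylor identities that define the intermediate points. When everything else is
    expanded at the old perturbed state, the second order terms combine to the differences of
    energies and of split derivatives that occur in the scheme. What remains is of third order, and
    each of its terms has a factor bounded by the increment of the perturbed solution, which is
    [O(tau)]. The remainder is therefore at most a constant times [tau] times the squared distances,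
    plus a multiple of [tau ^+ 3] ([pot_step], [pot_step_integral], [entropy_step]).

    The scheme and the perturbed system share the mobility argument, so their difference is linear
    in the fluxes. The equations for the chemical potentials, tested with the increments of the
    differences, turn the derivative terms into pairings of these increments with the potential
    differences, corrected by [r2], [r5] and terms in [lambda]. Exactly these corrected potentials,
    together with the temperature difference, are the test functions for the evolution equations:
    they produce minus the dissipation, residual pairings and one more flux term
    ([entropy_increment]). Young's inequality absorbs the latter into half of the dissipation. The
    obstacle is that the dissipation controls the gradient of the rho potential difference but not
    its L2 norm, and that [sq_dist] contains no gradient of rho. Both missing norms come from the
    potential equation for rho, tested with the potential difference and with the rho difference
    ([mu_bound], [grad_rho_bound], [absorption]). This gives [step_estimate], and the steps are
    summed by [discrete_gronwall]; when [tau] is too large for a Gronwall argument, the uniform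
    bound on [sq_dist] is itself at most a constant times [tau ^+ 2].

    Three analytic facts support this. Pointwise gradients of finite element functions are
    meaningful inside the simplices, a set of full measure, and all integrals are reduced to it
    ([gset_conull], [tintE]). Finite element functions lie in H1 with their pointwise gradient as
    weak gradient ([ip_by_parts], [Vh_H1]), so that the dual norm does bound the residual pairings
    ([norm_m1_dual]). Finally, essential bounds in space-time hold at every grid time by continuity
    ([norm_oo_grid]). *)

Definition between (R : realType) (a b c : R) := Num.min a b <= c <= Num.max a b.

(** * Mean value theorem for functions with partial derivatives *)

Section mean_value.
Context (R : realType) (n : nat).
Implicit Types (f : 'rV[R]_n -> R) (x y z e : 'rV[R]_n).

Lemma is_derive_slice f x e s df :
  is_derive (x + s *: e) e f df -> is_derive s 1 (fun t => f (x + t *: e)) df.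
Proof.
move=> [fd fE].
have E : (fun h : R => h^-1 *: (((fun t => f (x + t *: e)) \o shift s) (h *: 1)
   - f (x + s *: e))) =
   (fun h : R => h^-1 *: ((f \o shift (x + s *: e)) (h *: e) - f (x + s *: e))).
  apply/funext => h /=; congr (_ *: (f _ - _)).
  by rewrite scalerDl addrCA -scalerA scale1r.
by split; rewrite /derivable /derive E.
Qed.

Lemma mean_value_dir f (df : 'rV[R]_n -> R) x e (t : R) :
  (forall s, between 0 t s -> is_derive (x + s *: e) e f (df (x + s *: e))) ->
  exists2 s, between 0 t s & f (x + t *: e) - f x = df (x + s *: e) * t.
Proof.
move=> H.
have Hs s : between 0 t s ->
    is_derive s 1 (fun t => f (x + t *: e)) (df (x + s *: e)).
  by move=> /H; exact: is_derive_slice.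
have C a b : (forall s, s \in `[a, b] -> between 0 t s) ->
    {within `[a, b], continuous (fun t => f (x + t *: e))}.
  move=> ab; apply: derivable_within_continuous => s /ab/Hs [].
  by [].
have [t0|t0] := leP 0 t.
  have B s : s \in `[0, t] -> between 0 t s.
    by rewrite in_itv/= /between min_l// max_r.
  have [|c c0 E] := @MVT_segment R _ (fun s => df (x + s *: e)) _ _ t0 _ (C _ _ B).
    by move=> s /subset_itv_oo_cc/B/Hs.
  exists c; first exact: B.
  by move: E; rewrite scale0r addr0 subr0.
have B s : s \in `[t, 0] -> between 0 t s.
  by rewrite in_itv/= /between min_r ?max_l// ltW.
have [|c c0 E] := @MVT_segment R _ (fun s => df (x + s *: e)) _ _ (ltW t0) _ (C _ _ B).
  by move=> s /subset_itv_oo_cc/B/Hs.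
exists c; first exact: B.
apply: oppr_inj; rewrite opprB; move: E; rewrite scale0r addr0 => ->.
by rewrite sub0r mulrN.
Qed.

Lemma between_dist (a b c : R) : between a b c -> `|c - a| <= `|b - a|.
Proof.
rewrite /between; have [ab|ba] := leP a b => /andP[h1 h2].
  by rewrite !ger0_norm; lra.
by rewrite !ler0_norm; lra.
Qed.

(** Go from [z] to [z'] by changing one coordinate at a time and apply the one-dimensional theorem
    on each leg. Partial derivatives suffice for this, at the price of a separate point [zeta k] for
    each coordinate. *)
Lemma mean_value f (df : 'I_n -> 'rV[R]_n -> R) z z' :
  (forall y, (forall i, between (z 0 i) (z' 0 i) (y 0 i)) ->
     forall i, is_derive y (unit_vec R i) f (df i y)) ->
  exists2 zeta : 'I_n -> 'rV[R]_n,
    forall k i, between (z 0 i) (z' 0 i) (zeta k 0 i) &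
    f z' - f z = \sum_k df k (zeta k) * (z' 0 k - z 0 k).
Proof.
move=> H.
pose p (k : nat) : 'rV[R]_n := \row_i (if (i < k)%N then z' 0 i else z 0 i).
have btwl (a b : R) : between a b a by rewrite /between ge_min le_max lexx.
have btwr (a b : R) : between a b b by rewrite /between ge_min le_max lexx !orbT.
have pS (k : 'I_n) : p k.+1 = p k + (z' 0 k - z 0 k) *: unit_vec R k.
  apply/rowP => i; rewrite !mxE /= ?eqxx /= ltnS leq_eqVlt.
  have [->|ik] := eqVneq i k; first by rewrite ?eqxx/= ltnn mulr1 addrC subrK.
  have -> /= : (i == k :> nat) = false by apply/negbTE.
  by rewrite mulr0 addr0.
have step (k : 'I_n) : exists y, (forall i, between (z 0 i) (z' 0 i) (y 0 i)) /\
    f (p k.+1) - f (p k) = df k y * (z' 0 k - z 0 k).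
  have B s : between 0 (z' 0 k - z 0 k) s -> forall i,
      between (z 0 i) (z' 0 i) ((p k + s *: unit_vec R k) 0 i).
    move=> sB i; rewrite !mxE /= ?eqxx/=; have [->|ik] := eqVneq i k.
      rewrite ltnn mulr1; move: sB; rewrite /between.
      by case: (leP 0 (z' 0 k - z 0 k)); case: (leP (z 0 k) (z' 0 k)) => *; lra.
    by rewrite mulr0 addr0; case: ifP.
  have [|s sB E] := @mean_value_dir f (df k) (p k) (unit_vec R k) (z' 0 k - z 0 k).
    by move=> s /B/H/(_ k).
  by exists (p k + s *: unit_vec R k); split; [exact: B|rewrite pS E].
have [zeta zetaP] := choice step.
exists zeta; first by move=> k i; have [] := zetaP k.
have p0 : p 0%N = z by apply/rowP => i; rewrite mxE.
have pn : p n = z' by apply/rowP => i; rewrite mxE ltn_ord.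
rewrite -{1}pn -{1}p0 -(telescope_sumr (fun k => f (p k)))// big_mkord.
by apply: eq_bigr => k _; have [_ ->] := zetaP k.
Qed.

End mean_value.

(** * Taylor expansions on compact boxes with uniform constants *)

Section box.
Context (R : realType) (n : nat).
Implicit Types (f : 'rV[R]_n -> R) (w x y z : 'rV[R]_n) (D U : set 'rV[R]_n).

Definition l1 x : R := \sum_i `|x 0 i|.

Definition box (a b : 'rV[R]_n) : set 'rV[R]_n :=
  [set y | forall i, a 0 i <= y 0 i <= b 0 i].

Lemma l1_ge0 x : 0 <= l1 x.
Proof. by apply: sumr_ge0 => i _. Qed.

Lemma ler_l1 x i : `|x 0 i| <= l1 x.
Proof. by rewrite /l1 (bigD1 i)//= lerDl sumr_ge0. Qed.

Lemma box_compact a b : compact (box a b).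
Proof.
have /= := @rV_compact R n (fun i => `[a 0 i, b 0 i]%classic)
  (fun i => @segment_compact R _ _).
by congr compact; apply/seteqP; split=> y yab i; have := yab i; rewrite /= in_itv.
Qed.

Lemma between_box a b z z' y : box a b z -> box a b z' ->
  (forall i, between (z 0 i) (z' 0 i) (y 0 i)) -> box a b y.
Proof.
move=> hz hz' hy i; move: (hz i) (hz' i) (hy i); rewrite /between.
by case: (leP (z 0 i) (z' 0 i)) => *; lra.
Qed.

Lemma between_l1 z z' w y : (forall i, between (z 0 i) (z' 0 i) (y 0 i)) ->
  l1 (y - w) <= l1 (z - w) + l1 (z' - w).
Proof.
move=> hy; rewrite /l1 -big_split/=; apply: ler_sum => i _; rewrite !mxE.
move: (hy i); rewrite /between; case: (leP (z 0 i) (z' 0 i)) => _ h;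
case: (ger0P (y 0 i - w 0 i)) => ?; case: (ger0P (z 0 i - w 0 i)) => ?;
case: (ger0P (z' 0 i - w 0 i)) => ?; lra.
Qed.

Lemma between_l1_left z z' y : (forall i, between (z 0 i) (z' 0 i) (y 0 i)) ->
  l1 (y - z) <= l1 (z' - z).
Proof.
by move=> hy; have := between_l1 z hy; rewrite subrr [l1 0]big1 ?add0r// => i _;
  rewrite mxE normr0.
Qed.

Lemma mean_value_box f a b z z' :
  (forall y, box a b y -> forall i, derivable f y (unit_vec R i)) ->
  box a b z -> box a b z' ->
  exists2 zeta : 'I_n -> 'rV[R]_n,
    forall k, box a b (zeta k) /\ forall i, between (z 0 i) (z' 0 i) (zeta k 0 i) &
    f z' - f z = \sum_k pder k f (zeta k) * (z' - z) 0 k.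
Proof.
move=> df hz hz'.
have [|zeta zetab E] := @mean_value R n f (fun i => pder i f) z z'.
  by move=> y /(between_box hz hz') yD i; apply: DeriveDef => //; exact: df.
exists zeta; first by move=> k; split=> //; exact: between_box (zetab k).
by rewrite E; apply: eq_bigr => k _; rewrite !mxE.
Qed.

Lemma norm_sum_mul_le (g : 'I_n -> R) x B : (forall k, `|g k| <= B) ->
  `|\sum_k g k * x 0 k| <= B * l1 x.
Proof.
move=> gB; apply: (le_trans (ler_norm_sum _ _ _)).
rewrite /l1 mulr_sumr; apply: ler_sum => k _.
by rewrite normrM ler_wpM2r.
Qed.

Lemma pder_lipschitz f a b B z z' :
  (forall y, box a b y -> forall i, derivable f y (unit_vec R i) /\
     `|pder i f y| <= B) ->
  box a b z -> box a b z' -> `|f z' - f z| <= B * l1 (z' - z).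
Proof.
move=> df hz hz'.
have [|zeta zetaP ->] := @mean_value_box f a b z z' _ hz hz'.
  by move=> y yD i; have [] := df _ yD i.
by apply: norm_sum_mul_le => k; have [/df/(_ k)[]] := zetaP k.
Qed.

(** Order three is what the remainder of a second order expansion consumes. Derivability is recorded
    next to the bound because [pder] is a total operator. *)
Definition derivs_bounded D f (B : R) := forall (s : seq 'I_n) y, D y ->
  (size s <= 3)%N -> `|foldr (@pder R n) f s y| <= B /\
  forall i, derivable (foldr (@pder R n) f s) y (unit_vec R i).

(** Every iterated partial derivative is continuous, hence bounded on the compact box, and only
    finitely many have order at most three. *)
Lemma smooth_derivs_bounded f U a b : smooth_on U f -> box a b `<=` U ->
  exists2 B, 0 < B & derivs_bounded (box a b) f B.
Proof.
move=> fU DU.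
have H1 s : exists B, 0 < B /\ forall y, box a b y ->
    `|foldr (@pder R n) f s y| <= B.
  have [E|/set0P [y0 y0D]] := eqVneq (box a b) set0.
    by by exists 1; split=> // y; rewrite E.
  have /compact_bounded[M [_ MP]] :
      compact [set foldr (@pder R n) f s y | y in box a b].
    apply: continuous_compact; last exact: box_compact.
    apply: continuous_in_subspaceT => y /set_mem /DU yU.
    by have [] := fU s y yU.
  exists (`|M| + 1); split=> [|y yD]; first by rewrite ltr_wpDl.
  apply: (MP (`|M| + 1)); last by exists y.
  by rewrite (le_lt_trans (ler_norm _))// ltrDl.
have [B BP] := choice H1.
(* One bound for all derivatives of order [k]; the maximum starts from 1 to stay positive. *)
pose C k := \big[Num.max/1]_(t : k.-tuple 'I_n) B t.
exists (C 0 + C 1 + C 2 + C 3).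
  have C0 k : 0 < C k.
    by rewrite /C; elim/big_rec: _ => // t x _ x0; rewrite lt_max x0 orbT.
  by rewrite !addr_gt0.
move=> s y yD s3; split; last by move=> i; have [_] := fU s y (DU _ yD); exact.
have [_ /(_ y yD) le1] := BP s.
have C0 k : 0 <= C k.
  by rewrite /C; elim/big_rec: _ => // t x _ x0; rewrite le_max x0 orbT.
have le2 : B s <= C (size s).
  by rewrite /C (bigD1 (in_tuple s))//= le_max lexx.
apply: (le_trans le1); apply: (le_trans le2).
have := C0 0%N; have := C0 1%N; have := C0 2%N; have := C0 3%N.
by case: (size s) s3 => [|[|[|[|]]]]//= _; lra.
Qed.

Lemma derivs_bounded_pder D f B j : derivs_bounded D f B ->
  forall s y, D y -> (size s <= 2)%N -> `|foldr (@pder R n) (pder j f) s y| <= B /\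
  forall i, derivable (foldr (@pder R n) (pder j f) s) y (unit_vec R i).
Proof.
move=> fB s y yD s2; have := fB (rcons s j) y yD.
by rewrite size_rcons -cats1 foldr_cat/=; exact.
Qed.

(* The reference point [w] of the derivative need not be an end point. *)
Lemma taylor1 f a b B w z z' :
  (forall s y, box a b y -> (size s <= 2)%N -> `|foldr (@pder R n) f s y| <= B /\
  forall i, derivable (foldr (@pder R n) f s) y (unit_vec R i)) ->
  box a b w -> box a b z -> box a b z' ->
  `|f z' - f z - \sum_k pder k f w * (z' - z) 0 k|
    <= B * (l1 (z - w) + l1 (z' - w)) * l1 (z' - z).
Proof.
move=> fB hw hz hz'.
have [|zeta zetaP ->] := @mean_value_box f a b z z' _ hz hz'.
  by move=> y yD i; have [//|_] := fB [::] y yD; exact.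
rewrite -sumrB; under eq_bigr do rewrite -mulrBl.
apply: norm_sum_mul_le => k; have [zetaD /(@between_l1 z z' w) zw] := zetaP k.
have B0 : 0 <= B by apply: le_trans (fB [::] w hw isT).1.
apply: (le_trans (y := B * l1 (zeta k - w))); last by rewrite ler_wpM2l.
apply: (@pder_lipschitz (pder k f) a b) => // y yD i; split.
  by have [//|_] := fB [:: k] y yD; exact.
by have [] := fB [:: i; k] y yD.
Qed.

Lemma is_derive_coord (i k : 'I_n) x :
  is_derive x (unit_vec R k) (fun y : 'rV[R]_n => y 0 i) (i == k)%:R.
Proof.
apply: DeriveDef; first exact/diff_derivable/differentiable_coord.
rewrite /derive; apply: cvg_lim => //.
apply: cvg_near_cst; near=> h; rewrite /= !mxE addrK /= scalerA mulVf ?scale1r//.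
by near: h; exact: nbhs_dnbhs_neq.
Unshelve. all: by end_near. Qed.

(** Subtract from [f] the linear part at [z] and the quadratic form given by the Hessian at the free
    point [w]. As this Hessian is symmetric, the partial derivatives of the difference are the
    functions [dT k], which are first order remainders of [pder k f]; the mean value theorem
    followed by [taylor1] for [pder k f] gives the bound. *)
Lemma taylor2 f a b B w z z' : derivs_bounded (box a b) f B ->
  (forall i j, pder i (pder j f) w = pder j (pder i f) w) ->
  box a b w -> box a b z -> box a b z' ->
  `|f z' - f z - \sum_k pder k f z * (z' - z) 0 k
     - 2^-1 * \sum_k \sum_i pder i (pder k f) w * (z' - z) 0 i * (z' - z) 0 k|
    <= B * (2 * l1 (z - w) + l1 (z' - w)) * l1 (z' - z) ^+ 2.
Proof.
move=> fB sym hw hz hz'.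
pose H i k := pder i (pder k f) w.
pose T := (fun y => f y) \- (fun y => \sum_k pder k f z * y 0 k)
  \- (fun y => 2^-1 * \sum_k (\sum_i H i k * (y 0 i - z 0 i)) * (y 0 k - z 0 k)).
pose dT k y := pder k f y - pder k f z - \sum_i H i k * (y - z) 0 i.
have TD y i : box a b y -> is_derive y (unit_vec R i) T (dT i y).
  move=> yD.
  have d1 : is_derive y (unit_vec R i) (fun y => f y) (pder i f y).
    by apply: DeriveDef => //; have [//|_] := fB [::] y yD; exact.
  have dc k := is_derive_coord k i y.
  have dz k : is_derive y (unit_vec R i) (fun y : 'rV[R]_n => y 0 k - z 0 k)
      (k == i)%:R.
    have := is_deriveB (dc k) (is_derive_cst (z 0 k) y (unit_vec R i)).
    by rewrite subr0.
  have d2 : is_derive y (unit_vec R i) (fun y : 'rV[R]_n => \sum_k pder k f z * y 0 k)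
      (\sum_k pder k f z * (k == i)%:R).
    rewrite (_ : (fun _ => _) = \sum_k (pder k f z *: (fun y : 'rV[R]_n => y 0 k))).
      by apply: is_derive_sum => k; exact: is_deriveZ.
    by apply/funext => u; rewrite fct_sumE.
  have d3 k : is_derive y (unit_vec R i)
      (fun y : 'rV[R]_n => \sum_j H j k * (y 0 j - z 0 j)) (\sum_j H j k * (j == i)%:R).
    rewrite (_ : (fun _ => _) =
        \sum_j (H j k *: (fun y : 'rV[R]_n => y 0 j - z 0 j))).
      by apply: is_derive_sum => j; exact: is_deriveZ.
    by apply/funext => u; rewrite fct_sumE.
  have d4 : is_derive y (unit_vec R i)
      (fun y => 2^-1 * \sum_k (\sum_i H i k * (y 0 i - z 0 i)) * (y 0 k - z 0 k))
      (2^-1 * \sum_k ((\sum_j H j k * (y 0 j - z 0 j)) * (k == i)%:R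
         + (y 0 k - z 0 k) * \sum_j H j k * (j == i)%:R)).
    rewrite (_ : (fun _ => _) = 2^-1 *: \sum_k
       ((fun y : 'rV[R]_n => \sum_i H i k * (y 0 i - z 0 i)) *
        (fun y : 'rV[R]_n => y 0 k - z 0 k))).
      by apply: is_deriveZ; apply: is_derive_sum => k; exact: is_deriveM.
    apply/funext => u; rewrite [RHS]/(_ *: _)/=; congr (_ * _).
    by rewrite fct_sumE.
  have delta (g : 'I_n -> R) : \sum_k g k * (k == i)%:R = g i.
    rewrite (bigD1 i)//= eqxx mulr1 big1 ?addr0// => k /negbTE ->.
    by rewrite mulr0.
  have := is_deriveB (is_deriveB d1 d2) d4.
  rewrite big_split/= !delta; congr is_derive.
  under [X in 2^-1 * (_ + X)]eq_bigr do rewrite delta.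
  rewrite /dT; congr (_ - _).
  rewrite -big_split mulr_sumr/=; apply: eq_bigr => k _.
  by rewrite !mxE /H (sym i k); lra.
have [|zeta zetaB E] := @mean_value R n T dT z z'.
  by move=> y /(between_box hz hz') yD i; exact: TD.
have -> : f z' - f z - \sum_k pder k f z * (z' - z) 0 k
    - 2^-1 * \sum_k \sum_i H i k * (z' - z) 0 i * (z' - z) 0 k = T z' - T z.
  rewrite /T /=.
  have -> : \sum_k pder k f z * (z' - z) 0 k =
      \sum_k pder k f z * z' 0 k - \sum_k pder k f z * z 0 k.
    by rewrite -sumrB; apply: eq_bigr => k _; rewrite !mxE mulrBr.
  have -> : \sum_k (\sum_i H i k * (z 0 i - z 0 i)) * (z 0 k - z 0 k) = 0.
    by rewrite big1// => k _; rewrite subrr mulr0.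
  have -> : \sum_k (\sum_i H i k * (z' 0 i - z 0 i)) * (z' 0 k - z 0 k) =
     \sum_k \sum_i H i k * (z' - z) 0 i * (z' - z) 0 k.
    apply: eq_bigr => k _; rewrite mulr_suml; apply: eq_bigr => i _.
    by rewrite !mxE.
  by ring.
have B0 : 0 <= B by apply: le_trans (fB [::] w hw isT).1.
rewrite E (eq_bigr (fun k => dT k (zeta k) * (z' - z) 0 k)); last first.
  by move=> k _; rewrite !mxE.
rewrite exprS expr1 mulrA; apply: norm_sum_mul_le => k.
have zk := zetaB k.
have := @taylor1 (pder k f) a b B w z (zeta k) (derivs_bounded_pder k fB) hw hz
  (between_box hz hz' zk).
rewrite -/(dT k _) => /le_trans; apply.
rewrite -!mulrA ler_wpM2l// ler_pM ?addr_ge0 ?l1_ge0//.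
  by have := between_l1 w zk; lra.
exact: between_l1_left.
Qed.

End box.

(** * Symmetry of second partial derivatives *)

Section symmetry.
Context (R : realType) (n : nat).
Implicit Types (f : 'rV[R]_n -> R) (x y z : 'rV[R]_n) (U : set 'rV[R]_n).

Lemma is_derive_shift f c y e df :
  is_derive (y + c) e f df -> is_derive y e (fun x => f (x + c)) df.
Proof.
move=> [fd fE].
have E : (fun h : R => h^-1 *: (((fun x => f (x + c)) \o shift y) (h *: e)
   - f (y + c))) =
   (fun h : R => h^-1 *: ((f \o shift (y + c)) (h *: e) - f (y + c))).
  by apply/funext => h /=; rewrite addrA.
by split; rewrite /derivable /derive E.
Qed.

(** The mean value theorem is applied in direction [i] to the [j]-difference of [f], then in
    direction [j] to [pder i f]. The second difference is symmetric in [i] and [j], while the order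
    of derivation on the right is not. *)
Lemma second_difference f i j z (h : R) :
  (forall s t, between 0 h s -> between 0 h t ->
     derivable f (z + s *: unit_vec R i + t *: unit_vec R j) (unit_vec R i) /\
     derivable (pder i f) (z + s *: unit_vec R i + t *: unit_vec R j)
       (unit_vec R j)) ->
  exists s t, [/\ between 0 h s, between 0 h t &
    f (z + h *: unit_vec R i + h *: unit_vec R j) - f (z + h *: unit_vec R i)
    - f (z + h *: unit_vec R j) + f z =
    pder j (pder i f) (z + s *: unit_vec R i + t *: unit_vec R j) * h * h].
Proof.
move=> df.
have b0 : between 0 h 0 by rewrite /between ge_min le_max lexx.
have bh : between 0 h h by rewrite /between ge_min le_max lexx !orbT.
pose F := (fun y => f (y + h *: unit_vec R j)) \- f.
have [|s sb E] := @mean_value_dir R n F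
  (fun y => pder i f (y + h *: unit_vec R j) - pder i f y) z (unit_vec R i) h.
  move=> s sb; apply: is_deriveB.
    by apply: is_derive_shift; apply: DeriveDef => //; have [] := df s h sb bh.
  apply: DeriveDef => //; have [] := df s 0 sb b0; by rewrite scale0r addr0.
have [|t tb E'] := @mean_value_dir R n (pder i f) (pder j (pder i f))
    (z + s *: unit_vec R i) (unit_vec R j) h.
  by move=> t tb; apply: DeriveDef => //; have [] := df s t sb tb.
exists s, t; split=> //; rewrite -E' -E /F /=; ring.
Qed.

(** Used in both orders on the same small square, [second_difference] represents one quotient by
    either mixed derivative at a nearby point. Continuity of both mixed derivatives at [z] then
    makes them differ by at most any [e]. *)
Lemma schwarz f U i j z : open U -> smooth_on U f -> U z ->
  pder i (pder j f) z = pder j (pder i f) z.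
Proof.
move=> oU fU Uz; apply/eqP; rewrite -subr_eq0 -normr_le0.
apply/ler_addgt0Pl => e e0; rewrite addr0.
have e2 : 0 < e / 2 by rewrite divr_gt0.
have c k l : \forall y \near z, `|pder k (pder l f) z - pder k (pder l f) y| < e / 2.
  have [/= + _] := fU [:: k; l] z Uz.
  by move=> /cvgrPdist_lt/(_ _ e2).
have close (A A' p p' : R) : `|A - p| < e / 2 -> `|A' - p'| < e / 2 -> p = p' ->
    `|A' - A| <= e.
  by rewrite ler_distl !ltr_distl => /andP[? ?] /andP[? ?] ?; lra.
have nU : nbhs z U by apply: open_nbhs_nbhs; split.
have nV := filterI nU (filterI (c i j) (c j i)).
have [d /= d0 dP] := (nbhs_ballP _ _).1 (nV _ _).
(* Moving by at most [h] in each of two directions stays in the ball, as [h + h < d]. *)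
pose h := d / 3.
have h0 : 0 < h by rewrite divr_gt0.
have inU k l s t : between 0 h s -> between 0 h t ->
    ball z d (z + s *: unit_vec R k + t *: unit_vec R l).
  rewrite /between (min_l (ltW h0)) (max_r (ltW h0)) => /andP[s0 sh] /andP[t0 th].
  split=> // a b; rewrite /ball/= !mxE/= opprD addrA opprD addrA subrr add0r.
  rewrite -opprD normrN.
  have [u0 u1] : 0 <= (((a == 0) && (b == k))%:R : R) /\ 
      (((a == 0) && (b == k))%:R : R) <= 1 by case: (_ && _).
  have [v0 v1] : 0 <= (((a == 0) && (b == l))%:R : R) /\ 
      (((a == 0) && (b == l))%:R : R) <= 1 by case: (_ && _).
  rewrite ger0_norm; last by rewrite addr_ge0// mulr_ge0.
  rewrite (@le_lt_trans _ _ (h + h))//; last by rewrite /h; lra.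
  by rewrite lerD// -[leRHS]mulr1 ler_pM.
have [s [t [sb tb E]]] := @second_difference f i j z h (fun s t sb tb =>
  let Uy := (dP _ (inU i j s t sb tb)).1 in
  conj ((fU [::] _ Uy).2 i) ((fU [:: i] _ Uy).2 j)).
have [s' [t' [sb' tb' E']]] := @second_difference f j i z h (fun s t sb tb =>
  let Uy := (dP _ (inU j i s t sb tb)).1 in
  conj ((fU [::] _ Uy).2 j) ((fU [:: j] _ Uy).2 i)).
have [_ [_ q1]] := dP _ (inU i j s t sb tb).
have [_ [q2 _]] := dP _ (inU j i s' t' sb' tb').
apply: (close _ _ _ _ q1 q2).
 apply: (mulIf (lt0r_neq0 h0)); apply: (mulIf (lt0r_neq0 h0)).
  have Eq : z + h *: unit_vec R i + h *: unit_vec R j =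
      z + h *: unit_vec R j + h *: unit_vec R i by rewrite addrAC.
  apply: etrans (esym E) _; apply: etrans E'; rewrite Eq.
  by congr (_ + _); exact: addrAC.
Qed.

End symmetry.

(** * Real inequalities behind the third order remainder of one time step *)

Section scalar_estimates.
Context (R : realDomainType).

Lemma abs_mul_le (x y a b c : R) : `|x| <= a -> `|y| <= b -> a * b <= c ->
  - c <= x * y <= c.
Proof.
move=> xa yb ab; rewrite -ler_norml normrM (le_trans _ ab)//.
by rewrite ler_pM.
Qed.

Lemma abs_le (x a : R) : `|x| <= a -> - a <= x <= a.
Proof. by rewrite ler_norml. Qed.

End scalar_estimates.

Section remainders.
Context (R : realFieldType).
Variables (B q t : R).
Hypotheses (B0 : 0 <= B) (t0 : 0 <= t) (tq : t <= q).

Let q0 : 0 <= q. Proof. exact: le_trans tq. Qed.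
Let BqN : 0 <= B * q. Proof. exact: mulr_ge0. Qed.
Let BqqtN : 0 <= B * q * q * t. Proof. by rewrite !mulr_ge0. Qed.
Let Bqtt : B * q * t * t <= B * q * q * t.
Proof. by rewrite -!mulrA ler_wpM2l// ler_wpM2l// ler_wpM2r. Qed.

Section theta.
Variables (eu ev ev1 ar at_ ae a psm ps : R) (dr0 dt0 de0 dt1 hr ht he : R).
Hypotheses (h1 : `|eu - ev - (ar * dr0 + at_ * dt0 + ae * de0)| <= 2 * B * q * q)
  (h2 : `|ev1 - ev - (ar * hr + at_ * ht + ae * he)| <= 2 * B * q * t)
  (h3 : `|a - at_| <= B * q)
  (h4 : `|psm - ps - ev * ht - 2^-1 * (at_ * ht ^+ 2)| <= 3 * B * q * t ^+ 2)
  (dt0q : `|dt0| <= q) (dt1q : `|dt1| <= q) (htt : `|ht| <= t).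

(** Here [dr0], [dt0], [de0], [dt1] stand for solution minus perturbed solution at the old and new
    levels, and [hr], [ht], [he] for the increments of the perturbed solution; [q] bounds the former
    and [t] the latter. The hypotheses are Taylor expansions at the old perturbed state. Once they
    are inserted, the second order terms cancel, and each error is a product of [B], two factors of
    size [q] and one of size [t]. *)
Lemma theta_remainder :
  (eu - ev) * ht - (ev1 - ev) * dt1
  - ((ar * dr0 + ae * de0) * ht - (ar * hr + ae * he) * dt1)
  + 2^-1 * a * (2 * (dt1 - dt0) * ht + ht ^+ 2)
  - (psm - ps - ev * ht) <= 11 * (B * q * q * t).
Proof.
have dq : `|2 * (dt1 - dt0) + ht| <= 5 * q.
  have tq' := tq; move: dt0q dt1q htt => /abs_le ? /abs_le ? /abs_le ?.
  by rewrite ler_norml; lra.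
have p1 := abs_mul_le h1 htt (lexx _).
have p2 := abs_mul_le h2 dt1q (lexx _).
have p3 : - (5 * (B * q * q * t)) <= (a - at_) * ((2 * (dt1 - dt0) + ht) * ht)
    <= 5 * (B * q * q * t).
  apply: (abs_mul_le (b := 5 * q * t) h3); last by lra.
  by rewrite normrM ler_pM.
by have p4 := abs_le h4; have Bqtt' := Bqtt; have BqqtN' := BqqtN; lra.
Qed.
End theta.

Section implicit.
Variables (r1u e1u r1 e1 r0 e0 rm em V1 Vm hrr hre hee hrt het
  a11 a12 a21 a22 : R) (dr0 de0 dr1 de1 dt1 hr ht he : R).
Hypotheses
  (h1 : `|r1u - r1 - (hrr * dr1 + hrt * dt1 + hre * de1)| <= 2 * B * q * q)
  (h2 : `|e1u - e1 - (hre * dr1 + het * dt1 + hee * de1)| <= 2 * B * q * q)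
  (h3 : `|r1 - r0 - (hrr * hr + hrt * ht + hre * he)| <= 2 * B * q * t)
  (h4 : `|e1 - e0 - (hre * hr + het * ht + hee * he)| <= 2 * B * q * t)
  (h5 : `|rm - r0 - hrt * ht| <= 2 * B * q * t)
  (h6 : `|em - e0 - het * ht| <= 2 * B * q * t)
  (h7 : `|V1 - Vm - (rm * hr + em * he) - 2^-1 * (hrr * hr ^+ 2 +
     2 * hre * hr * he + hee * he ^+ 2)| <= 3 * B * q * t ^+ 2)
  (a11B : `|a11 - hrr| <= B * q) (a12B : `|a12 - hre| <= B * q)
  (a21B : `|a21 - hre| <= B * q) (a22B : `|a22 - hee| <= B * q)
  (dr0q : `|dr0| <= q) (de0q : `|de0| <= q) (dr1q : `|dr1| <= q)
  (de1q : `|de1| <= q) (dt1q : `|dt1| <= q)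
  (hrt_ : `|hr| <= t) (htt : `|ht| <= t) (het_ : `|he| <= t).

Let quad x y := a11 * x ^+ 2 + (a12 + a21) * x * y + a22 * y ^+ 2.

(** Hessian entries at an intermediate point differ from those at the reference point by at most
    [B * q]. The polynomial factors come from the value of a quadratic form at the sum of two
    vectors minus its value at one of them, so each contains an increment bounded by [t]. *)
Lemma quad_bounds :
  [/\ - (5 * (B * q * q * t)) <= (a11 - hrr) * (2 * (dr1 - dr0) * hr + hr ^+ 2)
      <= 5 * (B * q * q * t),
      - (5 * (B * q * q * t)) <= (a12 - hre) * ((dr1 - dr0) * he + (de1 - de0) * hr + hr * he)
      <= 5 * (B * q * q * t),
      - (5 * (B * q * q * t)) <= (a21 - hre) * ((dr1 - dr0) * he + (de1 - de0) * hr + hr * he)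
      <= 5 * (B * q * q * t) &
      - (5 * (B * q * q * t)) <= (a22 - hee) * (2 * (de1 - de0) * he + he ^+ 2)
      <= 5 * (B * q * q * t)].
Proof.
have ddr : `|dr1 - dr0| <= 2 * q by rewrite (le_trans (ler_normB _ _))// mulr_natl mulr2n lerD.
have dde : `|de1 - de0| <= 2 * q by rewrite (le_trans (ler_normB _ _))// mulr_natl mulr2n lerD.
have rr (x y : R) : `|x| <= 2 * q -> `|y| <= t -> - (5 * q * t) <= 2 * x * y + y ^+ 2
    <= 5 * q * t.
  move=> xq yt.
  have xy := abs_mul_le xq yt (lexx _).
  have yy : - (q * t) <= y * y <= q * t by apply: (abs_mul_le yt yt); rewrite ler_wpM2r.
  by lra.
have re : - (5 * q * t) <= (dr1 - dr0) * he + (de1 - de0) * hr + hr * he <= 5 * q * t.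
  have xy := abs_mul_le ddr het_ (lexx _).
  have xy' := abs_mul_le dde hrt_ (lexx _).
  have yy : - (q * t) <= hr * he <= q * t.
    by apply: (abs_mul_le hrt_ het_); rewrite ler_wpM2r.
  by lra.
split; (apply: (abs_mul_le (b := 5 * q * t)); [eassumption| |lra]);
  by rewrite ler_norml ?re ?rr.
Qed.

(** The counterpart for the convex part, whose split derivative is taken at the new time level. The
    two coupling terms with [hrt] and [het] are kept on the left, since [assemble] cancels them
    against those of the temperature part. *)
Lemma implicit_remainder :
  (r1u - r1) * hr + (e1u - e1) * he + r1 * (dr1 - dr0) + e1 * (de1 - de0)
  - r1 * dr1 - e1 * de1 + r0 * dr0 + e0 * de0
  + (r1 * hr + e1 * he - (V1 - Vm))
  - 2^-1 * (quad (hr + (dr1 - dr0)) (he + (de1 - de0)) - quad (dr1 - dr0) (de1 - de0))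
  + (hrt * dr0 + het * de0) * ht - (hrt * hr + het * he) * dt1
  <= 40 * (B * q * q * t).
Proof.
have [c1 c2 c3 c4] := quad_bounds.
have p1 := abs_mul_le h1 hrt_ (lexx _).
have p2 := abs_mul_le h2 het_ (lexx _).
have p3 := abs_mul_le h3 dr0q (lexx _).
have p4 := abs_mul_le h4 de0q (lexx _).
have p3' := abs_mul_le h3 hrt_ (lexx _).
have p4' := abs_mul_le h4 het_ (lexx _).
have p5 := abs_mul_le h5 hrt_ (lexx _).
have p6 := abs_mul_le h6 het_ (lexx _).
have p7 := abs_le h7.
have Bqtt' := Bqtt; have BqqtN' := BqqtN.
by rewrite /quad; lra.
Qed.

End implicit.

Section explicit.
Variables (rmu emu r1 e1 r0 e0 rm em V1 Vm hrr hre hee hrt het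
  a11 a12 a21 a22 : R) (dr0 de0 dr1 de1 dt1 hr ht he : R).
Hypotheses
  (h1 : `|rmu - rm - (hrr * dr0 + hrt * dt1 + hre * de0)| <= 2 * B * q * q)
  (h2 : `|emu - em - (hre * dr0 + het * dt1 + hee * de0)| <= 2 * B * q * q)
  (h3 : `|r1 - r0 - (hrr * hr + hrt * ht + hre * he)| <= 2 * B * q * t)
  (h4 : `|e1 - e0 - (hre * hr + het * ht + hee * he)| <= 2 * B * q * t)
  (h5 : `|rm - r0 - hrt * ht| <= 2 * B * q * t)
  (h6 : `|em - e0 - het * ht| <= 2 * B * q * t)
  (h7 : `|V1 - Vm - (rm * hr + em * he) - 2^-1 * (hrr * hr ^+ 2 +
     2 * hre * hr * he + hee * he ^+ 2)| <= 3 * B * q * t ^+ 2)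
  (a11B : `|a11 - hrr| <= B * q) (a12B : `|a12 - hre| <= B * q)
  (a21B : `|a21 - hre| <= B * q) (a22B : `|a22 - hee| <= B * q)
  (dr0q : `|dr0| <= q) (de0q : `|de0| <= q) (dr1q : `|dr1| <= q)
  (de1q : `|de1| <= q) (dt1q : `|dt1| <= q)
  (hrt_ : `|hr| <= t) (htt : `|ht| <= t) (het_ : `|he| <= t).

Let quad x y := a11 * x ^+ 2 + (a12 + a21) * x * y + a22 * y ^+ 2.

(** For the concave part the split derivative is taken at old rho and eta and new temperature, the
    state marked by [m]. Its Taylor formula is centred there instead of at the new state, whence the
    opposite sign of the quadratic term. *)
Lemma explicit_remainder :
  (rmu - rm) * hr + (emu - em) * he + rm * (dr1 - dr0) + em * (de1 - de0)
  - r1 * dr1 - e1 * de1 + r0 * dr0 + e0 * de0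
  + (rm * hr + em * he - (V1 - Vm))
  + 2^-1 * (quad (hr + (dr1 - dr0)) (he + (de1 - de0)) - quad (dr1 - dr0) (de1 - de0))
  + (hrt * dr0 + het * de0) * ht - (hrt * hr + het * he) * dt1
  <= 40 * (B * q * q * t).
Proof.
have [c1 c2 c3 c4] := quad_bounds a11B a12B a21B a22B dr0q de0q dr1q de1q hrt_ het_.
have p1 := abs_mul_le h1 hrt_ (lexx _).
have p2 := abs_mul_le h2 het_ (lexx _).
have p3 := abs_mul_le h3 dr1q (lexx _).
have p4 := abs_mul_le h4 de1q (lexx _).
have p5 := abs_mul_le h5 dr0q (lexx _).
have p6 := abs_mul_le h6 de0q (lexx _).
have p5' := abs_mul_le h5 dr1q (lexx _).
have p6' := abs_mul_le h6 de1q (lexx _).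
have p7 := abs_le h7.
have Bqtt' := Bqtt; have BqqtN' := BqqtN.
by rewrite /quad; lra.
Qed.

End explicit.
End remainders.

(** * Coordinates of states and quadratic forms in the pair (rho, eta) *)

Section coordinates.
Context (R : realType).
Implicit Types (r t e : R).

Lemma st_rho r t e : st r t e 0 irho = r. Proof. by rewrite mxE. Qed.
Lemma st_theta r t e : st r t e 0 itheta = t. Proof. by rewrite mxE. Qed.
Lemma st_eta r t e : st r t e 0 ieta = e. Proof. by rewrite mxE. Qed.
Definition stE := (st_rho, st_theta, st_eta).

Lemma forall3 (P : 'I_3 -> Prop) : P irho -> P itheta -> P ieta -> forall i, P i.
Proof.
move=> p0 p1 p2 [[|[|[|//]]] i3].
- by rewrite (_ : Ordinal i3 = irho)//; exact: val_inj.
- by rewrite (_ : Ordinal i3 = itheta)//; exact: val_inj.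
- by rewrite (_ : Ordinal i3 = ieta)//; exact: val_inj.
Qed.

Lemma sum3 (F : 'I_3 -> R) : \sum_k F k = F irho + F itheta + F ieta.
Proof.
rewrite !big_ord_recl big_ord0 addr0 addrA.
by congr (F _ + F _ + F _); exact: val_inj.
Qed.

Lemma st_diff r t e r' t' e' : st r' t' e' - st r t e = st (r' - r) (t' - t) (e' - e).
Proof.
by apply/rowP; apply: forall3; rewrite !mxE.
Qed.

Lemma l1_st r t e : l1 (st r t e) = `|r| + `|t| + `|e|.
Proof. by rewrite /l1 sum3 !stE. Qed.

Lemma wvecE0 r e : wvec r e 0 0 = r. Proof. by rewrite mxE. Qed.
Lemma wvecE1 r e : wvec r e 1 0 = e. Proof. by rewrite mxE. Qed.

Lemma wvec_inj r e r' e' : wvec r e = wvec r' e' -> r = r' /\ e = e'.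
Proof.
by move=> E; rewrite -(wvecE0 r e) -{2}(wvecE1 r e) E wvecE0 wvecE1.
Qed.

Lemma wvecD r e r' e' : wvec r e + wvec r' e' = wvec (r + r') (e + e').
Proof.
apply/colP => i; rewrite !mxE; case: i => [[|[|//]] i2] /=; by [].
Qed.

Lemma wvecB r e r' e' : wvec r e - wvec r' e' = wvec (r - r') (e - e').
Proof. by apply/colP => -[[|[|//]] i2]; rewrite !mxE. Qed.

Lemma wvecZ s r e : s *: wvec r e = wvec (s * r) (s * e).
Proof. by apply/colP => -[[|[|//]] i2]; rewrite !mxE. Qed.

Lemma dotE n (u v : 'cV[R]_n) : dot u v = \sum_i u i 0 * v i 0.
Proof. by rewrite /dot mxE; apply: eq_bigr => i _; rewrite mxE. Qed.

Lemma sum2 (F : 'I_2 -> R) : \sum_k F k = F 0 + F 1.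
Proof.
by rewrite !big_ord_recl big_ord0 addr0; congr (F _ + F _); exact: val_inj.
Qed.

Lemma dot_wvec (u : 'cV[R]_2) r e : dot u (wvec r e) = u 0 0 * r + u 1 0 * e.
Proof. by rewrite dotE sum2 wvecE0 wvecE1. Qed.

Lemma quad_wvec (H : 'M[R]_2) r e : dot (H *m wvec r e) (wvec r e) =
  H 0 0 * r ^+ 2 + (H 0 1 + H 1 0) * r * e + H 1 1 * e ^+ 2.
Proof.
rewrite dot_wvec !mxE !sum2 wvecE0 wvecE1.
move: (H 0 0) (H 0 1) (H 1 0) (H 1 1) => a b c d; ring.
Qed.

Lemma on_segment_between r r' c : on_segment (r : R^o) r' c -> between r r' c.
Proof.
move=> [s /andP[s0 s1] ->]; rewrite /GRing.scale/= /between.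
by case: (leP r r') => rr'; apply/andP; split; nra.
Qed.

Lemma on_segment_wvec r e r' e' c c' :
  on_segment (wvec r e) (wvec r' e') (wvec c c') ->
  between r r' c /\ between e e' c'.
Proof.
move=> [s s01]; rewrite !wvecZ wvecD => /wvec_inj[-> ->].
by split; apply: on_segment_between; exists s.
Qed.

Lemma between_refl r r' : between r r' r /\ between r r' r'.
Proof. by rewrite /between !ge_min !le_max !lexx !orbT. Qed.

Lemma iw0 : iw 0 = irho. Proof. by []. Qed.
Lemma iw1 : iw 1 = ieta. Proof. by []. Qed.

End coordinates.

(** * Taylor estimates in the variables rho, theta, eta *)

Section pointwise.
Context (R : realType).
Implicit Types (f : 'rV[R]_3 -> R) (z w p : 'rV[R]_3).

Definition symmetric_hessian (D : set 'rV[R]_3) f := forall w, D w ->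
  forall i j, pder i (pder j f) w = pder j (pder i f) w.

Lemma sum3_w (g : 'I_3 -> R) (x : 'rV[R]_3) : x 0 itheta = 0 ->
  \sum_k g k * x 0 k = g irho * x 0 irho + g ieta * x 0 ieta.
Proof. by move=> x0; rewrite sum3 x0 mulr0 addr0. Qed.

Lemma quad3_w (h : 'I_3 -> 'I_3 -> R) (x : 'rV[R]_3) : x 0 itheta = 0 ->
  h irho ieta = h ieta irho ->
  \sum_k \sum_i h i k * x 0 i * x 0 k = h irho irho * x 0 irho ^+ 2 +
    2 * h ieta irho * x 0 irho * x 0 ieta + h ieta ieta * x 0 ieta ^+ 2.
Proof. by move=> x0 hs; rewrite !sum3 x0 hs; ring. Qed.

Lemma sum3_theta (g : 'I_3 -> R) (x : 'rV[R]_3) : x 0 irho = 0 -> x 0 ieta = 0 ->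
  \sum_k g k * x 0 k = g itheta * x 0 itheta.
Proof. by move=> x0 x1; rewrite sum3 x0 x1; ring. Qed.

Lemma quad3_theta (h : 'I_3 -> 'I_3 -> R) (x : 'rV[R]_3) : x 0 irho = 0 ->
  x 0 ieta = 0 ->
  \sum_k \sum_i h i k * x 0 i * x 0 k = h itheta itheta * x 0 itheta ^+ 2.
Proof. by move=> x0 x1; rewrite !sum3 x0 x1; ring. Qed.

Variables (a b : 'rV[R]_3) (B : R).
Let D := box a b.

Lemma hess_close f v z q (k l : 'I_3) : derivs_bounded D f B -> D v -> D z ->
  l1 (z - v) <= q -> 0 <= B -> `|pder k (pder l f) z - pder k (pder l f) v| <= B * q.
Proof.
move=> fB Dv Dz zq B0; apply: (@le_trans _ _ (B * l1 (z - v))); last by rewrite ler_wpM2l.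
apply: (@pder_lipschitz _ _ _ a b) => // y Dy i; split.
  by have [//|_] := fB [:: k; l] y Dy; exact.
by have [] := fB [:: i; k; l] y Dy.
Qed.

Lemma taylor1_le f v z z' q m : derivs_bounded D f B -> 0 <= B ->
  D v -> D z -> D z' ->
  l1 (z - v) <= q -> l1 (z' - v) <= q -> l1 (z' - z) <= m -> forall k,
  `|pder k f z' - pder k f z - (pder irho (pder k f) v * (z' - z) 0 irho
     + pder itheta (pder k f) v * (z' - z) 0 itheta
     + pder ieta (pder k f) v * (z' - z) 0 ieta)| <= 2 * B * q * m.
Proof.
move=> fB B0 Dv Dz Dz' zq zq' zm k; rewrite -(sum3 (fun i => pder i (pder k f) v * (z' - z) 0 i)).
apply: (le_trans (@taylor1 _ _ (pder k f) a b B v z z' (derivs_bounded_pder k fB) _ _ _)) => //.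
have q2 : l1 (z - v) + l1 (z' - v) <= 2 * q by lra.
apply: ler_pM => //; rewrite ?mulr_ge0 ?addr_ge0 ?l1_ge0//.
by rewrite (_ : 2 * B * q = B * (2 * q)) ?ler_wpM2l//; ring.
Qed.

(** The temperature is fixed, so only the (rho, eta) block of the Hessian survives, and symmetry
    merges its two mixed entries. *)
Lemma taylor2_w_le f v r e r' e' t q m : derivs_bounded D f B -> 0 <= B ->
  symmetric_hessian D f ->
  D v -> D (st r t e) -> D (st r' t e') ->
  l1 (st r t e - v) <= q -> l1 (st r' t e' - v) <= q ->
  l1 (st r' t e' - st r t e) <= m ->
  `|f (st r' t e') - f (st r t e) - (pder irho f (st r t e) * (r' - r)
     + pder ieta f (st r t e) * (e' - e)) - 2^-1 *
     (pder irho (pder irho f) v * (r' - r) ^+ 2 +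
     2 * pder ieta (pder irho f) v * (r' - r) * (e' - e) +
     pder ieta (pder ieta f) v * (e' - e) ^+ 2)| <= 3 * B * q * m ^+ 2.
Proof.
move=> fB B0 sym Dv Dz Dz' zq zq' zm.
have := @taylor2 _ _ f a b B v (st r t e) (st r' t e') fB (sym v Dv) Dv Dz Dz'.
have dE : st r' t e' - st r t e = st (r' - r) 0 (e' - e) by rewrite st_diff subrr.
have d0 : (st r' t e' - st r t e) 0 itheta = 0 by rewrite dE stE.
rewrite (sum3_w (fun k => pder k f (st r t e)) d0).
rewrite (quad3_w (h := fun i k => pder i (pder k f) v) d0 (sym _ Dv irho ieta)).
rewrite [in X in X <= _ -> _]dE !stE.
move=> H; apply: (le_trans H).
have q3 : 2 * l1 (st r t e - v) + l1 (st r' t e' - v) <= 3 * q by lra.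
apply: ler_pM.
- by rewrite mulr_ge0// addr_ge0 ?mulr_ge0 ?l1_ge0.
- by rewrite exprn_ge0 ?l1_ge0.
- by rewrite (_ : 3 * B * q = B * (3 * q)) ?ler_wpM2l//; ring.
- by rewrite lerXn2r ?nnegrE ?l1_ge0// (le_trans _ zm) ?l1_ge0.
Qed.

Lemma taylor2_theta_le f r t e t' q m : derivs_bounded D f B -> 0 <= B ->
  symmetric_hessian D f -> D (st r t e) -> D (st r t' e) ->
  l1 (st r t' e - st r t e) <= q -> l1 (st r t' e - st r t e) <= m ->
  `|f (st r t' e) - f (st r t e) - pder itheta f (st r t e) * (t' - t)
   - 2^-1 * (pder itheta (pder itheta f) (st r t e) * (t' - t) ^+ 2)|
  <= 3 * B * q * m ^+ 2.
Proof.
move=> fB B0 sym Dz Dz' zq zm.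
have := @taylor2 _ _ f a b B (st r t e) (st r t e) (st r t' e) fB (sym _ Dz) Dz Dz Dz'.
have dE : st r t' e - st r t e = st 0 (t' - t) 0 by rewrite st_diff !subrr.
have d0 : (st r t' e - st r t e) 0 irho = 0 by rewrite dE stE.
have d1 : (st r t' e - st r t e) 0 ieta = 0 by rewrite dE stE.
rewrite (sum3_theta (fun k => pder k f (st r t e)) d0 d1).
rewrite (quad3_theta (fun i k => pder i (pder k f) (st r t e)) d0 d1).
rewrite [in X in X <= _ -> _]dE !stE.
move=> H; apply: (le_trans H).
have -> : l1 (st r t e - st r t e) = 0.
  by rewrite subrr [l1 0]big1// => i _; rewrite mxE normr0.
rewrite mulr0 add0r.
apply: ler_pM.
- by rewrite mulr_ge0 ?l1_ge0.
- by rewrite exprn_ge0 ?l1_ge0.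
- rewrite (_ : 3 * B * q = B * (3 * q)); last by ring.
  by rewrite ler_wpM2l//; have := l1_ge0 (st r t' e - st r t e); lra.
- by rewrite lerXn2r ?nnegrE ?l1_ge0// (le_trans _ zm) ?l1_ge0.
Qed.

End pointwise.

(** * Pointwise change of the relative entropy in one time step *)

Section energy_difference.
Context (R : realType).

Lemma l1_st_le (x y z m : R) : l1 (st x y z) <= m ->
  [/\ `|x| <= m, `|y| <= m & `|z| <= m].
Proof.
rewrite l1_st; have := normr_ge0 x; have := normr_ge0 y; have := normr_ge0 z.
by move=> ? ? ? ?; split; lra.
Qed.

Lemma quad_wvecB (H G : 'M[R]_2) x y :
  dot ((H - G) *m wvec x y) (wvec x y) =
  (H 0 0 * x ^+ 2 + (H 0 1 + H 1 0) * x * y + H 1 1 * y ^+ 2)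
  - (G 0 0 * x ^+ 2 + (G 0 1 + G 1 0) * x * y + G 1 1 * y ^+ 2).
Proof.
rewrite quad_wvec !mxE.
move: (H 0 0) (H 0 1) (H 1 0) (H 1 1) (G 0 0) (G 0 1) (G 1 0) (G 1 1) => *; ring.
Qed.

(** The density of the relative entropy without its gradient terms. It is a mixed Bregman distance:
    the tangent in theta is taken at the first state, those in rho and eta at the second. *)
Definition pot (psi : 'rV[R]_3 -> R) r t e r' t' e' :=
  psi (st r t e) - psi (st r' t' e') - pder itheta psi (st r t e) * (t - t')
  - pder irho psi (st r' t' e') * (r - r') - pder ieta psi (st r' t' e') * (e - e').

Let quad (a11 a12 a21 a22 x y : R) :=
  a11 * x ^+ 2 + (a12 + a21) * x * y + a22 * y ^+ 2.

(** The linear algebra of [pot_step], stated for real variables so that [lra] meets no derivatives.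
    Since the mixed temperature derivatives of psi are the sums of those of its convex and concave
    parts, the coupling terms of the three remainders cancel when these are added;
    [91 = 11 + 40 + 40]. *)
Lemma assemble (r0 t0 e0 r1 t1 e1 r0' t0' e0' r1' t1' e1' : R)
  (psu1 psu0 psmu psv1 psv0 psmv Vu1 Vmu V1 Vm Ku1 Kmu K1 Km eu1 eu ev1 ev
   vr1u ve1u vr1 ve1 vr0 ve0 vrm vem krmu kemu kr1 ke1 kr0 ke0 krm kem
   vrt vet krt ket pr1 pe1 pr0 pe0 ar ae a h11 h12 h21 h22 g11 g12 g21 g22 M : R) :
  psu1 = Vu1 + Ku1 -> psmu = Vmu + Kmu -> psv1 = V1 + K1 -> psmv = Vm + Km ->
  pr1 = vr1 + kr1 -> pe1 = ve1 + ke1 -> pr0 = vr0 + kr0 -> pe0 = ve0 + ke0 ->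
  ar = vrt + krt -> ae = vet + ket ->
  psmu = psu0 + eu * (t1 - t0) + 2^-1 * a * (t1 - t0) ^+ 2 ->
  Ku1 = Kmu + (krmu * (r1 - r0) + kemu * (e1 - e0))
    + 2^-1 * quad g11 g12 g21 g22 (r1 - r0) (e1 - e0) ->
  Vmu = Vu1 + (vr1u * (r0 - r1) + ve1u * (e0 - e1))
    + 2^-1 * quad h11 h12 h21 h22 (r0 - r1) (e0 - e1) ->
  let ht := t1' - t0' in let hr := r1' - r0' in let he := e1' - e0' in
  let dr0 := r0 - r0' in let dr1 := r1 - r1' in
  let dt0 := t0 - t0' in let dt1 := t1 - t1' in
  let de0 := e0 - e0' in let de1 := e1 - e1' in
  (eu - ev) * ht - (ev1 - ev) * dt1
  - ((ar * dr0 + ae * de0) * ht - (ar * hr + ae * he) * dt1)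
  + 2^-1 * a * (2 * (dt1 - dt0) * ht + ht ^+ 2)
  - (psmv - psv0 - ev * ht) <= 11 * M ->
  (vr1u - vr1) * hr + (ve1u - ve1) * he + vr1 * (dr1 - dr0) + ve1 * (de1 - de0)
  - vr1 * dr1 - ve1 * de1 + vr0 * dr0 + ve0 * de0
  + (vr1 * hr + ve1 * he - (V1 - Vm))
  - 2^-1 * (quad h11 h12 h21 h22 (hr + (dr1 - dr0)) (he + (de1 - de0))
            - quad h11 h12 h21 h22 (dr1 - dr0) (de1 - de0))
  + (vrt * dr0 + vet * de0) * ht - (vrt * hr + vet * he) * dt1
  <= 40 * M ->
  (krmu - krm) * hr + (kemu - kem) * he + krm * (dr1 - dr0) + kem * (de1 - de0)
  - kr1 * dr1 - ke1 * de1 + kr0 * dr0 + ke0 * de0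
  + (krm * hr + kem * he - (K1 - Km))
  + 2^-1 * (quad g11 g12 g21 g22 (hr + (dr1 - dr0)) (he + (de1 - de0))
            - quad g11 g12 g21 g22 (dr1 - dr0) (de1 - de0))
  + (krt * dr0 + ket * de0) * ht - (krt * hr + ket * he) * dt1
  <= 40 * M ->
  psu1 - psv1 - eu1 * dt1 - pr1 * dr1 - pe1 * de1
  - (psu0 - psv0 - eu * dt0 - pr0 * dr0 - pe0 * de0)
  - 2^-1 * (a * (dt1 - dt0) ^+ 2)
  + 2^-1 * (quad h11 h12 h21 h22 (dr1 - dr0) (de1 - de0)
            - quad g11 g12 g21 g22 (dr1 - dr0) (de1 - de0))
  <= - ((eu1 - eu) - (ev1 - ev)) * dt1
   + ((vr1u + krmu) - (vr1 + krm)) * (dr1 - dr0)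
   + ((ve1u + kemu) - (ve1 + kem)) * (de1 - de0) + 91 * M.
Proof.
move=> -> E2 -> E3 -> -> -> -> -> -> E4 E5 E6 ht hr he dr0 dr1 dt0 dt1 de0 de1.
rewrite {}E3 => xt xV xK.
have {}E4 : psu0 = Vmu + Kmu - eu * (t1 - t0) - 2^-1 * a * (t1 - t0) ^+ 2 by lra.
rewrite {}E4 {}E5 {}E6.
move: xt xV xK; rewrite /ht /hr /he /dr0 /dr1 /dt0 /dt1 /de0 /de1 /quad.
by lra.
Qed.

Variables (a b : 'rV[R]_3) (B : R) (psi vex cav : 'rV[R]_3 -> R).
Let D := box a b.
Hypotheses (psiB : derivs_bounded D psi B) (vexB : derivs_bounded D vex B)
  (cavB : derivs_bounded D cav B) (B0 : 0 <= B)
  (psiS : symmetric_hessian D psi) (vexS : symmetric_hessian D vex)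
  (cavS : symmetric_hessian D cav)
  (split0 : forall w, D w -> psi w = vex w + cav w)
  (split1 : forall w, D w -> forall i, pder i psi w = pder i vex w + pder i cav w)
  (split2 : forall w, D w -> forall i j,
     pder i (pder j psi) w = pder i (pder j vex) w + pder i (pder j cav) w).

Lemma taylor1_st_le f v r t e r' t' e' q m : derivs_bounded D f B ->
  D v -> D (st r t e) -> D (st r' t' e') ->
  l1 (st r t e - v) <= q -> l1 (st r' t' e' - v) <= q ->
  l1 (st r' t' e' - st r t e) <= m -> forall k,
  `|pder k f (st r' t' e') - pder k f (st r t e)
    - (pder irho (pder k f) v * (r' - r) + pder itheta (pder k f) v * (t' - t)
     + pder ieta (pder k f) v * (e' - e))| <= 2 * B * q * m.
Proof.
move=> fB Dv Dz Dz' zq zq' zm k.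
by have := taylor1_le fB B0 Dv Dz Dz' zq zq' zm k; rewrite st_diff !stE.
Qed.

Local Opaque pder st.

(** The three assumed Taylor identities are those that define the numerical dissipation, so its
    potential part appears without loss. All other expansions are centred at the old perturbed state
    [v0]. The number [q] bounds the distance from [v0] of every point involved, and the error keeps
    one factor that is the increment of the perturbed state alone. *)
Lemma pot_step (r0 t0 e0 r1 t1 e1 r0' t0' e0' r1' t1' e1' xi c1 c2 c3 c4 q : R) :
  D (st r0 t0 e0) -> D (st r1 t1 e1) -> D (st r0' t0' e0') -> D (st r1' t1' e1') ->
  between t0 t1 xi -> between r0 r1 c1 -> between e0 e1 c2 ->
  between r0 r1 c3 -> between e0 e1 c4 ->
  psi (st r0 t1 e0) = psi (st r0 t0 e0)
    + pder itheta psi (st r0 t0 e0) * (t1 - t0)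
    + 2^-1 * pder itheta (pder itheta psi) (st r0 xi e0) * (t1 - t0) ^+ 2 ->
  cav (st r1 t1 e1) = cav (st r0 t1 e0)
    + dot (gradw cav (st r0 t1 e0)) (wvec r1 e1 - wvec r0 e0)
    + 2^-1 * dot (hessw cav (st c1 t1 c2) *m (wvec r1 e1 - wvec r0 e0))
        (wvec r1 e1 - wvec r0 e0) ->
  vex (st r0 t1 e0) = vex (st r1 t1 e1)
    + dot (gradw vex (st r1 t1 e1)) (wvec r0 e0 - wvec r1 e1)
    + 2^-1 * dot (hessw vex (st c3 t1 c4) *m (wvec r0 e0 - wvec r1 e1))
        (wvec r0 e0 - wvec r1 e1) ->
  l1 (st r0 t0 e0 - st r0' t0' e0') + l1 (st r1 t1 e1 - st r1' t1' e1')
    + l1 (st r1' t1' e1' - st r0' t0' e0') <= q ->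
  pot psi r1 t1 e1 r1' t1' e1' - pot psi r0 t0 e0 r0' t0' e0'
  - 2^-1 * (pder itheta (pder itheta psi) (st r0 xi e0)
      * ((t1 - t1') - (t0 - t0')) ^+ 2)
  + 2^-1 * dot
      ((hessw vex (st c3 t1 c4) - hessw cav (st c1 t1 c2))
        *m wvec ((r1 - r1') - (r0 - r0')) ((e1 - e1') - (e0 - e0')))
      (wvec ((r1 - r1') - (r0 - r0')) ((e1 - e1') - (e0 - e0')))
  <= - ((pder itheta psi (st r1 t1 e1) - pder itheta psi (st r0 t0 e0))
        - (pder itheta psi (st r1' t1' e1') - pder itheta psi (st r0' t0' e0')))
       * (t1 - t1')
   + ((pder irho vex (st r1 t1 e1) + pder irho cav (st r0 t1 e0))
      - (pder irho vex (st r1' t1' e1') + pder irho cav (st r0' t1' e0')))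
     * ((r1 - r1') - (r0 - r0'))
   + ((pder ieta vex (st r1 t1 e1) + pder ieta cav (st r0 t1 e0))
      - (pder ieta vex (st r1' t1' e1') + pder ieta cav (st r0' t1' e0')))
     * ((e1 - e1') - (e0 - e0'))
   + 91 * (B * q * q * l1 (st r1' t1' e1' - st r0' t0' e0')).
Proof.
set u0 := st r0 t0 e0; set u1 := st r1 t1 e1.
set v0 := st r0' t0' e0'; set v1 := st r1' t1' e1'.
move=> Du0 Du1 Dv0 Dv1 bxi b1 b2 b3 b4 Tt Tc Tv qE.
set t := l1 (v1 - v0) in qE *.
have s0_ge0 := l1_ge0 (u0 - v0); have s1_ge0 := l1_ge0 (u1 - v1).
have t_ge0 : 0 <= t := l1_ge0 (v1 - v0).
have tq : t <= q by lra.
have s0q : l1 (u0 - v0) <= q by lra.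
have s1q : l1 (u1 - v1) <= q by lra.
have l1D (x y z : 'rV[R]_3) : l1 (x - z) <= l1 (x - y) + l1 (y - z).
  rewrite /l1 -big_split/=; apply: ler_sum => i _; rewrite !mxE.
  by rewrite (le_trans _ (ler_normD _ _))// addrA subrK.
have u1q : l1 (u0 - v0) + l1 (u1 - v0) <= q.
  by have := l1D u1 v1 v0; rewrite -/t; lra.
(* every point entering the expansion lies in D within distance q of v0 *)
have near_u x y z : between r0 r1 x -> between t0 t1 y -> between e0 e1 z ->
    D (st x y z) /\ l1 (st x y z - v0) <= q.
  move=> bx by_ bz.
  have bt : forall i, between (u0 0 i) (u1 0 i) (st x y z 0 i).
    by apply: forall3; rewrite !stE.
  split; first exact: between_box Du0 Du1 bt.
  exact: le_trans (between_l1 v0 bt) u1q.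
have bv : forall i, between (v0 0 i) (v1 0 i) (st r0' t1' e0' 0 i).
  by apply: forall3; rewrite !stE; have [] := between_refl r0' r1';
    have [] := between_refl t0' t1'; have [] := between_refl e0' e1'.
have Dm : D (st r0' t1' e0') := between_box Dv0 Dv1 bv.
have mt : l1 (st r0' t1' e0' - v0) <= t := between_l1_left bv.
have mq := le_trans mt tq.
have m1t : l1 (v1 - st r0' t1' e0') <= t.
  by rewrite /t !st_diff !l1_st subrr normr0; have := normr_ge0 (t1' - t0'); lra.
have [r0b r1b] := between_refl r0 r1; have [t0b t1b] := between_refl t0 t1.
have [e0b e1b] := between_refl e0 e1.
have [Dmu muq] := near_u _ _ _ r0b t1b e0b.
have [_ u1v0] := near_u _ _ _ r1b t1b e1b.
have [Dxi xiq] := near_u _ _ _ r0b bxi e0b.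
have [Dc1 c1q] := near_u _ _ _ b1 t1b b2.
have [Dc3 c3q] := near_u _ _ _ b3 t1b b4.
have v0q : l1 (v0 - v0) <= q.
  by rewrite subrr [l1 0]big1 ?(le_trans t_ge0)// => i _; rewrite mxE normr0.
have muv : l1 (st r0 t1 e0 - st r0' t1' e0') <= q.
  rewrite (le_trans _ (_ : l1 (u0 - v0) + l1 (u1 - v1) <= q))//; last first.
    by lra.
  rewrite !st_diff !l1_st.
  by have := normr_ge0 (t0 - t0'); have := normr_ge0 (r1 - r1');
    have := normr_ge0 (e1 - e1'); lra.
have [dr0q dt0q de0q] : [/\ `|r0 - r0'| <= q, `|t0 - t0'| <= q & `|e0 - e0'| <= q].
  by apply: l1_st_le; rewrite -st_diff.
have [dr1q dt1q de1q] : [/\ `|r1 - r1'| <= q, `|t1 - t1'| <= q & `|e1 - e1'| <= q].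
  by apply: l1_st_le; rewrite -st_diff.
have [hrt htt het] : [/\ `|r1' - r0'| <= t, `|t1' - t0'| <= t & `|e1' - e0'| <= t].
  by apply: l1_st_le; rewrite -st_diff.
have T f := @taylor1_st_le f v0.
(* Between [v0] and the mixed state with new temperature, only the temperature moves. *)
have Etheta (x y z : R) : x * (r0' - r0') + y * (t1' - t0') + z * (e0' - e0') =
  y * (t1' - t0') by ring.
have H f := @hess_close R a b B f v0.
have gradw0 f z : gradw f z 0 0 = pder irho f z by rewrite mxE.
have gradw1 f z : gradw f z 1 0 = pder ieta f z by rewrite mxE.
move: Tt Tc Tv; rewrite !wvecB quad_wvecB !quad_wvec !dot_wvec !gradw0 !gradw1.
move=> Tt Tc Tv.
(* Symmetry turns derivatives of the energy in rho and eta into temperature derivatives of the split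
   parts, as needed for the cancellation in [assemble]. *)
have eir i (Di : D v0) : pder i (pder itheta psi) v0 =
    pder itheta (pder i vex) v0 + pder itheta (pder i cav) v0.
  by rewrite psiS// split2.
apply: (@assemble r0 t0 e0 r1 t1 e1 r0' t0' e0' r1' t1' e1'
  _ _ _ _ _ _ _ _ _ _ _ _ _ _ _ _ _ _ _ _ _ _ _ _
  (pder irho vex (st r0' t1' e0')) (pder ieta vex (st r0' t1' e0')) _ _ _ _ _ _ _ _
  _ _ _ _ _ _ _ _ _ _ _ _ _ _ _ _ _ _ _ (B * q * q * t)
  (split0 Du1) (split0 Dmu) (split0 Dv1) (split0 Dm) 
  (split1 Dv1 irho) (split1 Dv1 ieta) (split1 Dv0 irho) (split1 Dv0 ieta)
  (eir irho Dv0) (eir ieta Dv0) Tt Tc Tv).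
- apply: (@theta_remainder R B q t B0 t_ge0 tq _ _ _ _
    (pder itheta (pder itheta psi) v0)) => //.
  + exact: (T psi _ _ _ _ _ _ _ _ psiB Dv0 Dv0 Du0 v0q s0q s0q itheta).
  + exact: (T psi _ _ _ _ _ _ _ _ psiB Dv0 Dv0 Dv1 v0q tq (lexx _) itheta).
  + exact: (H psi _ _ _ _ psiB Dv0 Dxi xiq B0).
  + exact: (taylor2_theta_le psiB B0 psiS Dv0 Dm mq mt).
- apply: (@implicit_remainder R B q t B0 t_ge0 tq _ _ _ _ _ _ _ _ _ _
    (pder irho (pder irho vex) v0) (pder ieta (pder irho vex) v0)
    (pder ieta (pder ieta vex) v0)) => //.
  + exact: (T vex _ _ _ _ _ _ _ _ vexB Dv0 Dv1 Du1 tq u1v0 s1q irho).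
  + rewrite (vexS Dv0 ieta irho).
    exact: (T vex _ _ _ _ _ _ _ _ vexB Dv0 Dv1 Du1 tq u1v0 s1q ieta).
  + exact: (T vex _ _ _ _ _ _ _ _ vexB Dv0 Dv0 Dv1 v0q tq (lexx _) irho).
  + rewrite (vexS Dv0 ieta irho).
    exact: (T vex _ _ _ _ _ _ _ _ vexB Dv0 Dv0 Dv1 v0q tq (lexx _) ieta).
  + have := T vex _ _ _ _ _ _ _ _ vexB Dv0 Dv0 Dm v0q mq mt irho.
    by rewrite Etheta; apply.
  + have := T vex _ _ _ _ _ _ _ _ vexB Dv0 Dv0 Dm v0q mq mt ieta.
    by rewrite Etheta; apply.
  + exact: (taylor2_w_le vexB B0 vexS Dv0 Dm Dv1 mq tq m1t).
  + by rewrite mxE; exact: (H vex _ _ _ _ vexB Dv0 Dc3 c3q B0).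
  + by rewrite mxE (vexS Dv0 ieta irho); exact: (H vex _ _ _ _ vexB Dv0 Dc3 c3q B0).
  + by rewrite mxE; exact: (H vex _ _ _ _ vexB Dv0 Dc3 c3q B0).
  + by rewrite mxE; exact: (H vex _ _ _ _ vexB Dv0 Dc3 c3q B0).
- apply: (@explicit_remainder R B q t B0 t_ge0 tq _ _ _ _ _ _ _ _ _ _
    (pder irho (pder irho cav) v0) (pder ieta (pder irho cav) v0)
    (pder ieta (pder ieta cav) v0)) => //.
  + exact: (T cav _ _ _ _ _ _ _ _ cavB Dv0 Dm Dmu mq muq muv irho).
  + rewrite (cavS Dv0 ieta irho).
    exact: (T cav _ _ _ _ _ _ _ _ cavB Dv0 Dm Dmu mq muq muv ieta).
  + exact: (T cav _ _ _ _ _ _ _ _ cavB Dv0 Dv0 Dv1 v0q tq (lexx _) irho).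
  + rewrite (cavS Dv0 ieta irho).
    exact: (T cav _ _ _ _ _ _ _ _ cavB Dv0 Dv0 Dv1 v0q tq (lexx _) ieta).
  + have := T cav _ _ _ _ _ _ _ _ cavB Dv0 Dv0 Dm v0q mq mt irho.
    by rewrite Etheta; apply.
  + have := T cav _ _ _ _ _ _ _ _ cavB Dv0 Dv0 Dm v0q mq mt ieta.
    by rewrite Etheta; apply.
  + exact: (taylor2_w_le cavB B0 cavS Dv0 Dm Dv1 mq tq m1t).
  + by rewrite mxE; exact: (H cav _ _ _ _ cavB Dv0 Dc1 c1q B0).
  + by rewrite mxE (cavS Dv0 ieta irho); exact: (H cav _ _ _ _ cavB Dv0 Dc1 c1q B0).
  + by rewrite mxE; exact: (H cav _ _ _ _ cavB Dv0 Dc1 c1q B0).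
  + by rewrite mxE; exact: (H cav _ _ _ _ cavB Dv0 Dc1 c1q B0).
Qed.

End energy_difference.

(** * Sign of the Hessians of the convex and concave parts *)

Section potential.
Context (R : realType).
Implicit Types (f g : 'rV[R]_3 -> R) (z w : 'rV[R]_3).

Lemma st_coords z : st (z 0 irho) (z 0 itheta) (z 0 ieta) = z.
Proof. by apply/rowP; apply: forall3; rewrite stE. Qed.

Lemma open_pos_theta : open (@pos_theta R).
Proof.
rewrite (_ : @pos_theta R = (fun z : 'rV[R]_3 => z 0 itheta) @^-1` [set x | 0 < x])//.
by apply: open_comp => // z _; exact: coord_continuous.
Qed.

Lemma pder_near (n : nat) (f g : 'rV[R]_n -> R) (U : set 'rV[R]_n) (z : 'rV[R]_n) i :
  open U -> U z -> (forall y, U y -> f y = g y) -> pder i f z = pder i g z.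
Proof.
move=> oU Uz fg; apply: near_eq_derive.
have nU : nbhs z U by apply: open_nbhs_nbhs; split.
by near=> y; apply: fg; near: y.
Unshelve. all: by end_near. Qed.

Lemma pderD (n : nat) (f g : 'rV[R]_n -> R) (z : 'rV[R]_n) i :
  derivable f z (unit_vec R i) -> derivable g z (unit_vec R i) ->
  pder i (fun y => f y + g y) z = pder i f z + pder i g z.
Proof. by move=> df dg; rewrite /pder (deriveD df dg). Qed.

Lemma derivs_boundedW (D : set 'rV[R]_3) f B B' : B <= B' ->
  derivs_bounded D f B -> derivs_bounded D f B'.
Proof.
by move=> BB' fB s y Dy s3; have [h1 h2] := fB s y Dy s3; split; rewrite ?(le_trans h1).
Qed.

Lemma convex_second_difference f t r e x y : 0 < t ->
  convex_function setT (at_theta f t) ->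
  2 * f (st r t e) <= f (st (r + x) t (e + y)) + f (st (r - x) t (e - y)).
Proof.
move=> t0 cf.
have h0 : 0 <= 2^-1 :> R by [].
have h1 : 2^-1 <= 1 :> R by lra.
have := cf (Itv01 h0 h1) (\row_i [:: r + x; e + y]`_i) (\row_i [:: r - x; e - y]`_i)
  (mem_set I) (mem_set I).
rewrite convRE /at_theta /unstable.onem /=.
rewrite ![conv _ _ _]/(_ *: _ + _ *: _) !mxE /= /unstable.onem.
have -> : 2^-1 * (r + x) + (1 - 2^-1) * (r - x) = r by lra.
have -> : 2^-1 * (e + y) + (1 - 2^-1) * (e - y) = e by lra.
by move: (f _) (f _) (f _) => A A' A'' ?; lra.
Qed.

Local Opaque pder st.

(** Along the direction [(x, y)] scaled by [s], the second difference is [s ^+ 2] times the Hessian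
    form up to an error of order three; divide by [s ^+ 2] and let [s] tend to 0. The sign [sg]
    covers convex and concave functions at once. *)
Lemma second_difference_hessw f (sg t r e x y : R) : sg = 1 \/ sg = -1 -> 0 < t ->
  smooth_on (@pos_theta R) f ->
  (forall x y, 0 <=
     sg * (f (st (r + x) t (e + y)) + f (st (r - x) t (e - y)) - 2 * f (st r t e))) ->
  0 <= sg * dot (hessw f (st r t e) *m wvec x y) (wvec x y).
Proof.
move=> sg1 t0 fU cf.
pose a := st (r - `|x|) t (e - `|y|); pose b := st (r + `|x|) t (e + `|y|).
have DU : box a b `<=` @pos_theta R.
  by move=> z /(_ itheta); rewrite /a /b !stE /pos_theta/= => /andP[? _]; lra.
have [B B0 fB] := smooth_derivs_bounded fU DU.
have sym : symmetric_hessian (box a b) f.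
  by move=> w /DU Uw i j; exact: (schwarz _ _ open_pos_theta fU Uw).
have inD s : `|s| <= 1 -> box a b (st (r + s * x) t (e + s * y)).
  move=> s1; have h (p u : R) : p - `|u| <= p + s * u <= p + `|u|.
    have : `|s * u| <= `|u| by rewrite normrM ler_piMl.
    by rewrite ler_norml => /andP[? ?]; lra.
  by apply: forall3; rewrite /a /b !stE ?lexx ?h.
have Dz : box a b (st r t e).
  by have := inD 0; rewrite normr0 !mul0r !addr0; apply.
set q := `|x| + `|y|.
have q0 : 0 <= q by rewrite addr_ge0.
have T s : `|s| <= 1 -> `|f (st (r + s * x) t (e + s * y)) - f (st r t e)
   - (pder irho f (st r t e) * (s * x) + pder ieta f (st r t e) * (s * y))
   - 2^-1 * (pder irho (pder irho f) (st r t e) * (s * x) ^+ 2 +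
     2 * pder ieta (pder irho f) (st r t e) * (s * x) * (s * y) +
     pder ieta (pder ieta f) (st r t e) * (s * y) ^+ 2)|
   <= 3 * B * (`|s| * q) * (`|s| * q) ^+ 2.
  move=> s1.
  have sq : l1 (st (r + s * x) t (e + s * y) - st r t e) <= `|s| * q.
    rewrite st_diff l1_st subrr normr0 addr0 ![_ + _ * _ - _]addrAC !subrr !add0r.
    by rewrite !normrM -mulrDr.
  have := @taylor2_w_le R a b B f (st r t e) r e (r + s * x) (e + s * y) t
    (`|s| * q) (`|s| * q) fB (ltW B0) sym Dz Dz (inD _ s1) _ sq sq.
  have -> : r + s * x - r = s * x by ring.
  have -> : e + s * y - e = s * y by ring.
  apply; rewrite subrr [l1 0]big1 ?mulr_ge0// => i _; by rewrite mxE normr0.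
have -> : dot (hessw f (st r t e) *m wvec x y) (wvec x y) =
   pder irho (pder irho f) (st r t e) * x ^+ 2 +
     2 * pder ieta (pder irho f) (st r t e) * x * y +
     pder ieta (pder ieta f) (st r t e) * y ^+ 2.
  rewrite quad_wvec !mxE /iw /= (sym _ Dz irho ieta).
  by move: (pder _ (pder _ _) _) (pder _ (pder _ _) _) (pder _ (pder _ _) _) => A A' A''; ring.
set H := (X in 0 <= _ * X).
(* Adding the expansions at [s] and [- s] removes the first order terms, and their two errors add up
   to [6 * B * q ^+ 3 * s ^+ 3]. *)
have key s : 0 < s -> s <= 1 -> - (6 * B * q ^+ 3) * s <= sg * H.
  move=> s0 s1.
  have T1 := T s; have T2 := T (- s).
  rewrite normrN (gtr0_norm s0) in T1 T2.
  have {T1 T2} [T1 T2] := (T1 s1, T2 s1).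
  have C := cf (s * x) (s * y).
  rewrite -!mulNr in C; move: T1 T2 C; rewrite !ler_norml /H.
  move: (pder irho _ _) (pder ieta _ _) (pder irho (pder irho f) _)
   (pder ieta (pder irho f) _) (pder ieta (pder ieta f) _)
   (f (st r t e)) (f _) (f _) => A1 A2 A3 A4 A5 f0 f1 f2 T1 T2 C.
  rewrite -(ler_pM2r (exprn_gt0 2 s0)).
  by case: sg1 C => -> C; lra.
apply/ler_addgt0Pr => eps eps0.
pose c := 6 * B * q ^+ 3 + 1.
have c0 : 0 < c by rewrite ltr_wpDl// !mulr_ge0 ?exprn_ge0// ltW.
pose s := Num.min 1 (eps / c).
have s0 : 0 < s by rewrite lt_min ltr01 divr_gt0.
have s1 : s <= 1 by rewrite ge_min lexx.
have sc : s * c <= eps by rewrite -ler_pdivlMr// ge_min lexx orbT.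
have := key s s0 s1; have : 6 * B * q ^+ 3 * s <= s * c.
  by rewrite mulrC ler_wpM2l ?(ltW s0)// lerDl.
by move: (sg * H) => h; lra.
Qed.

Lemma convex_hessw_ge0 f t r e x y : 0 < t -> smooth_on (@pos_theta R) f ->
  convex_function setT (at_theta f t) ->
  0 <= dot (hessw f (st r t e) *m wvec x y) (wvec x y).
Proof.
move=> t0 fU cf; rewrite -[leRHS]mul1r; apply: second_difference_hessw => //.
  by left.
move=> x' y'; rewrite mul1r subr_ge0.
exact: convex_second_difference.
Qed.

Lemma concave_hessw_le0 f t r e x y : 0 < t -> smooth_on (@pos_theta R) f ->
  convex_function setT (fun w : 'rV[R]_2 => - at_theta f t w) ->
  dot (hessw f (st r t e) *m wvec x y) (wvec x y) <= 0.
Proof.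
move=> t0 fU cf; rewrite -oppr_ge0 -mulN1r; apply: second_difference_hessw => //.
  by right.
move=> x' y'; have := @convex_second_difference (fun z => - f z) t r e x' y' t0 cf.
by move: (f _) (f _) (f _) => *; lra.
Qed.

End potential.

(** * Tangent inequalities for the potential *)

Section coercivity.
Context (R : realType).
Implicit Types (f g : 'rV[R]_3 -> R) (z w : 'rV[R]_3).

Local Opaque pder st.

Lemma derivable_box_is_derive (a b : 'rV[R]_3) f B s (i : 'I_3) z :
  derivs_bounded (box a b) f B -> (size s <= 3)%N -> box a b z ->
  is_derive z (unit_vec R i) (foldr (@pder R 3) f s)
    (pder i (foldr (@pder R 3) f s) z).
Proof. by move=> fB s3 Dz; apply: DeriveDef => //; have [_] := fB s z Dz s3; exact. Qed.

(** Adding [k * theta ^+ 2] to [f] leaves a nonpositive second derivative in theta, so the sum lies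
    below its tangents on the segment; both mean value steps are taken for that sum. *)
Lemma concave_theta_tangent (a b : 'rV[R]_3) f B k r t t' e :
  derivs_bounded (box a b) f B ->
  box a b (st r t e) -> box a b (st r t' e) ->
  (forall z, box a b z -> pder itheta (pder itheta f) z <= - (2 * k)) ->
  k * (t - t') ^+ 2 <=
    f (st r t e) - f (st r t' e) - pder itheta f (st r t e) * (t - t').
Proof.
move=> fB Dz Dz' f2.
have line s : st r t e + s *: unit_vec R itheta = st r (t + s) e.
  by apply/rowP; apply: forall3; rewrite !mxE ?stE /= ?mulr0 ?addr0 ?mulr1.
have Ds s : between 0 (t' - t) s -> box a b (st r (t + s) e).
  move=> sb; apply: (between_box Dz Dz'); apply: forall3; rewrite !stE.
  - by have [] := between_refl r r.
  - by move: sb; rewrite /between; case: (leP 0 (t' - t)); case: (leP t t') => *; lra.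
  - by have [] := between_refl e e.
pose F := (fun z => f z) \+ k \*: ((fun z : 'rV[R]_3 => z 0 itheta) * (fun z : 'rV[R]_3 => z 0 itheta)).
pose dF z := pder itheta f z + k * (z 0 itheta + z 0 itheta).
have dFP z : box a b z -> is_derive z (unit_vec R itheta) F (dF z).
  move=> Dy; apply: is_deriveD; first exact: (derivable_box_is_derive itheta fB (s := [::])).
  apply: is_deriveZ.
  have c := is_derive_coord itheta itheta z; rewrite eqxx in c.
  by have := is_deriveM c c; rewrite ![_ *: 1]mulr1.
have d2FP z : box a b z -> is_derive z (unit_vec R itheta) dF
    (pder itheta (pder itheta f) z + k * (1 + 1)).
  move=> Dy; apply: is_deriveD.
    exact: (derivable_box_is_derive itheta fB (s := [:: itheta])).
  apply: is_deriveZ.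
  have c := is_derive_coord itheta itheta z; rewrite eqxx in c.
  exact: is_deriveD.
have [|s sb E1] := @mean_value_dir R 3 F dF (st r t e) (unit_vec R itheta) (t' - t).
  by move=> s /Ds Dy; apply: dFP; rewrite line.
have sub u : between 0 s u -> between 0 (t' - t) u.
  move: sb; rewrite /between; case: (leP 0 s); case: (leP 0 (t' - t)) => *; lra.
have [|u ub E2] := @mean_value_dir R 3 dF
   (fun z => pder itheta (pder itheta f) z + k * (1 + 1)) (st r t e) (unit_vec R itheta) s.
  by move=> u /sub/Ds Dy; apply: d2FP; rewrite line.
rewrite !line in E1 E2.
have le0 := f2 _ (Ds _ (sub _ ub)).
have ss : 0 <= s * (t' - t).
  move: sb; rewrite /between; case: (leP 0 (t' - t)) => ? /andP[? ?].
    by rewrite mulr_ge0.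
  by rewrite mulr_le0// ltW.
have {E2} : dF (st r (t + s) e) * (t' - t) <= dF (st r t e) * (t' - t).
  rewrite -subr_le0 -mulrBl E2 -mulrA mulr_le0_ge0//.
  by move: (pder _ _ _) le0 => ? ?; lra.
have FE z : F z = f z + k * (z 0 itheta * z 0 itheta) by [].
rewrite -E1 !FE /dF (_ : t + (t' - t) = t'); last by ring.
rewrite !stE.
by move: (pder _ _ _) (f _) (f _) => A A' A''; lra.
Qed.

(** A convex function lies above its tangent: compare the convexity inequality at parameter [s] with
    the first order expansion at [(r', e')], divide by [s] and let [s] tend to 0. Coinciding end
    points are treated first, because strict convexity speaks of distinct points. *)
Lemma convex_w_tangent (a b : 'rV[R]_3) f B alpha r t e r' e' :
  derivs_bounded (box a b) f B ->
  box a b (st r t e) -> box a b (st r' t e') ->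
  strictly_convex [set: 'rV[R]_2] (fun w : 'rV[R]_2 =>
      at_theta f t w + alpha / 2 * (w 0 0 ^+ 2 + w 0 1 ^+ 2)) ->
  - (alpha / 2 * ((r - r') ^+ 2 + (e - e') ^+ 2)) <=
    f (st r t e) - f (st r' t e') - pder irho f (st r' t e') * (r - r')
    - pder ieta f (st r' t e') * (e - e').
Proof.
move=> fB Dz Dz' cf.
have [[-> ->]|ne] := pselect (r = r' /\ e = e').
  by move: (pder irho _ _) (pder ieta _ _) (f _) => *; lra.
set x := r - r'; set y := e - e'; set q := `|x| + `|y|.
have B0 : 0 <= B by apply: le_trans (fB [::] _ Dz isT).1.
(* The error of order [s] collects the Taylor remainder and the part of the quadratic shift that is
   of second order in [s]. *)
have key s : 0 < s -> s < 1 ->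
    - (B * q * q + `|alpha| * (x ^+ 2 + y ^+ 2)) * s <= f (st r t e) - f (st r' t e') - pder irho f (st r' t e') * x
    - pder ieta f (st r' t e') * y + alpha / 2 * (x ^+ 2 + y ^+ 2).
  move=> s0 s1.
  pose w : 'rV[R]_2 := \row_i [:: r; e]`_i; pose w' : 'rV[R]_2 := \row_i [:: r'; e']`_i.
  have ww' : w != w'.
    apply/eqP => ww'; apply: ne.
    by have := congr1 (fun z : 'rV[R]_2 => z 0 0) ww';
      have := congr1 (fun z : 'rV[R]_2 => z 0 1) ww'; rewrite !mxE.
  have := cf w w' I I ww' s s0 s1; rewrite /at_theta !mxE /=.
  have -> : s * r + (1 - s) * r' = r' + s * x by rewrite /x; ring.
  have -> : s * e + (1 - s) * e' = e' + s * y by rewrite /y; ring.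
  have Ds : box a b (st (r' + s * x) t (e' + s * y)).
    apply: (between_box Dz' Dz); apply: forall3; rewrite !stE.
    - apply: on_segment_between; exists s; first by rewrite !ltW.
      by rewrite /GRing.scale/= /x; ring.
    - by have [] := between_refl t t.
    - apply: on_segment_between; exists s; first by rewrite !ltW.
      by rewrite /GRing.scale/= /y; ring.
  have sq : l1 (st (r' + s * x) t (e' + s * y) - st r' t e') = s * q.
    rewrite st_diff l1_st subrr normr0 addr0 ![_ + _ * _ - _]addrAC !subrr !add0r.
    by rewrite !normrM gtr0_norm// -mulrDr.
  have := @taylor1 _ _ f a b B (st r' t e') (st r' t e') (st (r' + s * x) t (e' + s * y))
     (fun s y Dy s2 => fB s y Dy (leqW s2)) Dz' Dz' Ds.
  rewrite sq subrr [l1 0]big1 => [|i _]; last by rewrite mxE normr0.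
  rewrite add0r (sum3_w (fun k => pder k f (st r' t e'))); last first.
    by rewrite st_diff stE subrr.
  rewrite st_diff !stE.
  have -> : r' + s * x - r' = s * x by ring.
  have -> : e' + s * y - e' = s * y by ring.
  rewrite ler_norml => /andP[].
  move=> h1 _ h2.
  have al' : 0 <= (`|alpha| + alpha) * (x ^+ 2 + y ^+ 2) * s * s.
    have a0 : 0 <= `|alpha| + alpha by have := ler_norm (- alpha); rewrite normrN; lra.
    by rewrite mulr_ge0 ?(ltW s0)// mulr_ge0 ?(ltW s0)// mulr_ge0// addr_ge0 ?sqr_ge0.
  have al2 : 0 <= `|alpha| * (x ^+ 2 + y ^+ 2) * s * s.
    by rewrite mulr_ge0 ?(ltW s0)// mulr_ge0 ?(ltW s0)// mulr_ge0// addr_ge0 ?sqr_ge0.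
  move: (pder irho _ _) (pder ieta _ _) (f (st r t e)) (f (st r' t e')) (f _)
    h1 h2 => A A' f1 f2 f3 h1 h2.
  rewrite -(ler_pM2r s0).
  have Er : r = r' + x by rewrite /x; ring.
  have Ee : e = e' + y by rewrite /y; ring.
  rewrite {}Er {}Ee in h2; move: h1 h2 al' al2; clearbody x y q => {}h1 {}h2 al' al2.
  by lra.
pose H := f (st r t e) - f (st r' t e') - pder irho f (st r' t e') * x
    - pder ieta f (st r' t e') * y + alpha / 2 * (x ^+ 2 + y ^+ 2).
suff : 0 <= H.
  by rewrite /H; move: (pder irho _ _) (pder ieta _ _) (f _) (f _) => *; lra.
pose c := B * q * q + `|alpha| * (x ^+ 2 + y ^+ 2).
have {}key s : 0 < s -> s < 1 -> - c * s <= H by exact: key.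
clearbody H.
have c0 : 0 <= c by rewrite addr_ge0 ?mulr_ge0 ?addr_ge0 ?sqr_ge0.
apply/ler_addgt0Pr => eps eps0.
pose s := Num.min 2^-1 (eps / (c + 1)).
have s0 : 0 < s by rewrite lt_min invr_gt0 ltr0n divr_gt0// ltr_wpDl.
have s1 : s < 1 by rewrite gt_min invf_lt1 ?ltr1n.
have sc : s * (c + 1) <= eps by rewrite -ler_pdivlMr ?ltr_wpDl// ge_min lexx orbT.
by have {key} := key s s0 s1; clearbody c s => ?; lra.
Qed.

End coercivity.

(** * Consequences of the assumptions on the potential over a compact box *)

Section facts.
Context (R : realType) (d : nat).
Implicit Types (M : model R d).

Local Opaque pder.

(** The constants [B] and [k] depend on the potential and the box only. The box is later built from
    [c_oo] and [C_oo], which makes the final constants independent of mesh, time step and fields. *)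
Record potential_facts M (alpha : R) (a b : 'rV[R]_3) (B k : R) : Prop := {
  pf_B : 0 < B;
  pf_k : 0 < k;
  pf_psi : derivs_bounded (box a b) (psi M) B;
  pf_vex : derivs_bounded (box a b) (psi_vex M) B;
  pf_cav : derivs_bounded (box a b) (psi_cav M) B;
  pf_psi_sym : symmetric_hessian (box a b) (psi M);
  pf_vex_sym : symmetric_hessian (box a b) (psi_vex M);
  pf_cav_sym : symmetric_hessian (box a b) (psi_cav M);
  pf_split0 : forall w, box a b w -> psi M w = psi_vex M w + psi_cav M w;
  pf_split1 : forall w, box a b w -> forall i,
    pder i (psi M) w = pder i (psi_vex M) w + pder i (psi_cav M) w;
  pf_split2 : forall w, box a b w -> forall i j,
    pder i (pder j (psi M)) w =
    pder i (pder j (psi_vex M)) w + pder i (pder j (psi_cav M)) w;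
  pf_theta : forall z, box a b z -> pder itheta (pder itheta (psi M)) z <= 0;
  pf_hess : forall r t e x y r' e', box a b (st r t e) -> 
    0 <= dot ((hessw (psi_vex M) (st r t e) - hessw (psi_cav M) (st r' t e'))
              *m wvec x y) (wvec x y);
  pf_coercive : forall r t e r' t' e', box a b (st r t e) -> box a b (st r' t' e') ->
    k * (t - t') ^+ 2 - alpha / 2 * ((r - r') ^+ 2 + (e - e') ^+ 2) <=
    pot (psi M) r t e r' t' e' }.

Lemma potential_factsP M alpha (a b : 'rV[R]_3) : potential_ok M alpha ->
  0 < a 0 itheta -> exists B k, potential_facts M alpha a b B k.
Proof.
move=> pok a0.
have DU : box a b `<=` @pos_theta R.
  by move=> z /(_ itheta) /andP[? _]; rewrite /pos_theta/=; lra.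
have [B1 B10 psiB] := smooth_derivs_bounded (psi_smooth pok) DU.
have [B2 B20 vexB] := smooth_derivs_bounded (psi_vex_smooth pok) DU.
have [B3 B30 cavB] := smooth_derivs_bounded (psi_cav_smooth pok) DU.
pose B := B1 + B2 + B3.
have B1B : B1 <= B by rewrite /B -addrA lerDl addr_ge0 ?ltW.
have B2B : B2 <= B by rewrite /B addrAC lerDr addr_ge0 ?ltW.
have B3B : B3 <= B by rewrite /B lerDr addr_ge0 ?ltW.
have sym f : smooth_on (@pos_theta R) f -> symmetric_hessian (box a b) f.
  by move=> fU w /DU Uw i j; exact: (schwarz _ _ (@open_pos_theta R) fU Uw).
have split0 w : pos_theta w -> psi M w = psi_vex M w + psi_cav M w.
  by move=> w0; rewrite -(st_coords w); exact: (psi_split pok).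
have split1 w i : pos_theta w ->
    pder i (psi M) w = pder i (psi_vex M) w + pder i (psi_cav M) w.
  move=> w0; rewrite -pderD; last 2 first.
  - by have [_] := psi_vex_smooth pok [::] w0; exact.
  - by have [_] := psi_cav_smooth pok [::] w0; exact.
  exact: (pder_near _ (@open_pos_theta R) w0 split0).
have split2 w i j : pos_theta w -> pder i (pder j (psi M)) w =
    pder i (pder j (psi_vex M)) w + pder i (pder j (psi_cav M)) w.
  move=> w0; rewrite -pderD; last 2 first.
  - by have [_] := psi_vex_smooth pok [:: j] w0; exact.
  - by have [_] := psi_cav_smooth pok [:: j] w0; exact.
  by apply: (pder_near _ (@open_pos_theta R) w0) => y; exact: split1.
(* The continuous second temperature derivative attains its maximum on the compact box, and
   [psi_theta_concave2] makes that maximum negative. *)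
have [k k0 kP] : exists2 k, 0 < k & forall z, box a b z ->
    pder itheta (pder itheta (psi M)) z <= - (2 * k).
  have [E|/set0P D0] := eqVneq (box a b) set0.
    by exists 1 => // z; rewrite E.
  have [|c /set_mem cD cP] := EVT_max_rV (f := pder itheta (pder itheta (psi M))) D0 (@box_compact R 3 a b).
    apply: continuous_in_subspaceT => y /set_mem /DU yU.
    by have [] := psi_smooth pok [:: itheta; itheta] yU.
  exists (- pder itheta (pder itheta (psi M)) c / 2).
    by rewrite divr_gt0// oppr_gt0; exact: psi_theta_concave2 pok _ (DU _ cD).
  move=> z zD; have := cP z (mem_set zD).
  by move: (pder _ _ _) (pder _ _ _) => A A' ?; lra.
exists B, k; split.
- by rewrite /B !addr_gt0.
- exact: k0.
- exact: derivs_boundedW psiB.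
- exact: derivs_boundedW vexB.
- exact: derivs_boundedW cavB.
- exact/sym/psi_smooth/pok.
- exact/sym/psi_vex_smooth/pok.
- exact/sym/psi_cav_smooth/pok.
- by move=> w /DU; exact: split0.
- by move=> w /DU w0 i; exact: split1.
- by move=> w /DU w0 i j; exact: split2.
- by move=> z /kP; move: (pder _ _ _) => A ?; lra.
- move=> r t e x y r' e' /DU; rewrite /pos_theta/= stE => t0.
  rewrite mulmxBl /dot linearB/= mulmxBl mxE [X in _ + X]mxE subr_ge0.
  apply: (@le_trans _ _ 0).
    exact: concave_hessw_le0 (psi_cav_smooth pok) (psi_cav_concave pok t0).
  exact: convex_hessw_ge0 (psi_vex_smooth pok) (psi_vex_convex pok t0).
- move=> r t e r' t' e' D1 D2.
  (* The state [(r, t', e)] splits [pot] into a temperature gap at fixed [(r, e)] and a gap in (rho,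
     eta) at fixed [t'], one for each tangent inequality. *)
  have D3 : box a b (st r t' e).
    by apply: forall3; have := D1 irho; have := D2 itheta; have := D1 ieta; rewrite !stE.
  have c1 := concave_theta_tangent psiB D1 D3 kP.
  have t0 : 0 < t' by have := DU _ D2; rewrite /pos_theta/= stE.
  have c2 := convex_w_tangent psiB D3 D2 (psi_alpha_convex pok t0).
  move: c1 c2; rewrite /pot.
  move: (pder _ _ _) (pder _ _ _) (pder _ _ _) (psi M _) (psi M _) (psi M _).
  by move=> *; lra.
Qed.

End facts.

(** * Measurability of compositions with functions continuous on an open set *)

Section measurability.
Context d (T : measurableType d) (R : realType) (n : nat).
Implicit Types (A : set T) (z : T -> 'rV[R]_n) (f : 'rV[R]_n -> R).

(** An open set is a countable union of cubes with rational centre and radius, and the preimage of a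
    cube is measurable coordinate by coordinate. *)
Lemma measurable_preimage_open A z (W : set 'rV[R]_n) : measurable A ->
  (forall i, measurable_fun A (fun t => z t 0 i)) -> open W ->
  measurable (A `&` z @^-1` W).
Proof.
move=> mA mz oW.
pose bx (q : 'rV[rat]_n * rat) : set 'rV[R]_n :=
  [set x | forall i, `|x 0 i - ratr (q.1 0 i)| < ratr q.2].
pose F q := if `[< bx q `<=` W >] then A `&` z @^-1` (bx q) else set0.
have -> : A `&` z @^-1` W = \bigcup_q F q.
  apply/seteqP; split=> [t [At Wt]|t [q _]]; last first.
    by rewrite /F; case: asboolP => // qW [At /qW].
  have := oW _ Wt; rewrite nbhs_ballP => -[e /= e0 eW].
  have [r] := @rat_in_itvoo R 0 (e / 2) ltac:(by rewrite divr_gt0).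
  rewrite in_itv/= => /andP[r0 re].
  have Q i : exists s : rat, `|z t 0 i - ratr s| < ratr r.
    have [s] := @rat_in_itvoo R (z t 0 i - ratr r) (z t 0 i + ratr r) ltac:(lra).
    by rewrite in_itv/= => sP; exists s; rewrite ltr_distl; lra.
  have [s sP] := choice Q.
  have bt : bx (\row_i s i, r) (z t) by move=> i /=; rewrite mxE.
  exists (\row_i s i, r) => //; rewrite /F; case: asboolP => [_|[]]; first by [].
  move=> x xb; apply: eW; split=> // i j; rewrite ord1.
  have := xb j; have := sP j; rewrite /ball /= mxE !ltr_distl => *; lra.
apply: countable_bigcupT_measurable => // q.
rewrite /F; case: asboolP => // _.
rewrite (_ : _ `&` _ = A `&` \bigcap_(i in [set: 'I_n])
   (A `&` (fun t => z t 0 i) @^-1` [set x | `|x - ratr (q.1 0 i)| < ratr q.2])).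
  apply: measurableI => //; apply: fin_bigcap_measurable => // i _.
  apply: mz => //.
  rewrite (_ : [set _ | _] = `]ratr (q.1 0 i) - ratr q.2, ratr (q.1 0 i) + ratr q.2[%classic).
    exact: measurable_itv.
  by apply/seteqP; split=> x; rewrite /= in_itv/= ltr_distl.
apply/seteqP; split=> t [At tq]; split=> // i.
  by split=> //; exact: tq.
by have [] := tq i I.
Qed.

Lemma measurable_comp_open A z f (U : set 'rV[R]_n) : measurable A ->
  (forall i, measurable_fun A (fun t => z t 0 i)) -> open U ->
  (forall t, A t -> U (z t)) -> (forall x, U x -> {for x, continuous f}) ->
  measurable_fun A (f \o z).
Proof.
move=> mA mz oU AU cf; apply: (measurability _ (RGenOpens.measurableE R)).
move=> _ [_ [a [b ->] <-]].
rewrite (_ : _ `&` _ = A `&` z @^-1` (U `&` f @^-1` `]a, b[%classic)); last first.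
  by apply/seteqP; split=> t [At fz]; split=> //; [split=> //; exact: AU|case: fz].
apply: measurable_preimage_open => //; rewrite openE => x [Ux fx]; apply: filterI.
  exact: open_nbhs_nbhs.
by apply: (cf x Ux); apply: open_nbhs_nbhs; split=> //; exact: interval_open.
Qed.
End measurability.

(** * Integrals over sets of full measure *)

Section null_set.
Context d (T : measurableType d) (R : realType) (mu : {measure set T -> \bar R}).
Local Open Scope ereal_scope.
Import HBNNSimple.

(** The function [f] may fail to be measurable, as gradients of finite element functions might on
    the faces of the mesh. The integral of a nonnegative function is a supremum over the simple
    functions below it, and cutting these down to [G] does not change their integrals. *)
Let ge0_integral_conull (G : set T) (f : T -> \bar R) : measurable G ->
  mu (~` G) = 0 -> (forall x, 0 <= f x) ->
  \int[mu]_x f x = \int[mu]_(x in G) f x.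
Proof.
move=> mG G0 f0.
rewrite [LHS]ge0_integralE// [RHS]ge0_integralE//.
apply/eqP; rewrite eq_le; apply/andP; split.
  apply: ge_ereal_sup => _ [h hf <-]; apply: ereal_sup_ubound.
  exists (proj_nnsfun h mG).
    have E x : proj_nnsfun h mG x = (h \_ G) x by rewrite mrestrict.
    move=> x; have := hf x; rewrite [in X in _ -> X]E !patchE mem_setT.
    by case: (x \in G).
  have -> : sintegral mu h = \int[mu]_(x in setT) (h x)%:E.
    by rewrite integral_nnsfun// patch_setT.
  have -> : sintegral mu (proj_nnsfun h mG) = \int[mu]_(x in G) (h x)%:E.
    by rewrite integral_nnsfun// mrestrict.
  rewrite [RHS](@ge0_negligible_integral _ _ _ mu setT (~` G))//.
  - by rewrite setTD setCK.
  - exact: measurableC.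
  - exact/measurable_EFinP.
  - by move=> x _; rewrite lee_fin.
apply: ge_ereal_sup => _ [h hf <-]; apply: ereal_sup_ubound.
exists h => // x; apply: (le_trans (hf x)).
by rewrite !patchE mem_setT; case: ifP.
Qed.

Lemma integral_conull (G : set T) (f : T -> \bar R) : measurable G ->
  mu (~` G) = 0 -> \int[mu]_x f x = \int[mu]_(x in G) f x.
Proof.
move=> mG G0; rewrite [LHS]integralE [RHS]integralE.
by congr (_ - _); exact: ge0_integral_conull.
Qed.

End null_set.

(** * Null sets and sets of positive measure in the cube *)

Section cube.
Context (R : realType).
Local Open Scope ereal_scope.

Lemma product_measure_null d1 d2 (T1 : measurableType d1) (T2 : measurableType d2)
    (m1 : {measure set T1 -> \bar R}) (m2 : {sigma_finite_measure set T2 -> \bar R})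
    (A : set (T1 * T2)) (N : set T1) : measurable A -> measurable N -> m1 N = 0 ->
  (forall x, ~ N x -> m2 (xsection A x) = 0) -> (m1 \x m2) A = 0.
Proof.
move=> mA mN N0 H; rewrite /product_measure1.
rewrite (@ge0_negligible_integral _ _ _ _ setT N)//.
- by apply: integral0_eq => x [_ Nx] /=; exact: H.
- exact: measurable_fun_xsection.
Qed.

Lemma itv_measureE (l : R) (A : set R) :
  itv_measure 0 l A = lebesgue_measure (A `&` `[0%R, l]%classic).
Proof. by []. Qed.

Definition tcons n (p : measurableTypeR R * n.-tuple (measurableTypeR R)) :
    n.+1.-tuple (measurableTypeR R) := [tuple of p.1 :: p.2].

Lemma tnth_tcons0 n p : tnth (@tcons n p) ord0 = p.1.
Proof. by []. Qed.

Lemma tnth_tconsS n p i : tnth (@tcons n p) (lift ord0 i) = tnth p.2 i.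
Proof. exact: tnthS. Qed.

Lemma cons_measureE n (nu : {finite_measure set (measurableTypeR R) -> \bar R})
    (mu : {finite_measure set (n.-tuple (measurableTypeR R)) -> \bar R}) A :
  cons_measure nu mu A =
  (nu \x mu) (@tcons n @^-1` A).
Proof. by []. Qed.

Lemma cube_measureS (l : R) n A : cube_measure l n.+1 A =
  (itv_measure 0 l \x cube_measure l n) (@tcons n @^-1` A).
Proof. by []. Qed.

Lemma measurable_cons_preimage n (A : set (n.+1.-tuple (measurableTypeR R))) :
  measurable A -> measurable (@tcons n @^-1` A).
Proof.
move=> mA; rewrite -[X in measurable X]setTI.
exact: (@measurable_cons _ _ _ _ fst _ snd measurable_fst measurable_snd).
Qed.

Lemma xsection_cons n (A : set (n.+1.-tuple (measurableTypeR R))) x :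
  xsection (@tcons n @^-1` A) x = [set y | A (tcons (x, y))].
Proof. by apply/seteqP; split=> y; rewrite /xsection/= inE. Qed.

Definition cube (l : R) n : set (n.-tuple (measurableTypeR R)) :=
  [set y | forall i, (0 <= tnth y i <= l)%R].

Lemma measurable_forall_tnth n (P : 'I_n -> set (measurableTypeR R)) :
  (forall i, measurable (P i)) ->
  measurable [set y : n.-tuple (measurableTypeR R) | forall i, P i (tnth y i)].
Proof.
move=> mP; rewrite (_ : [set _ | _] = \bigcap_(i in [set: 'I_n])
   ((fun y : n.-tuple (measurableTypeR R) => tnth y i) @^-1` P i)).
  apply: fin_bigcap_measurable => // i _; rewrite -[X in measurable X]setTI.
  by apply: measurable_tnth.
by apply/seteqP; split=> y yP i; [move=> _; exact: yP|exact: (yP i I)].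
Qed.

Lemma measurable_cube l n : measurable (@cube l n).
Proof.
apply: (@measurable_forall_tnth n (fun=> [set x | (0 <= x <= l)%R])) => i.
rewrite (_ : [set _ | _] = `[0%R, l]%classic); first exact: measurable_itv.
by apply/seteqP; split=> x; rewrite /= in_itv.
Qed.

Lemma cube_measure_setC_cube (l : R) n : cube_measure l n (~` @cube l n) = 0.
Proof.
elim: n => [|n IH].
  rewrite (_ : ~` _ = set0) ?measure0//; apply/seteqP; split=> // y; apply.
  by case.
rewrite cube_measureS; apply: (@product_measure_null _ _ (measurableTypeR R) (n.-tuple (measurableTypeR R))
  (itv_measure 0 l) (cube_measure l n) _ (~` `[0%R, l]%classic)).
- by apply: measurable_cons_preimage; apply: measurableC; exact: measurable_cube.
- by apply: measurableC; exact: measurable_itv.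
- by rewrite [LHS]itv_measureE setICl measure0.
move=> x /contrapT; rewrite /= in_itv/= => x0l; rewrite xsection_cons.
rewrite (_ : [set _ | _] = ~` @cube l n); first exact: IH.
apply/seteqP; split=> y /= yN yc; apply: yN.
  move=> i; case: (unliftP ord0 i) => [j ->|->]; rewrite ?tnth_tconsS ?tnth_tcons0//.
by move=> i; have := yc (lift ord0 i); rewrite tnth_tconsS.
Qed.

Lemma measurable_affine n (c : 'I_n -> R) (b : R) :
  measurable_fun setT (fun y : n.-tuple (measurableTypeR R) =>
    (\sum_i c i * tnth y i + b)%R).
Proof.
apply: measurable_funD => //; apply: measurable_sum => i.
by apply: measurable_funM => //; exact: measurable_tnth.
Qed.

(** Induction on the dimension through sections at a fixed first coordinate. If some later
    coefficient is nonzero, all sections are hyperplanes; otherwise they are empty except over a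
    single value of the first coordinate. *)
Lemma cube_measure_hyperplane (l : R) n (c : 'I_n -> R) (b : R) :
  (exists i, c i != 0%R) ->
  cube_measure l n [set y | (\sum_i c i * tnth y i + b = 0)%R] = 0.
Proof.
elim: n c b => [c b [[]]//|n IH c b cN0].
have mH : measurable [set y : n.+1.-tuple (measurableTypeR R) |
    (\sum_i c i * tnth y i + b = 0)%R].
  rewrite -[X in measurable X]setTI.
  by apply: (@measurable_affine _ c b measurableT [set 0%R]).
have secE x : xsection (@tcons n @^-1` [set y | (\sum_i c i * tnth y i + b = 0)%R]) x
   = [set y | (\sum_i c (lift ord0 i) * tnth y i + (c ord0 * x + b) = 0)%R].
  have E y : (\sum_i c i * tnth (tcons (x, y)) i + b =
      \sum_i c (lift ord0 i) * tnth y i + (c ord0 * x + b))%R.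
    rewrite big_ord_recl tnth_tcons0 addrA [(c ord0 * _ + _)%R]addrC.
    by congr (_ + _ + _)%R; apply: eq_bigr => i _; rewrite tnth_tconsS.
  by rewrite xsection_cons; apply/seteqP; split=> y /=; rewrite E.
have [[i ci]|c0] := pselect (exists i, c (lift ord0 i) != 0%R).
  rewrite cube_measureS; apply: (@product_measure_null _ _ (measurableTypeR R) (n.-tuple (measurableTypeR R))
    (itv_measure 0 l) (cube_measure l n) _ set0) => //; first exact: measurable_cons_preimage.
  by move=> x _; rewrite secE; apply: IH; exists i.
have {}c0 i : c (lift ord0 i) = 0%R.
  by apply/eqP/negPn/negP => ci; apply: c0; exists i.
have cN : c ord0 != 0%R.
  by have [i] := cN0; case: (unliftP ord0 i) => [j ->|->//]; rewrite c0 eqxx.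
rewrite cube_measureS; apply: (@product_measure_null _ _ (measurableTypeR R) (n.-tuple (measurableTypeR R))
    (itv_measure 0 l) (cube_measure l n) _ [set (- b / c ord0)%R]) => //.
- exact: measurable_cons_preimage.
- rewrite [LHS]itv_measureE; apply/eqP; rewrite -measure_le0.
  rewrite -(lebesgue_measure_set1 (- b / c ord0)%R).
  by apply: le_measure; rewrite ?inE//; apply: measurableI => //; exact: measurable_itv.
- move=> x /= xb; rewrite secE.
  rewrite (_ : [set _ | _] = set0) ?measure0//; apply/seteqP; split=> // y /=.
  rewrite big1 => [|i _]; last by rewrite c0 mul0r.
  rewrite add0r => /eqP; rewrite addr_eq0 => /eqP cx; apply: xb.
  by rewrite -cx mulrC mulKf.
Qed.

Lemma itv_measure_ball_gt0 (l x e : R) : (0 < l)%R -> (0 <= x <= l)%R -> (0 < e)%R ->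
  0 < itv_measure 0 l [set y : R | (`|y - x| < e)%R].
Proof.
move=> l0 /andP[x0 xl] e0; rewrite itv_measureE.
have h : (Num.max 0 (x - e) < Num.min l (x + e))%R.
  by rewrite lt_min !gt_max; apply/andP; split; apply/andP; split; lra.
apply: (@lt_le_trans _ _ (lebesgue_measure
    `]Num.max 0%R (x - e)%R, Num.min l (x + e)%R[%classic)).
  by rewrite lebesgue_measure_itv/= lte_fin h -EFinB lte_fin subr_gt0.
have E : [set y : R | (`|y - x| < e)%R] = `](x - e)%R, (x + e)%R[%classic.
  by apply/seteqP; split=> y; rewrite /= in_itv/= ltr_distl.
apply: le_measure; rewrite ?inE.
- exact: measurable_itv.
- by rewrite E; apply: measurableI; exact: measurable_itv.
- move=> y; rewrite /= in_itv/= => /andP[].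
  rewrite gt_max lt_min => /andP[? ?] /andP[? ?].
  by rewrite /= ?in_itv/= ltr_distl; split; apply/andP; split; lra.
Qed.

Lemma cube_measure_ball_gt0 (l e : R) n (x : 'I_n -> R) : (0 < l)%R ->
  (forall i, 0 <= x i <= l)%R -> (0 < e)%R ->
  0 < cube_measure l n [set y | forall i, (`|tnth y i - x i| < e)%R].
Proof.
move=> l0 + e0; elim: n x => [x _|n IH x x0l].
  rewrite (_ : [set _ | _] = setT); last by apply/seteqP; split=> // y _ [].
  by rewrite /= diracT lte01.
have mb (a : R) : measurable [set y : measurableTypeR R | (`|y - a| < e)%R].
  rewrite (_ : [set _ | _] = `](a - e)%R, (a + e)%R[%classic); first exact: measurable_itv.
  by apply/seteqP; split=> y; rewrite /= in_itv/= ltr_distl.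
have -> : cube_measure l n.+1 [set y | forall i, (`|tnth y i - x i| < e)%R] =
  (itv_measure 0 l \x cube_measure l n)
    ([set y | (`|y - x ord0| < e)%R] `*`
     [set y | forall i, (`|tnth y i - x (lift ord0 i)| < e)%R]).
  rewrite cube_measureS; congr ((_ \x _) _); apply/seteqP; split=> -[a y].
    by move=> H; split=> [|i]; [exact: (H ord0)|have := H (lift ord0 i); rewrite tnth_tconsS].
  by move=> [H1 H2] i; case: (unliftP ord0 i) => [j ->|->]; rewrite ?tnth_tconsS ?tnth_tcons0//; exact: H2.
rewrite product_measure1E.
- rewrite mule_gt0//; first exact: itv_measure_ball_gt0.
  by apply: IH => i.
- exact: mb.
- exact: (measurable_forall_tnth (P := fun i => [set z | (`|z - x (lift ord0 i)| < e)%R])).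
Qed.

End cube.

(** * Barycentric coordinates of a simplex *)

Section simplices.
Context (R : realType) (d : nat).
Implicit Types (K : simplex R d) (x : 'rV[R]_d).

Let vmat K : 'M[R]_d.+1 := row_mx (const_mx 1 : 'cV_d.+1) K.
Let homog x : 'rV[R]_d.+1 := row_mx (const_mx 1 : 'rV_1) x.

(** Barycentric coordinates, obtained from [(1, x)] through the inverse of the vertex matrix
    bordered by a column of ones; this makes them visibly affine in [x]. *)
Definition bary K x : 'rV[R]_d.+1 := homog x *m invmx (vmat K).

Lemma baryE K x j : bary K x 0 j =
  \sum_i invmx (vmat K) (rshift 1 i) j * x 0 i + invmx (vmat K) (@lshift 1 d ord0) j.
Proof.
rewrite mxE (big_split_ord _ (m := 1) (n := d))/= big_ord1 addrC; congr (_ + _).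
  apply: eq_bigr => i _; rewrite /homog (@row_mxEr _ _ 1 d) mulrC.
  by [].
by rewrite /homog (@row_mxEl _ _ 1 d) mxE mul1r.
Qed.

Lemma bary_vertex K i : nondegenerate K -> bary K (row i K) = delta_mx 0 i.
Proof.
move=> Ku; have E : homog (row i K) = row i (vmat K).
  apply/rowP => j; rewrite -(splitK (m := 1) (n := d) j); case: (@fintype.split 1 d j) => k /=.
    by rewrite /homog /vmat (@row_mxEl _ _ 1 d) [RHS]mxE (@row_mxEl _ _ 1 d) !mxE.
  by rewrite /homog /vmat (@row_mxEr _ _ 1 d) [RHS]mxE (@row_mxEr _ _ 1 d) !mxE.
by rewrite /bary E -row_mul mulmxV// row1.
Qed.

Lemma bary_sum K x : nondegenerate K ->
  \sum_j bary K x 0 j = 1 /\ x = \sum_j bary K x 0 j *: row j K.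
Proof.
move=> Ku.
have H : bary K x *m vmat K = homog x by rewrite /bary mulmxKV.
have : @mulmx R 1 d.+1 (1 + d) (bary K x) (row_mx (const_mx 1 : 'cV_d.+1) K) =
  row_mx (const_mx 1) x by exact: H.
rewrite mul_mx_row => /eq_row_mx[E1 E2]; split.
  have := congr1 (fun M : 'rV[R]_1 => M 0 0) E1; rewrite mxE [RHS]mxE => <-.
  by apply: eq_bigr => j _; rewrite [const_mx _ _ _]mxE mulr1.
by rewrite -mulmx_sum_row E2.
Qed.

Lemma bary_comb K m (w : 'I_m -> R) (p : 'I_m -> 'rV[R]_d) : \sum_i w i = 1 ->
  bary K (\sum_i w i *: p i) = \sum_i w i *: bary K (p i).
Proof.
move=> w1; rewrite /bary; have -> : homog (\sum_i w i *: p i) = \sum_i w i *: homog (p i).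
  apply/rowP => j; rewrite -(splitK (m := 1) (n := d) j); case: (@fintype.split 1 d j) => k /=.
    rewrite [LHS](@row_mxEl _ _ 1 d) [LHS]mxE summxE -[LHS]w1; apply: eq_bigr => i _.
    by rewrite [RHS]mxE (@row_mxEl _ _ 1 d) [const_mx _ _ _]mxE mulr1.
  rewrite [LHS](@row_mxEr _ _ 1 d) !summxE; apply: eq_bigr => i _.
  by rewrite [LHS]mxE [RHS]mxE (@row_mxEr _ _ 1 d).
by rewrite mulmx_suml; apply: eq_bigr => i _; rewrite -scalemxAl.
Qed.

Lemma convex_hull_bary K x : nondegenerate K ->
  convex_hull (vertices K) x <-> forall j, 0 <= bary K x 0 j.
Proof.
move=> Ku; split=> [[m [p [w [pK w0 w1 ->]]]] j|x0].
  rewrite bary_comb// summxE; apply: sumr_ge0 => i _; rewrite mxE mulr_ge0//.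
  by have [k _ <-] := pK i; rewrite bary_vertex// mxE; case: (_ && _).
exists d.+1, (fun j => row j K), (fun j => bary K x 0 j).
have [s1 s2] := bary_sum x Ku; split=> //.
by move=> i; exists i.
Qed.

Definition open_simplex K : set 'rV[R]_d := [set x | forall j, 0 < bary K x 0 j].

Lemma open_simplex_hull K x : nondegenerate K -> open_simplex K x ->
  convex_hull (vertices K) x.
Proof. by move=> Ku xK; apply/convex_hull_bary => // j; exact/ltW. Qed.

Lemma continuous_affine (c : 'I_d -> R) (b : R) :
  continuous (fun x : 'rV[R]_d => \sum_i c i * x 0 i + b).
Proof.
rewrite (_ : (fun _ => _) = (\sum_i (fun x : 'rV[R]_d => c i * x 0 i)) \+ cst b).
  move=> x; apply: (@continuousD R _ _ (\sum_i (fun x : 'rV[R]_d => c i * x 0 i)) (cst b) x);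
    last exact: cst_continuous.
  elim/big_ind : _ x => [x|f g cf cg x|i _ x]; first exact: cst_continuous.
    by apply: (@continuousD R _ _ f g x); [exact: cf|exact: cg].
  apply: (@continuousM R _ (cst (c i)) (fun x : 'rV[R]_d => x 0 i) x).
    exact: cst_continuous.
  exact: coord_continuous.
by apply/funext => x; rewrite /= fct_sumE.
Qed.

Lemma open_open_simplex K : open (open_simplex K).
Proof.
rewrite openE => x xK; rewrite /interior.
have : \forall y \near x, forall j, 0 < bary K y 0 j; last by [].
apply: (@filter_forall _ _ (fun j => [set y | 0 < bary K y 0 j]) (nbhs x)) => j.
have cE : (fun y => bary K y 0 j) = (fun y => \sum_i invmx (vmat K) (rshift 1 i) j * y 0 i
    + invmx (vmat K) (@lshift 1 d ord0) j) by apply/funext => y; exact: baryE.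
have c : {for x, continuous (fun y => bary K y 0 j)}.
  by rewrite cE; exact: continuous_affine.
exact: (c _ (open_nbhs_nbhs (conj (@open_gt R 0) (xK j)))).
Qed.

(** A barycentric coordinate equals 1 at its own vertex and 0 at any other, so it is not constant;
    [0 < d] provides the other vertex. *)
Lemma bary_coef_neq0 K j : (0 < d)%N -> nondegenerate K ->
  exists i, invmx (vmat K) (rshift 1 i) j != 0.
Proof.
move=> d0 Ku; apply: contrapT => H.
have c0 i : invmx (vmat K) (rshift 1 i) j = 0.
  by apply/eqP/negPn/negP => ci; apply: H; exists i.
have [k kj] : exists k : 'I_d.+1, k != j.
  have [->|j0] := eqVneq j ord0; last by exists ord0; rewrite eq_sym.
  by exists ord_max; rewrite -val_eqE /= -lt0n.
have E y : bary K y 0 j = invmx (vmat K) (@lshift 1 d ord0) j.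
  by rewrite baryE big1 ?add0r// => i _; rewrite c0 mul0r.
have := E (row j K); rewrite -(E (row k K)) !bary_vertex// !mxE !eqxx/=.
by rewrite eq_sym (negbTE kj) => /eqP; rewrite oner_eq0.
Qed.

End simplices.

(** * Finite element functions and the set on which they have gradients *)

Section finite_element_space.
Context (R : realType) (d : nat) (l : R) (Th : seq (simplex R d)).
Implicit Types (f g v w : 'rV[R]_d -> R) (K : simplex R d) (x : 'rV[R]_d).

Lemma VhD v w : Vh l Th v -> Vh l Th w -> Vh l Th (fun x => v x + w x).
Proof.
move=> [pv cv av] [pw cw aw]; split.
- by move=> x i; rewrite pv pw.
- by move=> x; apply: (@continuousD R _ _ v w x); [exact: cv|exact: cw].
- move=> K KT; have [a [b ab]] := av K KT; have [a' [b' ab']] := aw K KT.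
  exists (a + a'), (b + b') => x xK; rewrite ab// ab'// mulmxDr [in RHS]mxE.
  by rewrite addrACA.
Qed.

Lemma VhZ (c : R) v : Vh l Th v -> Vh l Th (fun x => c * v x).
Proof.
move=> [pv cv av]; split.
- by move=> x i; rewrite pv.
- move=> x; apply: (@continuousM R _ (cst c) v x); [exact: cst_continuous|exact: cv].
- move=> K KT; have [a [b ab]] := av K KT.
  exists (c *: a), (c * b) => x xK; rewrite ab// -scalemxAr [in RHS]mxE.
  by rewrite mulrDr.
Qed.

Lemma VhB v w : Vh l Th v -> Vh l Th w -> Vh l Th (fun x => v x - w x).
Proof.
move=> hv hw; have := VhD hv (VhZ (-1) hw); congr Vh.
by apply/funext => x; rewrite mulN1r.
Qed.

Definition simplicial : set 'rV[R]_d :=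
  [set x | exists2 K, K \in Th & open_simplex K x].

(** The points of the cube that are interior to some simplex. There every finite element function is
    locally affine, so the total operator [pder] returns its true derivative. *)
Definition gset : set (d.-tuple (measurableTypeR R)) :=
  @cube R l d `&` [set y | simplicial (rv y)].

Hypothesis Th_ok : triangulation l Th.
Hypothesis d0 : (0 < d)%N.

Lemma rvE (y : d.-tuple (measurableTypeR R)) i : rv y 0 i = tnth y i.
Proof. by rewrite mxE. Qed.

Lemma measurable_rv (A : set (d.-tuple (measurableTypeR R))) i :
  measurable_fun A (fun y : d.-tuple (measurableTypeR R) => rv y 0 i).
Proof.
apply: (measurable_funS measurableT (@subsetT _ A)).
rewrite (_ : (fun _ => _) = fun y => tnth y i); first exact: measurable_tnth.
by apply/funext => y; rewrite rvE.
Qed.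

Lemma measurable_rv_open (A : set (d.-tuple (measurableTypeR R))) (W : set 'rV[R]_d) :
  measurable A -> open W -> measurable (A `&` [set y | W (rv y)]).
Proof.
by move=> mA oW; apply: (measurable_preimage_open (z := @rv R d)) => // i;
  exact: measurable_rv.
Qed.

Lemma open_simplicial : open simplicial.
Proof.
rewrite (_ : simplicial = \bigcup_(K in [set K | K \in Th]) open_simplex K).
  by apply: bigcup_open => K _; exact: open_open_simplex.
by apply/seteqP; split=> x [K KT xK]; exists K.
Qed.

Lemma measurable_gset : measurable gset.
Proof.
by apply: measurable_rv_open; [exact: measurable_cube|exact: open_simplicial].
Qed.

(** A point of the cube outside all open simplices lies in a closed one with a vanishing barycentric
    coordinate, hence on one of finitely many hyperplanes. *)
Lemma gset_conull : cube_measure l d (~` gset) = 0%E.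
Proof.
apply/negligibleP; first by apply: measurableC; exact: measurable_gset.
have [ndK covK _] := Th_ok.
(* The simplices, and further on the barycentric coordinates, are numbered by all naturals so that
   countable subadditivity applies; indices out of range contribute the empty set. *)
apply: (@negligibleS _ _ _ (cube_measure l d) ((~` @cube R l d) `|`
    \bigcup_m [set y | exists j : 'I_d.+1, (m < size Th)%N /\
       bary (nth 0 Th m) (rv y) 0 j = 0])).
  move=> y; rewrite /gset setCI => -[yc|ns]; first by left.
  have [yc|yc] := pselect (@cube R l d y); last by left.
  right; have [K KT yK] : exists2 K, K \in Th & convex_hull (vertices K) (rv y).
    have : [set x : 'rV[R]_d | forall i, 0 <= x 0 i <= l] (rv y).
      by move=> i; rewrite rvE.
    by rewrite -covK => -[K KT yK]; exists K.
  have K0 := (convex_hull_bary _ (ndK K KT)).1 yK.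
  have [j yj] : exists j, bary K (rv y) 0 j = 0.
    apply: contrapT => H; apply: ns; exists K => // j.
    rewrite lt_neqAle K0 andbT eq_sym; apply/eqP => yj; apply: H; by exists j.
  by exists (index K Th) => //; exists j; rewrite index_mem KT nth_index.
apply: negligibleU.
  apply/negligibleP; last exact: cube_measure_setC_cube.
  by apply: measurableC; exact: measurable_cube.
apply: negligible_bigcup => m.
have [ms|ms] := ltnP m (size Th); last first.
  apply: (@negligibleS _ _ _ (cube_measure l d) set0); last exact: negligible_set0.
  by move=> y [j []].
have KT := mem_nth 0 ms; set K := nth 0 Th m in KT *.
apply: (@negligibleS _ _ _ (cube_measure l d)
    (\bigcup_k [set y | exists j : 'I_d.+1, j = k :> nat /\ bary K (rv y) 0 j = 0])).
  by move=> y [j [_ yj]]; exists j => //; exists j.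
apply: negligible_bigcup => k.
have [kd|kd] := ltnP k d.+1; last first.
  apply: (@negligibleS _ _ _ (cube_measure l d) set0); last exact: negligible_set0.
  by move=> y [j [jk _]]; have := ltn_ord j; rewrite jk ltnNge kd.
pose j := Ordinal kd.
have H := cube_measure_hyperplane l
  (invmx (row_mx (const_mx 1 : 'cV_d.+1) K : 'M[R]_d.+1) (@lshift 1 d ord0) j)
  (bary_coef_neq0 j d0 (ndK K KT)).
apply: negligibleS; last first.
  apply/(negligibleP _ _).2; last exact: H.
  rewrite -[X in measurable X]setTI.
  by apply: (@measurable_affine _ _ _ _ measurableT [set 0%R]).
move=> y [i [ik]]; have -> : i = j by exact/val_inj.
rewrite baryE /= => yj; rewrite -[RHS]yj; congr (_ + _).
by apply: eq_bigr => i' _; rewrite rvE.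
Qed.

Lemma Vh_affine v K : nondegenerate K -> K \in Th -> Vh l Th v ->
  exists a : 'cV[R]_d, forall x, open_simplex K x ->
    (exists b, \forall y \near x, v y = (y *m a) 0 0 + b) /\
    forall i, is_derive x (unit_vec R i) v (a i 0).
Proof.
move=> Ku KT [_ _ /(_ K KT)[a [b ab]]]; exists a => x xK.
have nK : \forall y \near x, v y = (y *m a) 0 0 + b.
  have : nbhs x (open_simplex K) by apply: open_nbhs_nbhs; split; [exact: open_open_simplex|].
  by apply: filterS => y /(open_simplex_hull Ku); exact: ab.
split; first by exists b.
move=> i; apply: (near_eq_is_derive (f := fun y => (y *m a) 0 0 + b)).
  by near=> y; apply/esym; near: y.
rewrite (_ : (fun _ => _) =
    (\sum_j (a j 0 *: (fun y : 'rV[R]_d => y 0 j))) \+ cst b); last first.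
  apply/funext => y; rewrite /= fct_sumE mxE; congr (_ + _).
  by apply: eq_bigr => j _; rewrite mulrC.
have dd : is_derive x (unit_vec R i)
   ((\sum_j (a j 0 *: (fun y : 'rV[R]_d => y 0 j))) \+ cst b)
   (\sum_j (a j 0 *: ((j == i)%:R : R)) + 0).
  apply: is_deriveD; apply: is_derive_sum => j; apply: is_deriveZ.
  exact: is_derive_coord.
move: dd; congr is_derive; rewrite addr0 (bigD1 i)//= eqxx big1 => [|j /negbTE ->].
  by rewrite addr0 [_ *: _]mulr1.
by rewrite [_ *: _]mulr0.
Unshelve. all: by end_near. Qed.

Lemma Vh_derivable v x : Vh l Th v -> simplicial x ->
  forall i, derivable v x (unit_vec R i).
Proof.
move=> hv [K KT xK] i; have [ndK _ _] := Th_ok.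
by have [a /(_ x xK)[_ /(_ i)[]]] := Vh_affine (ndK K KT) KT hv.
Qed.

Lemma Vh_gradB v w x : Vh l Th v -> Vh l Th w -> simplicial x ->
  grad (fun y => v y - w y) x = grad v x - grad w x.
Proof.
move=> hv hw xs; apply/colP => i; rewrite !mxE.
by rewrite -[LHS]/('D_(unit_vec R i) (v - w) x) deriveB//; exact: Vh_derivable.
Qed.

Lemma Vh_gradD v w x : Vh l Th v -> Vh l Th w -> simplicial x ->
  grad (fun y => v y + w y) x = grad v x + grad w x.
Proof.
move=> hv hw xs; apply/colP => i; rewrite !mxE.
by rewrite -[LHS]/('D_(unit_vec R i) (v + w) x) deriveD//; exact: Vh_derivable.
Qed.

Lemma Vh_gradZ (c : R) v x : Vh l Th v -> simplicial x ->
  grad (fun y => c * v y) x = c *: grad v x.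
Proof.
move=> hv xs; apply/colP => i; rewrite !mxE.
by rewrite -[LHS]/('D_(unit_vec R i) (c *: v) x) deriveZ//; exact: Vh_derivable.
Qed.

(** Both conditions concern [gset] alone. The class contains finite element functions and their
    derivatives, is stable under the algebraic operations, and consists of integrable functions. *)
Definition nice f := measurable_fun gset (f \o @rv R d) /\
  exists B, forall y, gset y -> `|f (rv y)| <= B.

Lemma Vh_nice v : Vh l Th v -> nice v.
Proof.
move=> [_ cv _]; split.
  apply: (measurable_comp_open (U := setT)) => //.
  - exact: measurable_gset.
  - by move=> i; exact: measurable_rv.
  - exact: openT.
  - by move=> x _; exact: cv.
have /compact_bounded[B [_ BP]] :
    compact [set v x | x in box (const_mx 0) (const_mx l : 'rV[R]_d)].
  apply: continuous_compact; last exact: box_compact.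
  exact: continuous_subspaceT.
exists (`|B| + 1) => y [yc _]; apply: (BP (`|B| + 1)).
  by rewrite (le_lt_trans (ler_norm _))// ltrDl.
by exists (rv y) => // i; rewrite !mxE.
Qed.

(** The derivative is constant on each open simplex; finitely many constants are patched by
    induction over the list of simplices. *)
Lemma Vh_pder_nice v i : Vh l Th v -> nice (pder i v).
Proof.
move=> hv; have [ndK _ _] := Th_ok.
suff H (s : seq (simplex R d)) : {subset s <= Th} ->
    measurable_fun (@cube R l d `&` [set y | exists2 K, K \in s & open_simplex K (rv y)])
      (pder i v \o @rv R d) /\
    exists B, forall y, [set y | exists2 K, K \in s & open_simplex K (rv y)] y ->
      `|pder i v (rv y)| <= B.
  have [m1 [B BP]] := H Th (fun _ h => h).
  by split=> //; exists B => y [_ ys]; exact: BP.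
elim: s => [_|K s IH sT].
  split; last by exists 0 => y [].
  rewrite (_ : _ `&` _ = set0); first exact: measurable_fun_set0.
  by apply/seteqP; split=> // y [_ []].
have [m1 [B BP]] := IH (fun K' h => sT K' (@mem_behead _ (K :: s) K' h)).
have KT : K \in Th by apply: sT; rewrite inE eqxx.
have [a aP] := Vh_affine (ndK K KT) KT hv.
have dE x : open_simplex K x -> pder i v x = a i 0.
  by move=> /aP[_ /(_ i)[]].
split; last first.
  exists (Num.max `|a i 0| B) => y [K' /[!inE] /orP[/eqP -> /dE ->|K's yK']].
    by rewrite le_max lexx.
  by rewrite le_max BP ?orbT//; exists K'.
rewrite (_ : _ `&` _ = (@cube R l d `&` [set y | open_simplex K (rv y)]) `|`
  (@cube R l d `&` [set y | exists2 K, K \in s & open_simplex K (rv y)])); last first.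
  apply/seteqP; split=> [y [yc [K' /[!inE] /orP[/eqP ->|K's] yK']]|y [[yc yK]|[yc [K' K's yK']]]].
  - by left.
  - by right; split=> //; exists K'.
  - by split=> //; exists K => //; rewrite inE eqxx.
  - by split=> //; exists K' => //; rewrite inE K's orbT.
apply/measurable_funU.
- by apply: measurable_rv_open; [exact: measurable_cube|exact: open_open_simplex].
- apply: (measurable_rv_open (W := [set x | exists2 K, K \in s & open_simplex K x])).
    exact: measurable_cube.
  rewrite (_ : [set x | _] = \bigcup_(K in [set K | K \in s]) open_simplex K).
    by apply: bigcup_open => K' _; exact: open_open_simplex.
  by apply/seteqP; split=> x [K' ? ?]; exists K'.
- split=> //; apply: (eq_measurable_fun (cst (a i 0))) => [y|]; last exact: measurable_cst.
  by rewrite inE => -[_ /dE].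
Qed.

End finite_element_space.

(** * Calculus of the integral for functions that are nice inside the simplices *)

Section integration.
Context (R : realType) (d : nat) (l : R) (Th : seq (simplex R d)).
Implicit Types (f g v w : 'rV[R]_d -> R) (x : 'rV[R]_d) (F G : 'rV[R]_d -> 'cV[R]_d).
Hypothesis Th_ok : triangulation l Th.
Hypothesis d0 : (0 < d)%N.
Local Notation gset := (gset l Th).
Local Notation nice := (nice l Th).
Local Notation mu := (cube_measure l d).

Definition gpts : set 'rV[R]_d :=
  [set x : 'rV[R]_d | (forall i, 0 <= x 0 i <= l) /\ simplicial Th x].

Lemma gsetP y : gset y <-> gpts (rv y).
Proof.
by split=> -[yc ys]; split=> // i; have := yc i; rewrite rvE.
Qed.

Lemma gpts_rv x : gpts x -> exists2 y, gset y & x = rv y.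
Proof.
move=> xG; have E : x = rv (mktuple (fun i => x 0 i)).
  by apply/rowP => i; rewrite rvE tnth_mktuple.
by exists (mktuple (fun i => x 0 i)) => //; apply/gsetP; rewrite -E.
Qed.

Lemma nice_bound f : nice f -> exists2 B, 0 <= B & forall x, gpts x -> `|f x| <= B.
Proof.
move=> [_ [B BP]]; exists `|B| => // x /gpts_rv[y yG ->].
by rewrite (le_trans (BP y yG))// ler_norm.
Qed.

Lemma nice_ext f g : (forall x, gpts x -> f x = g x) -> nice f -> nice g.
Proof.
move=> fg [mf [B BP]]; split.
  by apply: eq_measurable_fun mf => y; rewrite inE => /gsetP /fg.
by exists B => y yG; rewrite -fg; [exact: BP|exact/gsetP].
Qed.

Lemma nice_cst (c : R) : nice (fun=> c).
Proof. by split; [exact: measurable_cst|exists `|c|]. Qed.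

Lemma niceD f g : nice f -> nice g -> nice (fun x => f x + g x).
Proof.
move=> [mf [B BP]] [mg [B' BP']]; split; first exact: measurable_funD.
by exists (B + B') => y yG; rewrite (le_trans (ler_normD _ _))// lerD ?BP ?BP'.
Qed.

Lemma niceM f g : nice f -> nice g -> nice (fun x => f x * g x).
Proof.
move=> [mf [B BP]] [mg [B' BP']]; split; first exact: measurable_funM.
by exists (B * B') => y yG; rewrite normrM ler_pM ?BP ?BP'.
Qed.

Lemma niceZ (c : R) f : nice f -> nice (fun x => c * f x).
Proof. by move=> nf; apply: niceM => //; exact: nice_cst. Qed.

Lemma niceN f : nice f -> nice (fun x => - f x).
Proof. by move=> /(niceZ (-1)); apply: nice_ext => x _; rewrite mulN1r. Qed.

Lemma niceB f g : nice f -> nice g -> nice (fun x => f x - g x).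
Proof. by move=> nf /niceN; exact: niceD. Qed.

Lemma niceX f n : nice f -> nice (fun x => f x ^+ n).
Proof.
move=> nf; elim: n => [|n IH]; first exact: nice_cst.
by apply: nice_ext (niceM nf IH) => x _; rewrite exprS.
Qed.

Lemma nice_sum (I : Type) (r : seq I) (F : I -> 'rV[R]_d -> R) :
  (forall i, nice (F i)) -> nice (fun x => \sum_(i <- r) F i x).
Proof.
move=> nF; elim: r => [|i r IH].
  by apply: nice_ext (nice_cst 0) => x _; rewrite big_nil.
by apply: nice_ext (niceD (nF i) IH) => x _; rewrite big_cons.
Qed.

Lemma nice_norm f : nice f -> nice (fun x => `|f x|).
Proof.
move=> [mf [B BP]]; split; first exact: measurableT_comp.
by exists B => y yG; rewrite normr_id BP.
Qed.

(** Passing to [gset] is what gives linearity and monotonicity for integrands whose behaviour is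
    known inside the simplices only. *)
Lemma tintE f : tint l f = \int[mu]_(y in gset) f (rv y).
Proof.
rewrite /tint /Rintegral (integral_conull _ (measurable_gset l Th)) //.
exact: gset_conull.
Qed.

Lemma tint_ext f g : (forall x, gpts x -> f x = g x) -> tint l f = tint l g.
Proof.
move=> fg; rewrite !tintE; apply: eq_Rintegral => y.
by rewrite inE => /gsetP /fg.
Qed.

Lemma nice_integrable f : nice f -> mu.-integrable gset (EFin \o (f \o @rv R d)).
Proof.
move=> [mf [B BP]]; apply: measurable_bounded_integrable => //.
- exact: measurable_gset.
- by rewrite ltey_eq fin_num_measure//; exact: measurable_gset.
- by exists B; split; [exact: num_real|move=> M BM y yG; exact: (le_trans (BP y yG) (ltW BM))].
Qed.

Lemma tintD f g : nice f -> nice g ->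
  tint l (fun x => f x + g x) = tint l f + tint l g.
Proof.
by move=> nf ng; rewrite !tintE RintegralD//; [exact: measurable_gset| |];
  exact: nice_integrable.
Qed.

Lemma tintB f g : nice f -> nice g ->
  tint l (fun x => f x - g x) = tint l f - tint l g.
Proof.
by move=> nf ng; rewrite !tintE RintegralB//; [exact: measurable_gset| |];
  exact: nice_integrable.
Qed.

Lemma tintZ (c : R) f : nice f -> tint l (fun x => c * f x) = c * tint l f.
Proof.
by move=> nf; rewrite !tintE RintegralZl//; [exact: measurable_gset|];
  exact: nice_integrable.
Qed.

Lemma tintN f : nice f -> tint l (fun x => - f x) = - tint l f.
Proof.
move=> nf; rewrite -mulN1r -tintZ//; apply: tint_ext => x _.
by rewrite mulN1r.
Qed.

Lemma tint_ge0 f : (forall x, gpts x -> 0 <= f x) -> 0 <= tint l f.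
Proof. by move=> f0; rewrite tintE; apply: Rintegral_ge0 => y /gsetP /f0. Qed.

Lemma tint_le f g : nice f -> nice g -> (forall x, gpts x -> f x <= g x) ->
  tint l f <= tint l g.
Proof.
move=> nf ng fg; rewrite -subr_ge0 -tintB//; apply: tint_ge0 => x /fg.
by rewrite subr_ge0.
Qed.

Lemma ipC v w : ip l v w = ip l w v.
Proof. by apply: tint_ext => x _; rewrite mulrC. Qed.

Lemma ip_ext v v' w w' : (forall x, gpts x -> v x = v' x) ->
  (forall x, gpts x -> w x = w' x) -> ip l v w = ip l v' w'.
Proof. by move=> vv ww; apply: tint_ext => x xG; rewrite vv// ww. Qed.

Lemma ip_ge0 v : 0 <= ip l v v.
Proof. by apply: tint_ge0 => x _; rewrite -expr2 sqr_ge0. Qed.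

Lemma norm0_sqr v : norm0 l v ^+ 2 = ip l v v.
Proof. by rewrite /norm0 sqr_sqrtr// ip_ge0. Qed.

Definition niceV n (F : 'rV[R]_d -> 'cV[R]_n) := forall i, nice (fun x => F x i 0).

Lemma nice_dot n (F G : 'rV[R]_d -> 'cV[R]_n) : niceV F -> niceV G -> nice (fun x => dot (F x) (G x)).
Proof.
move=> nF nG; apply: nice_ext (nice_sum (index_enum _) (fun i => niceM (nF i) (nG i))) => x _.
by rewrite dotE.
Qed.

Lemma niceV_grad v : Vh l Th v -> niceV (grad v).
Proof.
move=> hv i; apply: nice_ext (Vh_pder_nice Th_ok i hv) => x _.
by rewrite mxE.
Qed.

Lemma niceVD n (F G : 'rV[R]_d -> 'cV[R]_n) : niceV F -> niceV G -> niceV (fun x => F x + G x).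
Proof. by move=> nF nG i; apply: nice_ext (niceD (nF i) (nG i)) => x _; rewrite mxE. Qed.

Lemma niceVB n (F G : 'rV[R]_d -> 'cV[R]_n) : niceV F -> niceV G -> niceV (fun x => F x - G x).
Proof. by move=> nF nG i; apply: nice_ext (niceB (nF i) (nG i)) => x _; rewrite !mxE. Qed.

Lemma niceVZ n f (G : 'rV[R]_d -> 'cV[R]_n) : nice f -> niceV G -> niceV (fun x => f x *: G x).
Proof. by move=> nF nG i; apply: nice_ext (niceM nF (nG i)) => x _; rewrite mxE. Qed.

Lemma niceVM n (A : 'rV[R]_d -> 'M[R]_n) (G : 'rV[R]_d -> 'cV[R]_n) : (forall i j, nice (fun x => A x i j)) ->
  niceV G -> niceV (fun x => A x *m G x).
Proof.
move=> nA nG i.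
by apply: nice_ext (nice_sum (index_enum _) (fun j => niceM (nA i j) (nG j))) => x _;
  rewrite mxE.
Qed.

Lemma dot_ge0 n (F : 'cV[R]_n) : 0 <= dot F F.
Proof. by rewrite dotE sumr_ge0// => i _; rewrite -expr2 sqr_ge0. Qed.

Lemma ipv_ge0 F : 0 <= ipv l F F.
Proof. by apply: tint_ge0 => x _; exact: dot_ge0. Qed.

Lemma norm0v_sqr F : norm0v l F ^+ 2 = ipv l F F.
Proof. by rewrite /norm0v sqr_sqrtr// ipv_ge0. Qed.

Lemma norm1_sqr v G : norm1 l v G ^+ 2 = ip l v v + ipv l G G.
Proof. by rewrite /norm1 sqr_sqrtr// addr_ge0 ?ip_ge0 ?ipv_ge0. Qed.

Lemma ipDl v v' w : nice v -> nice v' -> nice w ->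
  ip l (fun x => v x + v' x) w = ip l v w + ip l v' w.
Proof.
move=> nv nv' nw; rewrite /ip -tintD; [|exact: niceM|exact: niceM].
by apply: tint_ext => x _; rewrite mulrDl.
Qed.

Lemma ipBl v v' w : nice v -> nice v' -> nice w ->
  ip l (fun x => v x - v' x) w = ip l v w - ip l v' w.
Proof.
move=> nv nv' nw; rewrite /ip -tintB; [|exact: niceM|exact: niceM].
by apply: tint_ext => x _; rewrite mulrBl.
Qed.

Lemma ipZl (c : R) v w : nice v -> nice w -> ip l (fun x => c * v x) w = c * ip l v w.
Proof.
move=> nv nw; rewrite /ip -tintZ; last exact: niceM.
by apply: tint_ext => x _; rewrite mulrA.
Qed.

Lemma ipDr v w w' : nice v -> nice w -> nice w' ->
  ip l v (fun x => w x + w' x) = ip l v w + ip l v w'.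
Proof. by move=> *; rewrite ipC ipDl// !(ipC v). Qed.

Lemma ipBr v w w' : nice v -> nice w -> nice w' ->
  ip l v (fun x => w x - w' x) = ip l v w - ip l v w'.
Proof. by move=> *; rewrite ipC ipBl// !(ipC v). Qed.

Lemma ipZr (c : R) v w : nice v -> nice w -> ip l v (fun x => c * w x) = c * ip l v w.
Proof. by move=> *; rewrite ipC ipZl// (ipC v). Qed.

(** Pointwise completion of the square; the weight [e] stays free for the later absorption. *)
Lemma ip_young v w (e : R) : nice v -> nice w -> 0 < e ->
  ip l v w <= e * ip l v v + (4 * e)^-1 * ip l w w.
Proof.
move=> nv nw e0; rewrite /ip -!tintZ; [|exact: niceM|exact: niceM].
have e40 : 0 < 4 * e by rewrite mulr_gt0.
rewrite -tintD; [|exact/niceZ/niceM|exact/niceZ/niceM].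
apply: tint_le => [||x _]; first exact: niceM.
  by apply: niceD; exact/niceZ/niceM.
rewrite -subr_ge0 -(pmulr_rge0 _ e40).
rewrite (_ : 4 * e * _ = (2 * e * v x - w x) ^+ 2) ?sqr_ge0//.
by field; rewrite gt_eqF.
Qed.

Lemma dot_young n (F G : 'cV[R]_n) (e : R) : 0 < e ->
  dot F G <= e * dot F F + (4 * e)^-1 * dot G G.
Proof.
move=> e0; rewrite !dotE !mulr_sumr -big_split/=; apply: ler_sum => i _.
have e40 : 0 < 4 * e by rewrite mulr_gt0.
rewrite -subr_ge0 -(pmulr_rge0 _ e40).
rewrite (_ : 4 * e * _ = (2 * e * F i 0 - G i 0) ^+ 2) ?sqr_ge0//.
by move: (F i 0) (G i 0) => p q; field; rewrite gt_eqF.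
Qed.

Lemma ipv_young F G (e : R) : niceV F -> niceV G -> 0 < e ->
  ipv l F G <= e * ipv l F F + (4 * e)^-1 * ipv l G G.
Proof.
move=> nF nG e0; have nFF := nice_dot nF nF; have nGG := nice_dot nG nG.
rewrite /ipv -!tintZ// -tintD; [|exact: niceZ|exact: niceZ].
apply: tint_le => [||x _]; first exact: nice_dot.
  by apply: niceD; exact: niceZ.
exact: dot_young.
Qed.

End integration.

(** * Translation invariance of integrals of periodic functions *)

Section translation.
Context (R : realType).
Local Open Scope ereal_scope.

Lemma lebesgue_measure_translation (h : R) (A : set R) : measurable A ->
  lebesgue_measure ((fun x : R => x + h)%R @^-1` A) = lebesgue_measure A.
Proof.
move=> mA.
have mh : measurable_fun setT (fun x : measurableTypeR R => (x + h)%R : measurableTypeR R).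
  by apply: measurable_funD => //; exact: measurable_id.
apply/esym; apply: (@lebesgue_measure_unique R (pushforward lebesgue_measure
  (fun x : measurableTypeR R => (x + h)%R : measurableTypeR R))) => //= _ [[a b]] _ <-.
rewrite /pushforward /=.
have -> : (fun x : R => x + h)%R @^-1` `]a, b]%classic = `](a - h)%R, (b - h)%R]%classic.
  by apply/seteqP; split=> x; rewrite /= !in_itv/= ltrBlDr lerBrDr.
rewrite !lebesgue_measure_itv/= !lte_fin ltrD2r.
by case: ifP => // _; rewrite -!EFinB; congr EFin; ring.
Qed.

Lemma ge0_integral_translation (h : R) (D : set R) (G : R -> \bar R) : measurable D ->
  measurable_fun setT G -> (forall x, 0 <= G x) ->
  \int[lebesgue_measure]_(x in (fun x : R => x + h)%R @^-1` D) G (x + h)%R =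
  \int[lebesgue_measure]_(x in D) G x.
Proof.
move=> mD mG G0.
have mh : measurable_fun setT (fun x : measurableTypeR R => (x + h)%R : measurableTypeR R).
  by apply: measurable_funD => //; exact: measurable_id.
have := @ge0_integral_pushforward _ _ _ _ R _ mh lebesgue_measure D G mD
  (measurable_funS measurableT (@subsetT _ D) mG) (fun x _ => G0 x).
move=> H; apply: etrans (esym H) _.
apply: eq_measure_integral => A mA _.
by rewrite /pushforward /=; exact: lebesgue_measure_translation.
Qed.

Lemma integral_itv_measure (l : R) (G : R -> \bar R) : (0 < l)%R ->
  measurable_fun setT G -> 
  \int[itv_measure 0 l]_x G x = \int[lebesgue_measure]_(x in `[0%R, l[%classic) G x.
Proof.
move=> l0 mG.
rewrite (@integral_conull _ _ _ (itv_measure 0 l) `[0%R, l]%classic); last 2 first.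
- exact: measurable_itv.
- by rewrite [LHS]itv_measureE setICl measure0.
rewrite integral_itv_bndo_bndc; last exact: measurable_funS mG.
apply: eq_measure_integral => A mA AD.
by rewrite [LHS]itv_measureE; congr (lebesgue_measure _); apply/setIidl.
Qed.

(** Cut the period at [l - h]: the part that the shift moves beyond [l] returns by periodicity to
    the interval from 0 to [h]. Half-open intervals keep the pieces disjoint. *)
Lemma ge0_integral_periodic (l h : R) (G : R -> \bar R) : (0 < l)%R -> (0 <= h <= l)%R ->
  measurable_fun setT G -> (forall x, 0 <= G x) -> (forall x, G (x + l)%R = G x) ->
  \int[itv_measure 0 l]_x G (x + h)%R = \int[itv_measure 0 l]_x G x.
Proof.
move=> l0 /andP[h0 hl] mG G0 Gl.
have mGh c : measurable_fun setT (fun x : R => G (x + c)%R).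
  apply: (measurableT_comp mG); apply: measurable_funD => //; exact: measurable_id.
rewrite !integral_itv_measure//.
have -> : `[0%R, l[%classic = `[0%R, (l - h)%R[%classic `|` `[(l - h)%R, l[%classic :> set R.
  apply/seteqP; split=> x; rewrite /= !in_itv/=.
    by have [?|?] := ltP x (l - h)%R; [left|right]; lra.
  by case; lra.
have dj (a b c : R) : [disjoint `[a, b[%classic & `[b, c[%classic].
  apply/disj_setPRL => x; rewrite /= !in_itv/= => /andP[? ?] /andP[? ?].
  lra.
rewrite [LHS](@ge0_integral_setU _ _ _ lebesgue_measure _ _ (measurable_itv _)
  (measurable_itv _) _ (measurable_funS measurableT (@subsetT _ _) (mGh h))
  (fun x _ => G0 _) (dj _ _ _)).
have -> : `[0%R, (l - h)%R[%classic `|` `[(l - h)%R, l[%classic =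
   `[0%R, h[%classic `|` `[h, l[%classic :> set R.
  apply/seteqP; split=> x; rewrite /= !in_itv/= => -[] ?.
  - by have [?|?] := ltP x h; [left|right]; lra.
  - by have [?|?] := ltP x h; [left|right]; lra.
  - by have [?|?] := ltP x (l - h)%R; [left|right]; lra.
  - by have [?|?] := ltP x (l - h)%R; [left|right]; lra.
rewrite [RHS](@ge0_integral_setU _ _ _ lebesgue_measure _ _ (measurable_itv _)
  (measurable_itv _) _ (measurable_funS measurableT (@subsetT _ _) mG)
  (fun x _ => G0 _) (dj _ _ _)).
rewrite addeC; congr (_ + _).
  rewrite -(@ge0_integral_translation (h - l) `[0%R, h[%classic)//.
  have -> : (fun x : R => x + (h - l))%R @^-1` `[0%R, h[%classic = `[(l - h)%R, l[%classic.
    by apply/seteqP; split=> x; rewrite /= !in_itv/= => ?; lra.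
  by apply: eq_integral => x _; rewrite -[in RHS]Gl; congr G; ring.
rewrite -(@ge0_integral_translation h `[h, l[%classic)//.
congr (integral _ _ _); apply/seteqP; split=> x; rewrite /= !in_itv/= => ?; lra.
Qed.

Definition tshift n (i : 'I_n) (h : R) (y : n.-tuple (measurableTypeR R)) :
    n.-tuple (measurableTypeR R) := mktuple (fun j => tnth y j + h * (j == i)%:R)%R.

Lemma measurable_tshift n (i : 'I_n) h : measurable_fun setT (tshift i h).
Proof.
apply/measurable_fun_tnthP => j.
rewrite (_ : _ \o _ = fun y => (tnth y j + h * (j == i)%:R)%R).
  by apply: measurable_funD => //; exact: measurable_tnth.
by apply/funext => y /=; rewrite tnth_mktuple.
Qed.

Lemma measurable_tcons n : measurable_fun setT (@tcons R n).
Proof. exact: (@measurable_cons _ _ _ _ fst _ snd measurable_fst measurable_snd). Qed.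

Lemma ge0_integral_cube_cons (l : R) n (F : n.+1.-tuple (measurableTypeR R) -> \bar R) :
  measurable_fun setT F -> (forall y, 0 <= F y) ->
  \int[cube_measure l n.+1]_y F y =
  \int[(itv_measure 0 l \x cube_measure l n)]_p F (tcons p).
Proof.
move=> mF F0.
exact: (@ge0_integral_pushforward _ _ _ _ R _ (@measurable_tcons n)
  (itv_measure 0 l \x cube_measure l n) setT F measurableT mF (fun x _ => F0 x)).
Qed.

(** Induction with Tonelli's theorem: the shifted coordinate is either the first one, handled by
    [ge0_integral_periodic], or belongs to the remaining factor. *)
Lemma ge0_integral_cube_shift (l h : R) n (i : 'I_n)
    (F : n.-tuple (measurableTypeR R) -> \bar R) : (0 < l)%R -> (0 <= h <= l)%R ->
  measurable_fun setT F -> (forall y, 0 <= F y) -> (forall y, F (tshift i l y) = F y) ->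
  \int[cube_measure l n]_y F (tshift i h y) = \int[cube_measure l n]_y F y.
Proof.
move=> l0 hl; elim: n i F => [[]//|n IH] i F mF F0 Fl.
have mFh : measurable_fun setT (F \o tshift i h).
  exact: (measurableT_comp mF (@measurable_tshift _ i h)).
rewrite !ge0_integral_cube_cons//.
have mFt : measurable_fun setT (F \o @tcons R n).
  exact: (measurableT_comp mF (@measurable_tcons n)).
have mFht : measurable_fun setT ((F \o tshift i h) \o @tcons R n).
  exact: (measurableT_comp mFh (@measurable_tcons n)).
case: (unliftP ord0 i) => [j|] iE.
  have shE c x y : tshift i c (tcons (x, y)) = tcons (x, tshift j c y).
    apply: eq_from_tnth => k; rewrite tnth_mktuple iE.
    case: (unliftP ord0 k) => [k' ->|->].
      by rewrite !tnth_tconsS tnth_mktuple (inj_eq (@lift_inj _ ord0)).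
    by rewrite !tnth_tcons0 /= mulr0 addr0.
  rewrite [LHS](@fubini_tonelli1 _ _ _ _ R (itv_measure 0 l) (cube_measure l n) _ mFht (fun p => F0 _)).
  rewrite [RHS](@fubini_tonelli1 _ _ _ _ R (itv_measure 0 l) (cube_measure l n) _ mFt (fun p => F0 _)).
  apply: eq_integral => x _; rewrite /fubini_F /=.
  rewrite -(IH j (fun y => F (tcons (x, y))))//.
  - by apply: eq_integral => y _; rewrite shE.
  - exact: (measurableT_comp mFt (measurable_pair1 x)).
  - by move=> y; rewrite -shE.
have shE c x y : tshift i c (tcons (x, y)) = tcons (x + c, y)%R.
  apply: eq_from_tnth => k; rewrite tnth_mktuple iE.
  case: (unliftP ord0 k) => [k' ->|->].
    by rewrite !tnth_tconsS /= mulr0 addr0.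
  by rewrite !tnth_tcons0 /= mulr1.
rewrite [LHS](@fubini_tonelli2 _ _ _ _ R (itv_measure 0 l) (cube_measure l n) _ mFht (fun p => F0 _)).
rewrite [RHS](@fubini_tonelli2 _ _ _ _ R (itv_measure 0 l) (cube_measure l n) _ mFt (fun p => F0 _)).
apply: eq_integral => y _; rewrite /fubini_G /=.
rewrite -(@ge0_integral_periodic l h (fun x => F (tcons (x, y))))//.
- by apply: eq_integral => x _; rewrite shE.
- exact: (measurableT_comp mFt (measurable_pair2 y)).
- by move=> x; rewrite -shE.
Qed.

Lemma integral_cube_shift (l h : R) n (i : 'I_n)
    (F : n.-tuple (measurableTypeR R) -> \bar R) : (0 < l)%R -> (0 <= h <= l)%R ->
  measurable_fun setT F -> (forall y, F (tshift i l y) = F y) ->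
  \int[cube_measure l n]_y F (tshift i h y) = \int[cube_measure l n]_y F y.
Proof.
move=> l0 hl mF Fl; have FlE : F \o tshift i l = F by apply/funext.
rewrite [LHS]integralE [RHS]integralE; congr (_ - _).
- have H := @ge0_integral_cube_shift l h n i (F^\+) l0 hl (measurable_funepos mF)
    (fun y => funepos_ge0 F y).
  apply: etrans (H _) => [|y]; first by rewrite -[_^\+]/((F \o tshift i h)^\+) funepos_comp.
  by rewrite -[LHS]/((F^\+ \o tshift i l) y) -funepos_comp FlE.
- have H := @ge0_integral_cube_shift l h n i (F^\-) l0 hl (measurable_funeneg mF)
    (fun y => funeneg_ge0 F y).
  apply: etrans (H _) => [|y]; first by rewrite -[_^\-]/((F \o tshift i h)^\-) funeneg_comp.
  by rewrite -[LHS]/((F^\- \o tshift i l) y) -funeneg_comp FlE.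
Qed.

End translation.

Lemma tint_shift (R : realType) (d : nat) (l h : R) (i : 'I_d) (f : 'rV[R]_d -> R) :
  0 < l -> 0 <= h <= l -> measurable_fun setT (f \o @rv R d) ->
  (forall x, f (x + l *: unit_vec R i) = f x) ->
  tint l (fun x => f (x + h *: unit_vec R i)) = tint l f.
Proof.
move=> l0 hl mf fl.
have rvs c y : rv (tshift i c y) = rv y + c *: unit_vec R i.
  by apply/rowP => j; rewrite !mxE tnth_mktuple eqxx.
have := @integral_cube_shift R l h d i (fun y => (f (rv y))%:E) l0 hl.
move=> /(_ _ _)/(congr1 fine) H; rewrite /tint /Rintegral -H.
- by congr fine; apply: eq_integral => y _; rewrite rvs.
- exact/measurable_EFinP.
- by move=> y; rewrite rvs fl.
Qed.

(** * Lipschitz continuity of finite element functions along coordinate lines *)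

Section lipschitz_cover.
Context (R : realType).

(* A continuous function that is C-Lipschitz on each of finitely many sets
   covering [a, b] is C-Lipschitz: leave the set containing a at its supremum
   and recurse on the remaining sets. *)
Lemma lipschitz_cover (T : eqType) (A : T -> set R) (s : seq T) (g : R -> R) (C a b : R) :
  0 <= C -> a <= b -> (forall t, a <= t <= b -> {for t, continuous g}) ->
  (forall t, a <= t <= b -> exists2 k, k \in s & A k t) ->
  (forall k t t', k \in s -> A k t -> A k t' -> `|g t - g t'| <= C * `|t - t'|) ->
  `|g b - g a| <= C * (b - a).
Proof.
move=> C0; move: {2}(size s) (erefl (size s)) => m.
elim: m s a => [s a /size0nil -> ab _ cov|m IH s a sm ab cg cov lip].
  by have [|k] := cov a; rewrite ?lexx.
have [k ks ka] : exists2 k, k \in s & A k a by apply: cov; rewrite lexx.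
pose S := [set t | a <= t <= b /\ A k t].
have Sa : S a by rewrite /S/= lexx.
have hS : has_sup S by split; [exists a|exists b => t [/andP[]]].
pose c := sup S.
have ac : a <= c := ub_le_sup hS.2 Sa.
have cb : c <= b by apply: ge_sup; [exists a|move=> t [/andP[]]].
have cc : {for c, continuous g} by apply: cg; rewrite ac cb.
have gca : `|g c - g a| <= C * (c - a).
  apply/ler_addgt0Pr => e e0.
  have [d /= d0 dP] := (nbhs_ballP _ _).1 ((@cvgrPdist_lt _ _ _ _ _ _ _).1 cc e e0).
  have [t [/andP[at_ tb] kt] ct] := sup_adherent d0 hS.
  have tc : t <= c by apply: (ub_le_sup hS.2); split=> //; rewrite at_ tb.
  have /= H : `|g c - g t| < e.
    by apply: dP; rewrite /ball/= ger0_norm ?subr_ge0//; rewrite -/c in ct; lra.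
  have H2 := lip k t a ks kt ka; rewrite [`|t - a|]ger0_norm ?subr_ge0// in H2.
  have H3 : C * (t - a) <= C * (c - a) by rewrite ler_wpM2l// lerD2r.
  rewrite (_ : g c - g a = (g c - g t) + (g t - g a)); last by ring.
  by rewrite (le_trans (ler_normD _ _))//; lra.
have gbc : `|g b - g c| <= C * (b - c).
  have [->|ncb] := eqVneq c b; first by rewrite !subrr normr0 mulr0.
  have {}ncb : c < b by rewrite lt_neqAle ncb.
  apply/ler_addgt0Pr => e e0.
  have [d /= d0 dP] := (nbhs_ballP _ _).1 ((@cvgrPdist_lt _ _ _ _ _ _ _).1 cc e e0).
  pose c' := Num.min b (c + d / 2).
  have cc' : c < c' by rewrite lt_min ncb ltrDl divr_gt0.
  have c'b : c' <= b by rewrite ge_min lexx.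
  have c'd : c' <= c + d / 2 by rewrite ge_min lexx orbT.
  have /= H : `|g c - g c'| < e.
    by apply: dP; rewrite /ball/= distrC gtr0_norm ?subr_gt0//; lra.
  have H2 : `|g b - g c'| <= C * (b - c').
    apply: (IH (rem k s)) => //.
    - by rewrite size_rem// sm.
    - by move=> t /andP[t1 t2]; apply: cg; rewrite t2 andbT; lra.
    - move=> t /andP[t1 t2]; have [|j js jt] := cov t; first by rewrite t2 andbT; lra.
      exists j => //; have [jk|jk] := eqVneq j k; last first.
        by move: js; rewrite (perm_mem (perm_to_rem ks)) inE (negbTE jk).
      suff : t <= c by lra.
      apply: ub_le_sup; first exact: hS.2.
      by split; [rewrite t2 andbT; lra|rewrite -jk].
    - by move=> j t t' /mem_rem; exact: lip.
  have H3 : C * (b - c') <= C * (b - c) by rewrite ler_wpM2l// lerD2l lerN2 ltW.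
  rewrite (_ : g b - g c = (g b - g c') + (g c' - g c)); last by ring.
  by rewrite distrC in H; rewrite (le_trans (ler_normD _ _))//; lra.
rewrite (_ : g b - g a = (g b - g c) + (g c - g a)); last by ring.
rewrite (_ : C * (b - a) = C * (b - c) + C * (c - a)); last by ring.
by rewrite (le_trans (ler_normD _ _))// lerD.
Qed.

End lipschitz_cover.

Section Vh_lipschitz.
Context (R : realType) (d : nat) (l : R) (Th : seq (simplex R d)).
Implicit Types (v w : 'rV[R]_d -> R) (x : 'rV[R]_d).
Hypothesis Th_ok : triangulation l Th.
Hypothesis l0 : 0 < l.

Let pts : set 'rV[R]_d := [set x | forall i, 0 <= x 0 i <= l].

Lemma line_coord x (h : R) i j :
  (x + h *: unit_vec R i) 0 j = x 0 j + h * (j == i)%:R.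
Proof. by rewrite !mxE /= ?eqxx. Qed.

Lemma continuous_line x i (t : R) :
  {for t, continuous (fun t : R => x + t *: unit_vec R i)}.
Proof.
apply: (@continuousD R _ _ (cst x) (fun t : R => t *: unit_vec R i) t).
  exact: cst_continuous.
exact: scalel_continuous.
Qed.

(** On each simplex the slope in direction [i] is a coefficient of the affine function; the finitely
    many simplices cover the segment, so [lipschitz_cover] glues these estimates. *)
Lemma Vh_lipschitz_cube v i : Vh l Th v -> exists2 C, 0 <= C &
  forall x (h : R), pts x -> 0 <= h -> pts (x + h *: unit_vec R i) ->
    `|v (x + h *: unit_vec R i) - v x| <= C * h.
Proof.
move=> [_ cv av]; have [_ covT _] := Th_ok.
have [C C0 CP] : exists2 C, 0 <= C & forall K, K \in Th -> forall x t t',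
    convex_hull (vertices K) (x + t *: unit_vec R i) ->
    convex_hull (vertices K) (x + t' *: unit_vec R i) ->
    `|v (x + t *: unit_vec R i) - v (x + t' *: unit_vec R i)| <= C * `|t - t'|.
  suff H (s : seq (simplex R d)) : {subset s <= Th} -> exists2 C, 0 <= C &
      forall K, K \in s -> forall x t t',
      convex_hull (vertices K) (x + t *: unit_vec R i) ->
      convex_hull (vertices K) (x + t' *: unit_vec R i) ->
      `|v (x + t *: unit_vec R i) - v (x + t' *: unit_vec R i)| <= C * `|t - t'|.
    by have [C C0 CP] := H Th (fun _ h => h); exists C.
  elim: s => [_|K s IH sT]; first by exists 0.
  have [C C0 CP] := IH (fun K' h => sT K' (@mem_behead _ (K :: s) K' h)).
  have [a [b ab]] := av K (sT K (mem_head _ _)).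
  have aC : 0 <= `|a i 0| by [].
  exists (`|a i 0| + C); first by rewrite addr_ge0.
  move=> K' /[!inE] /orP[/eqP ->|K's] x t t' xt xt'; last first.
    by rewrite (le_trans (CP K' K's x t t' xt xt'))// ler_wpM2r// lerDr.
  have E u : ((x + u *: unit_vec R i) *m a) 0 0 = (x *m a) 0 0 + u * a i 0.
    rewrite mulmxDl [LHS]mxE; congr (_ + _).
    by rewrite -scalemxAl -rowE [LHS]mxE; congr (_ * _); rewrite mxE.
  rewrite ab// ab// !E.
  move: ((x *m a) 0 0) (a i 0) aC => p q q0.
  rewrite (_ : p + t * q + b - (p + t' * q + b) = q * (t - t')); last by ring.
  by rewrite normrM ler_wpM2r// lerDl.
exists C => // x h xp h0 xhp.
have := @lipschitz_cover R (simplex R d)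
  (fun K => [set t | convex_hull (vertices K) (x + t *: unit_vec R i)]) Th
  (fun t => v (x + t *: unit_vec R i)) C 0 h C0 h0.
rewrite scale0r addr0 subr0; apply.
- move=> t _; apply: (@continuous_comp _ _ _ (fun t : R => x + t *: unit_vec R i) v).
    exact: continuous_line.
  exact: cv.
- move=> t /andP[t0 th].
  have : pts (x + t *: unit_vec R i).
    move=> j; have := xp j; have := xhp j; rewrite !line_coord.
    by case: (j == i); rewrite ?mulr1 ?mulr0 => *; lra.
  move=> xt; have [K KT Kx] : [set x | exists2 K, K \in Th & convex_hull (vertices K) x]
      (x + t *: unit_vec R i) by rewrite covT; exact: xt.
  by exists K.
- by move=> K t t' KT Kt Kt'; exact: (CP K KT x t t' Kt Kt').
Qed.

(** A step of length at most [l] crosses the face of the cube at most once. The path is split there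
    and its outer part is moved back by one period. *)
Lemma Vh_lipschitz v i : Vh l Th v -> exists2 C, 0 <= C &
  forall x (h : R), pts x -> 0 <= h <= l -> `|v (x + h *: unit_vec R i) - v x| <= C * h.
Proof.
move=> hv; have [C C0 CP] := Vh_lipschitz_cube i hv; exists C => // x h xp /andP[h0 hl].
have [pv _ _] := hv.
have ptsD c : 0 <= x 0 i + c <= l -> pts (x + c *: unit_vec R i).
  move=> ci j; have := xp j; rewrite line_coord.
  by have [->|] := eqVneq j i; rewrite ?mulr1 ?mulr0 ?addr0.
have xi := xp i.
have [xh|xh] := leP (x 0 i + h) l.
  by apply: CP => //; apply: ptsD; lra.
pose c := l - x 0 i.
have c0 : 0 <= c by rewrite /c; lra.
have pc : pts (x + c *: unit_vec R i) by apply: ptsD; rewrite /c; lra.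
have pz : pts (x - x 0 i *: unit_vec R i) by rewrite -scaleNr; apply: ptsD; lra.
have e1 : v (x + c *: unit_vec R i) = v (x - x 0 i *: unit_vec R i).
  rewrite -[RHS](pv _ i) /c scalerBl; congr v.
  by rewrite addrA addrAC.
have e2 : v (x + h *: unit_vec R i) =
    v (x - x 0 i *: unit_vec R i + (h - c) *: unit_vec R i).
  rewrite -[RHS](pv _ i) -addrA -scalerDl -addrA -scaleNr -scalerDl.
  by congr (v (_ + _ *: _)); rewrite /c; ring.
have s1 := CP x c xp c0 pc.
have s2 : `|v (x + h *: unit_vec R i) - v (x - x 0 i *: unit_vec R i)| <= C * (h - c).
  rewrite e2; apply: CP => //; first by rewrite /c; lra.
  by rewrite -scaleNr -addrA -scalerDl; apply: ptsD; rewrite /c; lra.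
rewrite e1 in s1.
rewrite (_ : C * h = C * (h - c) + C * c); last by ring.
by rewrite (le_trans (ler_distD (v (x - x 0 i *: unit_vec R i)) _ _))// lerD.
Qed.

End Vh_lipschitz.

(** * Finite element functions in H1 and the dual norm *)

Section weak_gradient.
Context (R : realType) (d : nat) (l : R) (Th : seq (simplex R d)).
Implicit Types (f g v w phi : 'rV[R]_d -> R) (x : 'rV[R]_d) (F G : 'rV[R]_d -> 'cV[R]_d).
Hypothesis Th_ok : triangulation l Th.
Hypothesis d0 : (0 < d)%N.
Hypothesis l0 : 0 < l.
Local Notation gset := (gset l Th).
Local Notation gpts := (gpts l Th).
Local Notation nice := (nice l Th).
Local Notation mu := (cube_measure l d).

Lemma continuous_measurable_rv f : continuous f -> measurable_fun setT (f \o @rv R d).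
Proof.
move=> cf; apply: (measurable_comp_open (U := setT)) => //.
- by move=> i; exact: measurable_rv.
- exact: openT.
- by move=> x _; exact: cf.
Qed.

Lemma continuous_nice f : continuous f -> nice f.
Proof.
move=> cf; split.
  by apply: measurable_funS (continuous_measurable_rv cf).
have /compact_bounded[B [_ BP]] :
    compact [set f x | x in box (const_mx 0) (const_mx l : 'rV[R]_d)].
  apply: continuous_compact; last exact: box_compact.
  exact: continuous_subspaceT.
exists (`|B| + 1) => y [yc _]; apply: (BP (`|B| + 1)).
  by rewrite (le_lt_trans (ler_norm _))// ltrDl.
by exists (rv y) => // i; rewrite !mxE.
Qed.

Lemma tint_dominated (Q : nat -> 'rV[R]_d -> R) f (B : R) :
  (forall n, nice (Q n)) -> nice f ->
  (forall n x, gpts x -> `|Q n x| <= B) ->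
  (forall x, gpts x -> Q n x @[n --> \oo] --> f x) ->
  tint l (Q n) @[n --> \oo] --> tint l f.
Proof.
move=> nQ nf QB Qf.
have [] := @dominated_convergence _ _ _ mu gset (measurable_gset l Th)
  (fun n y => (Q n (rv y))%:E) (fun y => (f (rv y))%:E) (cst B%:E).
- by move=> n; apply/measurable_EFinP; exact: (nQ n).1.
- by apply/measurable_EFinP; exact: nf.1.
- apply: aeW => y /gsetP yG; apply/fine_cvgP; split; first exact: nearW.
  exact: Qf.
- exact: (nice_integrable (nice_cst l Th B)).
- by apply: aeW => y n /gsetP yG; rewrite abse_EFin lee_fin; exact: QB.
move=> fi _ fc.
have E : (tint l f)%:E = (\int[mu]_(y in gset) (f (rv y))%:E)%E.
  by rewrite (tintE Th_ok d0) /Rintegral fineK//; exact: (integrable_fin_num (measurable_gset l Th) fi).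
rewrite -E in fc; under eq_fun do rewrite (tintE Th_ok d0).
exact: (fine_cvg fc).
Qed.

Lemma tint_periodic_shift f i (h : R) : continuous f -> periodic l f -> 0 <= h <= l ->
  tint l (fun x => f (x + h *: unit_vec R i)) = tint l f.
Proof.
move=> cf pf hl; apply: tint_shift => //; exact: continuous_measurable_rv.
Qed.

Lemma cvg_difference_quotient f x i : derivable f x (unit_vec R i) ->
  (l / n.+1%:R)^-1 * (f (x + (l / n.+1%:R) *: unit_vec R i) - f x) @[n --> \oo] -->
  pder i f x.
Proof.
move=> df; apply/cvgrPdist_lt => e e0.
have [dl /= dl0 dP] := (nbhs_ballP _ _).1 ((@cvgrPdist_lt _ _ _ _ _ _ _).1 df e e0).
have dl0' : 0 < dl / l by rewrite divr_gt0.
have := @near_infty_natSinv_lt R (PosNum dl0'); apply: filterS => n /= nd.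
have h0 : 0 < l / n.+1%:R by rewrite divr_gt0.
have := dP (l / n.+1%:R); rewrite /ball/= sub0r normrN gtr0_norm// => H.
rewrite [x + _]addrC; apply: H; last by rewrite gt_eqF.
by rewrite mulrC -ltr_pdivlMr.
Qed.

Lemma continuous_shift f (c : 'rV[R]_d) : continuous f -> continuous (fun x => f (x + c)).
Proof.
move=> cf x; apply: (@continuous_comp _ _ _ (fun x => x + c) f); last exact: cf.
apply: (@continuousD R _ _ id (cst c) x); [exact: cvg_id|exact: cst_continuous].
Qed.

(** The difference quotients [Q n] of the periodic function [v * phi] have integral 0 by translation
    invariance, are bounded by the Lipschitz estimates, and converge inside the simplices to the
    derivative of the product. Dominated convergence concludes, and contributions of interelement
    faces never arise. *)
Lemma ip_by_parts v phi i : Vh l Th v -> smooth_on setT phi -> periodic l phi ->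
  ip l v (pder i phi) = - ip l (pder i v) phi.
Proof.
move=> hv sphi pphi; have [pv cv _] := hv.
have cphi : continuous phi by move=> x; have [] := sphi [::] x I.
have cdphi : continuous (pder i phi) by move=> x; have [] := sphi [:: i] x I.
have nv := Vh_nice hv; have ndv := Vh_pder_nice Th_ok i hv.
have nphi := continuous_nice cphi; have ndphi := continuous_nice cdphi.
pose P x := v x * phi x.
have cP : continuous P by move=> x; apply: (@continuousM R _ v phi x); [exact: cv|exact: cphi].
have pP : periodic l P by move=> x j; rewrite /P pv pphi.
pose h (n : nat) := l / n.+1%:R.
have h0 n : 0 < h n by rewrite divr_gt0.
have hl n : h n <= l by rewrite ler_pdivrMr//; apply: ler_peMr; [exact: ltW|rewrite ler1n].
pose Q n x := (h n)^-1 * (P (x + h n *: unit_vec R i) - P x).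
have nP := continuous_nice cP.
have nPh n := continuous_nice (continuous_shift (c := h n *: unit_vec R i) cP).
have nQ n : nice (Q n) by apply: niceZ; apply: niceB.
have Q0 n : tint l (Q n) = 0.
  rewrite (tintZ Th_ok d0)//; last exact: niceB.
  by rewrite (tintB Th_ok d0)// tint_periodic_shift ?subrr ?mulr0// ltW ?h0// hl.
have nf : nice (fun x => v x * pder i phi x + pder i v x * phi x).
  by apply: niceD; exact: niceM.
have Qf x : gpts x -> Q n x @[n --> \oo] --> v x * pder i phi x + pder i v x * phi x.
  move=> [_ xs]; have dv := Vh_derivable Th_ok hv xs (i := i).
  have dphi : derivable phi x (unit_vec R i) by have [_] := sphi [::] x I; exact.
  have := @cvg_difference_quotient (v * phi) x i (derivableM dv dphi).
  have -> // : pder i (v * phi) x = v x * pder i phi x + pder i v x * phi x.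
  by rewrite [LHS](deriveM dv dphi) /GRing.scale/= [X in _ + X]mulrC.
have [C C0 CP] := Vh_lipschitz Th_ok i hv.
have [Bv Bv0 BvP] := nice_bound nv.
(* The box extends to [2 * l] because points of the cube are shifted by at most [l]. *)
have [B B0 BP] : exists2 B, 0 < B & derivs_bounded (box (const_mx 0) (const_mx (2 * l))) phi B.
  exact: (smooth_derivs_bounded sphi).
have QB n x : gpts x -> `|Q n x| <= C * B + Bv * B.
  move=> xG; have [xc _] := xG.
  have bx : box (const_mx 0) (const_mx (2 * l)) x.
    by move=> j; have := xc j; rewrite !mxE; lra.
  have bxh : box (const_mx 0) (const_mx (2 * l)) (x + h n *: unit_vec R i).
    move=> j; have := xc j; have := h0 n; have := hl n; rewrite line_coord !mxE.
    by case: (j == i); rewrite ?mulr1 ?mulr0 => *; lra.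
  have e1 := CP x (h n) xc; rewrite hl (ltW (h0 n)) in e1; have {}e1 := e1 isT.
  have e2 : `|phi (x + h n *: unit_vec R i) - phi x| <= B * h n.
    have := @pder_lipschitz _ _ phi (const_mx 0) (const_mx (2 * l)) B x (x + h n *: unit_vec R i).
    have -> : l1 (x + h n *: unit_vec R i - x) = h n.
      rewrite addrAC subrr add0r /l1 (bigD1 i)//= big1.
        by rewrite !mxE !eqxx/= mulr1 addr0 gtr0_norm.
      by move=> j /negbTE ji; rewrite !mxE ji andbF mulr0 normr0.
    apply=> // y by_ j; split; first by have [//|_] := BP [::] y by_; exact.
    by have [] := BP [:: j] y by_.
  have e3 : `|phi (x + h n *: unit_vec R i)| <= B by have [] := BP [::] _ bxh.
  rewrite /Q normrM (gtr0_norm (_ : 0 < (h n)^-1)) ?invr_gt0// mulrC ler_pdivrMr// /P.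
  rewrite (_ : v (x + h n *: unit_vec R i) * phi (x + h n *: unit_vec R i) - v x * phi x =
    (v (x + h n *: unit_vec R i) - v x) * phi (x + h n *: unit_vec R i) +
    v x * (phi (x + h n *: unit_vec R i) - phi x)); last by ring.
  rewrite (le_trans (ler_normD _ _))// !normrM.
  rewrite (_ : (C * B + Bv * B) * h n = C * h n * B + Bv * (B * h n)); last by ring.
  by rewrite lerD// ler_pM// BvP.
have := tint_dominated nQ nf QB Qf.
have -> : (fun n => tint l (Q n)) = cst 0 by apply/funext.
move=> /cvg_lim; rewrite lim_cst// => /(_ _)/esym; rewrite (tintD Th_ok d0); [|exact: niceM|exact: niceM].
by move=> H; apply/eqP; rewrite -addr_eq0; apply/eqP; apply: H.
Qed.

Lemma nice_L2 f : measurable_fun setT (f \o @rv R d) -> nice f -> L2 l f.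
Proof.
move=> mf nf; split=> //.
have mf2 : measurable_fun setT (fun y => ((f \o @rv R d) y ^+ 2)%:E).
  by apply/measurable_EFinP; exact: measurable_funX.
have mG := measurable_gset l Th.
apply/(negligible_integrable (measurableC mG) measurableT mf2 (gset_conull Th_ok d0)).
rewrite setTD setCK; exact: (nice_integrable (niceX 2 nf)).
Qed.

(* the pointwise gradient of a finite element function, set to 0 on the null
   set where its measurability is unclear *)
Definition mgrad v x : 'cV[R]_d := if `[< gpts x >] then grad v x else 0.

Lemma mgradE v x : gpts x -> mgrad v x = grad v x.
Proof. by move=> xG; rewrite /mgrad asboolT. Qed.

(** This makes finite element functions competitors in the supremum that defines [norm_m1]. *)
Lemma Vh_H1 v : Vh l Th v -> H1 l v (mgrad v).
Proof.
move=> hv; have [pv cv _] := hv; split=> //.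
- by apply: nice_L2; [exact: continuous_measurable_rv|exact: Vh_nice].
- move=> i; apply: nice_L2; last first.
    by apply: nice_ext (niceV_grad Th_ok hv i) => x xG; rewrite mgradE.
  rewrite (_ : _ \o _ = (pder i v \o @rv R d) \_ gset).
    by apply/(measurable_restrictT _ (measurable_gset l Th)); exact: (Vh_pder_nice Th_ok i hv).1.
  apply/funext => y; rewrite /= /mgrad patchE; case: asboolP => [/gsetP yG|yG].
    by rewrite mem_set// mxE.
  by rewrite memNset ?mxE// => /gsetP.
- move=> phi i sphi pphi; rewrite (ip_by_parts i hv sphi pphi); congr (- _).
  by apply: (ip_ext Th_ok d0) => // x xG; rewrite mgradE// mxE.
Qed.

Lemma L2_young f g (e : R) : L2 l f -> L2 l g -> 0 < e ->
  ip l f g <= e * ip l f f + (4 * e)^-1 * ip l g g.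
Proof.
move=> [mf f2] [mg g2] e0.
have e40 : 0 < 4 * e by rewrite mulr_gt0.
have i1 : mu.-integrable setT (EFin \o (fun y => e * f (rv y) ^+ 2)).
  by have := integrableZl measurableT e f2; apply: eq_integrable => // y _; rewrite /= EFinM.
have i2 : mu.-integrable setT (EFin \o (fun y => (4 * e)^-1 * g (rv y) ^+ 2)).
  by have := integrableZl measurableT (4 * e)^-1 g2; apply: eq_integrable => // y _;
    rewrite /= EFinM.
have i3 : mu.-integrable setT (EFin \o (fun y => e * f (rv y) ^+ 2 + (4 * e)^-1 * g (rv y) ^+ 2)).
  by have := integrableD measurableT i1 i2; apply: eq_integrable.
have yg (p q : R) : p * q <= e * p ^+ 2 + (4 * e)^-1 * q ^+ 2.
  rewrite -subr_ge0 -(pmulr_rge0 _ e40).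
  rewrite (_ : 4 * e * _ = (2 * e * p - q) ^+ 2) ?sqr_ge0//.
  by field; rewrite gt_eqF.
have i4 : mu.-integrable setT (EFin \o (fun y => f (rv y) * g (rv y))).
  apply: le_integrable i3 => //.
    by apply/measurable_EFinP; exact: measurable_funM.
  move=> y _; rewrite !abse_EFin lee_fin.
  have H0 : 0 <= e * f (rv y) ^+ 2 + (4 * e)^-1 * g (rv y) ^+ 2.
    apply: addr_ge0; apply: mulr_ge0; rewrite ?sqr_ge0 ?invr_ge0//; exact: ltW.
  rewrite (ger0_norm H0) ler_norml; apply/andP; split; last exact: yg.
  by have := yg (- f (rv y)) (g (rv y)); rewrite sqrrN; lra.
have -> : e * ip l f f = \int[mu]_y (e * f (rv y) ^+ 2).
  by rewrite /ip /tint RintegralZl.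
have -> : (4 * e)^-1 * ip l g g = \int[mu]_y ((4 * e)^-1 * g (rv y) ^+ 2).
  by rewrite /ip /tint RintegralZl.
rewrite -RintegralD//; apply: le_Rintegral => // y _; exact: yg.
Qed.

(** An unbounded set would have [sup] equal to 0 by convention, so boundedness must be established
    before the dual norm can bound anything. It follows from Young's inequality with the H1 norm of
    [v] as weight. *)
Lemma norm_m1_has_ubound r : Vh l Th r ->
  has_ubound [set q | exists v G, [/\ H1 l v G, norm1 l v G != 0 & q = ip l r v / norm1 l v G]].
Proof.
move=> hr; exists (ip l r r + 1) => q [v [G [[_ v2 _ _] N0 ->]]].
have Np : 0 < norm1 l v G by rewrite lt_neqAle eq_sym N0 sqrtr_ge0.
have r2 : L2 l r.
  have [_ cr _] := hr.
  by apply: nice_L2; [exact: continuous_measurable_rv|exact: Vh_nice].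
have vN : ip l v v <= norm1 l v G ^+ 2.
  by rewrite (norm1_sqr Th_ok d0) lerDl (ipv_ge0 Th_ok d0).
have := L2_young r2 v2 Np.
rewrite ler_pdivrMr// => /le_trans; apply.
move: vN Np; move: (norm1 l v G) (ip l v v) (ip l r r) => N V p VN Np.
have H : (4 * N)^-1 * V <= N.
  rewrite mulrC ler_pdivrMr ?mulr_gt0//.
  by have := sqr_ge0 N; lra.
by lra.
Qed.

(** The pairing is at most the dual norm times the H1 norm, to which Young's inequality applies. A
    function of zero H1 norm is excluded from the supremum; its pairing is shown to be at most every
    positive [t]. *)
Lemma norm_m1_dual r v (e : R) : Vh l Th r -> Vh l Th v -> 0 < e ->
  ip l r v <= e * (ip l v v + ipv l (grad v) (grad v)) + (4 * e)^-1 * norm_m1 l r ^+ 2.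
Proof.
move=> hr hv e0.
have nr := Vh_nice hr; have nv := Vh_nice hv.
have NE : norm1 l v (mgrad v) ^+ 2 = ip l v v + ipv l (grad v) (grad v).
  rewrite (norm1_sqr Th_ok d0); congr (_ + _).
  by apply: (tint_ext Th_ok d0) => x xG; rewrite mgradE.
have e40 : 0 < 4 * e by rewrite mulr_gt0.
rewrite -NE; have [N0|N0] := eqVneq (norm1 l v (mgrad v)) 0.
  have v0 : ip l v v = 0.
    apply/eqP; rewrite eq_le (ip_ge0 Th_ok d0) andbT.
    have := ipv_ge0 Th_ok d0 (grad v).
    by move: NE; rewrite N0 expr0n/=; lra.
  rewrite N0 expr0n/= mulr0 add0r (@le_trans _ _ 0)//; last first.
    by rewrite mulr_ge0 ?sqr_ge0// invr_ge0 ltW.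
  apply/ler_addgt0Pr => t t0; rewrite add0r.
  have c0 : 0 < ip l r r + 1 by rewrite ltr_wpDl// (ip_ge0 Th_ok d0).
  have s0 : 0 < t / (ip l r r + 1) by rewrite divr_gt0.
  have := ip_young Th_ok d0 nr nv s0; rewrite v0 mulr0 addr0 => /le_trans; apply.
  by rewrite mulrAC ler_pdivrMr// ler_pM2l// lerDl.
have Np : 0 < norm1 l v (mgrad v) by rewrite lt_neqAle eq_sym N0 sqrtr_ge0.
have : ip l r v / norm1 l v (mgrad v) <= norm_m1 l r.
  apply: (ub_le_sup (norm_m1_has_ubound hr)); exists v, (mgrad v); split=> //.
  exact: Vh_H1.
rewrite ler_pdivrMr// => /le_trans; apply.
move: (norm1 l v _) (norm_m1 l r) => N m.
rewrite -subr_ge0 -(pmulr_rge0 _ e40).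
rewrite (_ : 4 * e * _ = (2 * e * N - m) ^+ 2) ?sqr_ge0//.
by field; rewrite gt_eqF.
Qed.

End weak_gradient.

(** * From essential bounds in space-time to bounds at grid times *)

Section pointwise_bounds.
Context (R : realType) (d : nat) (l T : R).
Implicit Types (A B : 'rV[R]_d -> R) (x : 'rV[R]_d).
Hypotheses (l0 : 0 < l) (T0 : 0 < T).
Local Notation space_time := (cube_measure l d \x itv_measure 0 T)%E.

Let pts : set 'rV[R]_d := [set x | forall i, 0 <= x 0 i <= l].

(** Such a box has positive measure even around a boundary point of the cube, so no null set
    contains it. *)
Lemma box_meets_conull (N : set (d.-tuple (measurableTypeR R) * measurableTypeR R))
    x (e a b : R) :
  measurable N -> space_time N = 0%E -> pts x -> 0 < e -> 0 <= a -> a < b -> b <= T ->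
  exists y t, [/\ forall i, `|rv y 0 i - x 0 i| < e, a <= t <= b & ~ N (y, t)].
Proof.
move=> mN N0 xp e0 a0 ab bT; apply: contrapT => H.
pose S1 := [set y : d.-tuple (measurableTypeR R) | forall i, `|tnth y i - x 0 i| < e].
have mS1 : measurable S1.
  apply: (@measurable_forall_tnth R d (fun i => [set z | `|z - x 0 i| < e])) => i.
  rewrite (_ : [set _ | _] = `](x 0 i - e), (x 0 i + e)[%classic); first exact: measurable_itv.
  by apply/seteqP; split=> z; rewrite /= in_itv/= ltr_distl.
have : (0 < space_time (S1 `*` (`[a, b]%classic : set (measurableTypeR R))))%E.
  rewrite product_measure1E//.
  rewrite mule_gt0//; first exact: cube_measure_ball_gt0.
  rewrite [X in (0 < X)%E]itv_measureE.
  rewrite (_ : _ `&` _ = `[a, b]%classic); last first.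
    apply/setIidl => t.
    by rewrite /= !in_itv/= => /andP[? ?]; apply/andP; split; lra.
  by rewrite lebesgue_measure_itv/= lte_fin ab -EFinB lte_fin subr_gt0.
rewrite ltNge => /negP; apply; rewrite -N0; apply: le_measure.
- by rewrite inE; apply: measurableX => //; exact: measurable_itv.
- by rewrite inE.
- move=> [y t] [/= yS]; rewrite in_itv/= => tab; apply: contrapT => nN.
  by apply: H; exists y, t; split=> // i; rewrite rvE.
Qed.

Lemma norm_oo_ae (g1 g2 g3 : R -> 'rV[R]_d -> R) (C : R) :
  (norm_oo T l g1 g2 g3 <= C%:E)%E ->
  exists N, [/\ measurable N, space_time N = 0%E & forall y t, ~ N (y, t) ->
    [/\ `|g1 t (rv y)| <= C, `|g2 t (rv y)| <= C & `|g3 t (rv y)| <= C]].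
Proof.
(* The norm of exponent infinity is an essential supremum under the condition that the measure is
   nonzero. *)
have mu0 : (0 < space_time setT)%E.
  apply: contrapT => /negP; rewrite -leNgt => H.
  have m0 : space_time setT = 0%E by apply/eqP; rewrite eq_le H measure_ge0.
  have p0 : pts (const_mx 0) by move=> i; rewrite mxE lexx ltW.
  by have [y [t [_ _ []]]] := box_meets_conull measurableT m0 p0 ltr01 (lexx _) T0 (lexx _).
rewrite /norm_oo Lnorm.unlock mu0 => /ess_sup_inf.ess_supP[N [mN N0 NP]].
exists N; split=> // y t nN.
have H : Num.sqrt (g1 t (rv y) ^+ 2 + g2 t (rv y) ^+ 2 + g3 t (rv y) ^+ 2) <= C.
  apply: contrapT => nC; apply: nN; apply: NP => /= Hle; apply: nC.
  by move: Hle; rewrite lee_fin ger0_norm// sqrtr_ge0.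
have s (p q r : R) : `|p| <= Num.sqrt (p ^+ 2 + q ^+ 2 + r ^+ 2).
  by rewrite -sqrtr_sqr ler_wsqrtr// -addrA lerDl addr_ge0 ?sqr_ge0.
split; apply: le_trans H; first exact: s.
- by rewrite [_ + g2 _ _ ^+ 2]addrC; exact: s.
- by rewrite addrC addrA; exact: s.
Qed.

(** The bounded values [(1 - s) * A y + s * B y] tend to [A x] when [s] tends to 0 and [y] to [x]
    together. *)
Lemma limit_bound A B x (C : R) : continuous A -> continuous B ->
  (forall s0 e : R, 0 < s0 -> s0 <= 1 -> 0 < e -> exists (s : R) (y : 'rV[R]_d),
    [/\ 0 <= s <= s0, forall i, `|y 0 i - x 0 i| < e & `|(1 - s) * A y + s * B y| <= C]) ->
  `|A x| <= C.
Proof.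
move=> cA cB H; apply/ler_addgt0Pr => e e0.
have e2 : 0 < e / 3 by rewrite divr_gt0.
have [dA /= dA0 dAP] := (nbhs_ballP _ _).1 ((@cvgrPdist_lt _ _ _ _ _ _ _).1 (cA x) _ e2).
have [dB /= dB0 dBP] := (nbhs_ballP _ _).1 ((@cvgrPdist_lt _ _ _ _ _ _ _).1 (cB x) _ e2).
pose M := `|A x| + `|B x| + e.
have M0 : 0 < M by rewrite ltr_wpDl// addr_ge0.
have s0 : 0 < Num.min 1 (e / 3 / M) by rewrite lt_min ltr01 divr_gt0.
have d0 : 0 < Num.min dA dB by rewrite lt_min dA0.
have [|s [y [/andP[s1 s2] yx yC]]] := H _ _ s0 _ d0; first by rewrite ge_min lexx.
have inb (r : R) : 0 < r -> Num.min dA dB <= r -> ball x r y.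
  move=> r0 dr; split=> // i j; rewrite ord1 /ball/= distrC.
  exact: lt_le_trans (yx j) dr.
have /= yA := dAP y (inb _ dA0 (ltac:(by rewrite ge_min lexx))).
have /= yB := dBP y (inb _ dB0 (ltac:(by rewrite ge_min lexx orbT))).
have sM : s * M <= e / 3.
  rewrite -ler_pdivlMr// (le_trans s2)// ge_min lexx orbT//.
have h1 : `|s * (B y - A y)| <= s * M.
  rewrite normrM (ger0_norm s1) ler_wpM2l// (le_trans (ler_normB _ _))//.
  have a1 : `|A y| <= `|A x| + e / 3.
    by rewrite -lerBlDl (le_trans (lerB_dist _ _))// distrC ltW.
  have b1 : `|B y| <= `|B x| + e / 3.
    by rewrite -lerBlDl (le_trans (lerB_dist _ _))// distrC ltW.
  by rewrite /M; lra.
rewrite (_ : A x = ((1 - s) * A y + s * B y) + ((A x - A y) - s * (B y - A y))); last by ring.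
rewrite (le_trans (ler_normD _ _))// lerD//.
by rewrite (le_trans (ler_normB _ _))//; lra.
Qed.

Variable nT : nat.
Hypothesis nT0 : (0 < nT)%N.
Local Notation tau := (tau T nT).
Local Notation tn := (tn T nT).

Lemma tau_gt0 : 0 < tau.
Proof. by rewrite /tau divr_gt0// ltr0n. Qed.

Lemma tn_ge0 n : 0 <= tn n.
Proof. by rewrite /tn mulr_ge0// ltW// tau_gt0. Qed.

Lemma tn_le n : (n <= nT)%N -> tn n <= T.
Proof.
move=> nnT; have nT1 : nT%:R != 0 :> R by rewrite pnatr_eq0 -lt0n.
rewrite [leRHS](_ : T = nT%:R * tau); last by rewrite /tau mulrC divfK.
by rewrite /tn ler_wpM2r ?ler_nat// ltW// tau_gt0.
Qed.

Lemma tnS n : tn n.+1 = tn n + tau.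
Proof. by rewrite /tn -natr1 mulrDl mul1r. Qed.

(** Points outside the null set exist arbitrarily close to [x] in space and to either end of the
    time interval; linearity in time and continuity in space carry the bound to the grid times. For
    the right end the two levels exchange roles in [limit_bound]. *)
Lemma piecewise_linear_bound N (g : R -> 'rV[R]_d -> R) C n : measurable N ->
  space_time N = 0%E -> (forall y t, ~ N (y, t) -> `|g t (rv y)| <= C) ->
  (n < nT)%N -> continuous (g (tn n)) -> continuous (g (tn n.+1)) ->
  (forall (s : R) x, 0 <= s <= 1 ->
    g (tn n + s * tau) x = (1 - s) * g (tn n) x + s * g (tn n.+1) x) ->
  forall x, pts x -> `|g (tn n) x| <= C /\ `|g (tn n.+1) x| <= C.
Proof.
move=> mN N0 NP nnT c0 c1 lin x xp.
have t0 := tau_gt0; have n0 := tn_ge0 n; have n1 := tn_le nnT.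
split.
  apply: (limit_bound c0 c1) => s0 e s00 s01 e0.
  have [||y [t [yx /andP[ta tb] /NP]]] :=
    @box_meets_conull N x e (tn n) (tn n + s0 * tau) mN N0 xp e0 n0.
  - by rewrite ltrDl mulr_gt0.
  - by rewrite (le_trans _ n1)// tnS lerD2l ler_piMl// ltW.
  pose s := (t - tn n) / tau.
  have tE : t = tn n + s * tau by rewrite /s divfK ?gt_eqF// addrC subrK.
  have s1 : 0 <= s by rewrite divr_ge0 ?subr_ge0// ltW.
  have s2 : s <= s0 by rewrite ler_pdivrMr// lerBlDl.
  rewrite tE lin ?s1 ?(le_trans s2)// => H.
  by exists s, (rv y); rewrite s1 s2.
apply: (limit_bound c1 c0) => s0 e s00 s01 e0.
have [|||y [t [yx /andP[ta tb] /NP]]] :=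
  @box_meets_conull N x e (tn n.+1 - s0 * tau) (tn n.+1) mN N0 xp e0.
- rewrite subr_ge0 tnS (@le_trans _ _ tau)//; first by rewrite ler_piMl// ltW.
  by rewrite lerDr.
- by rewrite gtrBl mulr_gt0.
- exact: n1.
pose s := (tn n.+1 - t) / tau.
have tE : t = tn n + (1 - s) * tau.
  by rewrite mulrBl mul1r /s divfK ?gt_eqF// addrA -tnS opprB addrC subrK.
have s1 : 0 <= s by rewrite divr_ge0 ?subr_ge0// ltW.
have s2 : s <= s0 by rewrite ler_pdivrMr// lerBlDl -lerBlDr.
rewrite tE lin; last by apply/andP; split; lra.
rewrite opprB addrCA subrr addr0 addrC => H.
by exists s, (rv y); rewrite s1 s2.
Qed.

End pointwise_bounds.

(** * Continuity, measurability and block structure of the mobility *)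

Section mobility.
Context (R : realType) (d : nat).
Implicit Types (M : model R d).

(** Joint continuity comes from the bound on the partial derivatives, which makes [f] Lipschitz on a
    small box around [z]. *)
Lemma partial_continuous n (f : 'rV[R]_n -> R) (U : set 'rV[R]_n) z : open U -> U z ->
  C1_bounded_on U f -> {for z, continuous f}.
Proof.
move=> oU Uz [B BP].
have [dl /= dl0 dP] := (nbhs_ballP _ _).1 (open_nbhs_nbhs (conj oU Uz)).
pose a := z - const_mx (dl / 2); pose b := z + const_mx (dl / 2).
have DU : box a b `<=` U.
  move=> y yb; apply: dP; split=> // i j; rewrite ord1.
  by have := yb j; rewrite /a /b /ball/= !mxE distrC ltr_distl => /andP[? ?]; lra.
have B0 : 0 <= `|B| := normr_ge0 B.
have lip y : box a b y -> `|f z - f y| <= `|B| * l1 (z - y).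
  move=> yb; apply: (@pder_lipschitz _ _ _ a b) => //.
    move=> w wb i; have [h1 _ h2] := BP w (DU w wb) i; split=> //.
    exact: le_trans h2 (ler_norm _).
  by move=> j; rewrite /a /b !mxE; lra.
move=> A /= /(nbhs_ballP _ _).1[e /= e0 eA]; apply: (nbhs_ballP _ _).2.
have c0 : 0 < e / (`|B| * n%:R + 1) by rewrite divr_gt0// ltr_wpDl// mulr_ge0.
exists (Num.min (dl / 2) (e / (`|B| * n%:R + 1))).
  by rewrite /= lt_min c0 divr_gt0.
move=> y [_ /= zy].
have zyj j : `|(z - y) 0 j| < Num.min (dl / 2) (e / (`|B| * n%:R + 1)).
  by rewrite !mxE; exact: (zy 0 j).
have yb : box a b y.
  move=> j; have := zyj j; rewrite lt_min => /andP[+ _].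
  by rewrite /a /b !mxE ltr_norml => /andP[? ?]; lra.
apply: eA; rewrite /ball/=; apply: (le_lt_trans (lip y yb)).
have l1c : l1 (z - y) <= n%:R * (e / (`|B| * n%:R + 1)).
  rewrite /l1 (@le_trans _ _ (\sum_(j < n) (e / (`|B| * n%:R + 1))))//.
    apply: ler_sum => j _; apply: ltW; apply: lt_le_trans (zyj j) _.
    by rewrite ge_min lexx orbT.
  by rewrite sumr_const card_ord mulr_natl.
apply: (le_lt_trans (ler_wpM2l B0 l1c)).
have n0 : 0 <= n%:R :> R by [].
have c1 : 0 < `|B| * n%:R + 1 by rewrite ltr_wpDl// mulr_ge0.
by rewrite !mulrA ltr_pdivrMr// mulrDr mulr1 mulrC ltrDl.
Qed.

Lemma mob_theta_continuous (z : 'rV[R]_(mob_dim d)) : {for z, continuous (@mob_theta R d)}.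
Proof.
rewrite (_ : @mob_theta R d = fun y => y 0 (rshift 1 (rshift d (lshift _ 0)))).
  exact: coord_continuous.
by apply/funext => y; rewrite /mob_theta !mxE.
Qed.

Lemma open_mob_theta (Theta : set R) : open Theta ->
  open [set z : 'rV[R]_(mob_dim d) | Theta (mob_theta z)].
Proof.
by move=> oT; apply: open_comp => // z _; exact: mob_theta_continuous.
Qed.

Lemma measurable_mob_arg dT (Y : measurableType dT) (A : set Y) (r t e : Y -> R)
    (gr ge : Y -> 'cV[R]_d) :
  measurable_fun A r -> measurable_fun A t -> measurable_fun A e ->
  (forall i, measurable_fun A (fun y => gr y i 0)) ->
  (forall i, measurable_fun A (fun y => ge y i 0)) ->
  forall i : 'I_(mob_dim d), measurable_fun A (fun y => mob_arg (r y) (gr y) (t y) (e y) (ge y) 0 i).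
Proof.
have rowS m n (f : Y -> 'rV[R]_m) (g : Y -> 'rV[R]_n) :
    (forall i, measurable_fun A (fun y => f y 0 i)) ->
    (forall i, measurable_fun A (fun y => g y 0 i)) ->
    forall i, measurable_fun A (fun y => row_mx (f y) (g y) 0 i).
  move=> mf mg i; rewrite -(splitK i); case: (fintype.split i) => j.
    by apply: eq_measurable_fun (mf j) => y _; rewrite row_mxEl.
  by apply: eq_measurable_fun (mg j) => y _; rewrite row_mxEr.
have C (f : Y -> R) : measurable_fun A f -> forall i : 'I_1, measurable_fun A (fun y => ((f y)%:M : 'rV_1) 0 i).
  by move=> mf i; apply: eq_measurable_fun mf => y _; rewrite (ord1 i) mxE eqxx mulr1n.
have D n (f : Y -> 'cV[R]_n) : (forall i, measurable_fun A (fun y => f y i 0)) ->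
    forall i, measurable_fun A (fun y => (f y)^T 0 i).
  by move=> mf i; apply: eq_measurable_fun (mf i) => y _; rewrite mxE.
move=> mr mt me mgr mge; rewrite /mob_arg.
apply: (@rowS _ _) => [|j]; first exact: C.
apply: (@rowS _ _) => [|{}j]; first exact: D.
apply: (@rowS _ _) => [|{}j]; first exact: C.
by apply: (@rowS _ _) => [|{}j]; [exact: C|exact: D].
Qed.

(** The blocks are the fluxes of the rho, energy and eta equations, the energy flux with a minus
    sign; this is why the energy equation is subtracted when the equations are tested together. *)
Lemma Lfull_mul M z (xi1 xi2 : 'cV[R]_d) (s : R) :
  Lfull M z *m col_mx xi1 (col_mx xi2 (s%:M : 'cV_1)) =
  col_mx (L11 M z *m xi1 - L12 M z *m xi2 + s *: L13 M z)
    (col_mx (- (L12 M z *m xi1 - L22 M z *m xi2 + s *: L23 M z))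
      ((dot (L13 M z) xi1 - dot (L23 M z) xi2 + L33 M z * s)%:M : 'cV_1)).
Proof.
rewrite /Lfull mul_block_col mul_row_col mul_col_mx mul_block_col !add_col_mx.
rewrite !mul_mx_scalar; congr (col_mx _ (col_mx _ _)); first by rewrite mulNmx addrA.
  rewrite mulNmx; move: (L12 M z *m xi1) (L22 M z *m xi2) (L23 M z) => A B C.
  by apply/matrixP => i j; rewrite !mxE; ring.
rewrite linearN /= mulNmx addrA scale_scalar_mx [s * _]mulrC.
by rewrite [_ ^T *m xi1]mx11_scalar [_ ^T *m xi2]mx11_scalar -raddfB -raddfD.
Qed.

Lemma dot_col_mx m n (u1 v1 : 'cV[R]_m) (u2 v2 : 'cV[R]_n) :
  dot (col_mx u1 u2) (col_mx v1 v2) = dot u1 v1 + dot u2 v2.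
Proof. by rewrite /dot tr_col_mx mul_row_col mxE. Qed.

Lemma dot_scalar (s t : R) : dot (s%:M : 'cV_1) t%:M = s * t.
Proof. by rewrite dotE big_ord1 !mxE eqxx !mulr1n. Qed.

Lemma dot_mulmx_le n (A : 'M[R]_n) (xi : 'cV[R]_n) (B : R) : (forall i j, `|A i j| <= B) ->
  dot (A *m xi) (A *m xi) <= (n%:R * B) ^+ 2 * dot xi xi.
Proof.
move=> AB; have xi0 : 0 <= dot xi xi := dot_ge0 xi.
have W i : (A *m xi) i 0 * (A *m xi) i 0 <= n%:R * B ^+ 2 * dot xi xi.
  (* This double sum is twice the gap in the Cauchy-Schwarz inequality for row [i]. *)
  have e0 : 0 <= \sum_j \sum_k (A i j * xi j 0 - A i k * xi k 0) ^+ 2.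
    by apply: sumr_ge0 => j _; apply: sumr_ge0 => k _; exact: sqr_ge0.
  have := e0.
  rewrite (_ : \sum_j _ = 2 * (n%:R * (\sum_j (A i j * xi j 0) ^+ 2) - (A *m xi) i 0 ^+ 2)); last first.
    rewrite mxE.
    transitivity (\sum_j (n%:R * (A i j * xi j 0) ^+ 2 + \sum_k (A i k * xi k 0) ^+ 2
       - 2 * (A i j * xi j 0) * \sum_k (A i k * xi k 0))).
      apply: eq_bigr => j _; rewrite mulr_sumr -sumrN /=.
      rewrite -[in n%:R](card_ord n) mulr_natl -sumr_const -!big_split /=.
      by apply: eq_bigr => k _; ring.
    rewrite big_split /= big_split /= sumr_const card_ord sumrN -mulr_suml -!mulr_sumr -mulr_natl.
    by ring.
  move=> h; rewrite -expr2 (@le_trans _ _ (n%:R * (\sum_j (A i j * xi j 0) ^+ 2)))//.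
    by lra.
  rewrite -mulrA ler_wpM2l// dotE mulr_sumr; apply: ler_sum => j _.
  rewrite exprMn -expr2 ler_wpM2r ?sqr_ge0// -[A i j ^+ 2]real_normK ?num_real//.
  by rewrite ler_sqr ?nnegrE ?AB// (le_trans _ (AB i j)).
rewrite dotE (le_trans (ler_sum _ (fun i _ => W i)))// sumr_const card_ord -[leLHS]mulr_natl.
by rewrite [leLHS](_ : _ = (n%:R * B) ^+ 2 * dot xi xi)//; ring.
Qed.

End mobility.

Section mobility_nice.
Context (R : realType) (d : nat) (l : R) (Th : seq (simplex R d)).
Hypothesis Th_ok : triangulation l Th.
Local Notation nice := (nice l Th).

Lemma Lfull_nice M Theta (r t e : 'rV[R]_d -> R) i j : mobility_ok M Theta -> open Theta ->
  (forall x, Theta (t x)) -> Vh l Th r -> Vh l Th t -> Vh l Th e ->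
  nice (fun x => Lfull M (mob_arg (r x) (grad r x) (t x) (e x) (grad e x)) i j).
Proof.
move=> Mo oT tT hr ht he.
have thE x : mob_theta (mob_arg (r x) (grad r x) (t x) (e x) (grad e x)) = t x.
  by rewrite /mob_theta /mob_arg !row_mxKr row_mxKl mxE eqxx mulr1n.
have [B BP] := mob_bounded Mo.
have [[mr _] [mt _] [me _]] := And3 (Vh_nice hr) (Vh_nice ht) (Vh_nice he).
split; last by exists B => y _; apply: BP; rewrite thE; exact: tT.
apply: (@measurable_comp_open _ _ R (mob_dim d) (gset l Th)
  (fun y => mob_arg (r (rv y)) (grad r (rv y)) (t (rv y)) (e (rv y)) (grad e (rv y)))
  (fun z => Lfull M z i j) [set z | Theta (mob_theta z)]).
- exact: measurable_gset.
- apply: measurable_mob_arg => // k.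
    by have [] := niceV_grad Th_ok hr k.
  by have [] := niceV_grad Th_ok he k.
- exact: open_mob_theta.
- by move=> y _ /=; rewrite thE.
- move=> x Tx; apply: partial_continuous Tx _; first exact: open_mob_theta.
  exact: mob_C1.
Qed.

End mobility_nice.

(** * Coercivity of the regularised relative entropy *)

Section relative_entropy.
Context (R : realType) (d : nat) (M : model R d) (Th : seq (simplex R d)).
Context (alpha B k : R) (a b : 'rV[R]_3).
Local Notation l := (edge M).
Local Notation nice := (nice l Th).
Local Notation gpts := (gpts l Th).
Hypotheses (Th_ok : triangulation l Th) (d0 : (0 < d)%N).
Hypotheses (pok : potential_ok M alpha) (pf : potential_facts M alpha a b B k).
Hypothesis a0 : 0 < a 0 itheta.

Local Opaque pder st.

Lemma nice_derivs f s (r t e : 'rV[R]_d -> R) : smooth_on (@pos_theta R) f ->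
  derivs_bounded (box a b) f B -> (size s <= 3)%N ->
  measurable_fun (gset l Th) (r \o @rv R d) -> measurable_fun (gset l Th) (t \o @rv R d) ->
  measurable_fun (gset l Th) (e \o @rv R d) ->
  (forall x, gpts x -> box a b (st (r x) (t x) (e x))) ->
  nice (fun x => foldr (@pder R 3) f s (st (r x) (t x) (e x))).
Proof.
move=> fS fB s3 mr mt me bx; split; last first.
  by exists B => y /gsetP /bx yb; have [] := fB s _ yb s3.
apply: (@measurable_comp_open _ _ R 3 (gset l Th)
  (fun y => st (r (rv y)) (t (rv y)) (e (rv y))) (foldr (@pder R 3) f s) (@pos_theta R)).
- exact: measurable_gset.
- by apply: forall3; [apply: eq_measurable_fun mr|apply: eq_measurable_fun mt|
    apply: eq_measurable_fun me] => y _; rewrite stE.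
- exact: open_pos_theta.
- move=> y /gsetP /bx /(_ itheta) /andP[+ _]; rewrite /pos_theta/= => h.
  exact: lt_le_trans a0 h.
- by move=> x Ux; have [] := fS s x Ux.
Qed.

Variables (u v : fields R d).

(** The quantity driving the Gronwall argument; unlike the relative entropy it contains no
    gradients. *)
Definition sq_dist (t : R) : R :=
  ip l (fun x => frho u t x - frho v t x) (fun x => frho u t x - frho v t x)
  + ip l (fun x => ftheta u t x - ftheta v t x) (fun x => ftheta u t x - ftheta v t x)
  + ip l (fun x => feta u t x - feta v t x) (fun x => feta u t x - feta v t x).

Definition pot_fields (t : R) (x : 'rV[R]_d) : R :=
  pot (psi M) (frho u t x) (ftheta u t x) (feta u t x)
    (frho v t x) (ftheta v t x) (feta v t x).

Record admissible (t : R) : Prop := Admissible {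
  adm_ur : Vh l Th (frho u t); adm_ut : Vh l Th (ftheta u t); adm_ue : Vh l Th (feta u t);
  adm_vr : Vh l Th (frho v t); adm_vt : Vh l Th (ftheta v t); adm_ve : Vh l Th (feta v t);
  adm_u : forall x, gpts x -> box a b (state u t x);
  adm_v : forall x, gpts x -> box a b (state v t x) }.

Lemma nice_state_u f s t : smooth_on (@pos_theta R) f ->
  derivs_bounded (box a b) f B -> (size s <= 3)%N -> admissible t ->
  nice (fun x => foldr (@pder R 3) f s (state u t x)).
Proof.
move=> fS fB s3 [/Vh_nice[? _] /Vh_nice[? _] /Vh_nice[? _] _ _ _ h _].
exact: nice_derivs.
Qed.

Lemma nice_state_v f s t : smooth_on (@pos_theta R) f ->
  derivs_bounded (box a b) f B -> (size s <= 3)%N -> admissible t ->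
  nice (fun x => foldr (@pder R 3) f s (state v t x)).
Proof.
move=> fS fB s3 [_ _ _ /Vh_nice[? _] /Vh_nice[? _] /Vh_nice[? _] _ h].
exact: nice_derivs.
Qed.

Section fixed_time.
Variable t : R.
Hypothesis adm : admissible t.

Lemma VhBr : Vh l Th (fun x => frho u t x - frho v t x).
Proof. by apply: VhB; [exact: adm_ur|exact: adm_vr]. Qed.
Lemma VhBt : Vh l Th (fun x => ftheta u t x - ftheta v t x).
Proof. by apply: VhB; [exact: adm_ut|exact: adm_vt]. Qed.
Lemma VhBe : Vh l Th (fun x => feta u t x - feta v t x).
Proof. by apply: VhB; [exact: adm_ue|exact: adm_ve]. Qed.

Lemma nice_pot_fields : nice (pot_fields t).
Proof.
have pu s := @nice_state_u (psi M) s t (psi_smooth pok) (pf_psi pf).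
have pv s := @nice_state_v (psi M) s t (psi_smooth pok) (pf_psi pf).
rewrite /pot_fields /pot; do ![apply: niceB].
- exact: (pu [::]).
- exact: (pv [::]).
- by apply: niceM; [exact: (pu [:: itheta])|exact: (Vh_nice VhBt)].
- by apply: niceM; [exact: (pv [:: irho])|exact: (Vh_nice VhBr)].
- by apply: niceM; [exact: (pv [:: ieta])|exact: (Vh_nice VhBe)].
Qed.

Lemma rel_entropy_regE (lambda : R) : rel_entropy_reg M lambda u v t =
  gamma_rho M / 2 * ipv l (grad (fun x => frho u t x - frho v t x))
    (grad (fun x => frho u t x - frho v t x))
  + gamma_eta M / 2 * ipv l (grad (fun x => feta u t x - feta v t x))
    (grad (fun x => feta u t x - feta v t x))
  + tint l (pot_fields t)
  + lambda / 2 * (ip l (fun x => frho u t x - frho v t x) (fun x => frho u t x - frho v t x)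
    + ip l (fun x => feta u t x - feta v t x) (fun x => feta u t x - feta v t x)).
Proof.
rewrite /rel_entropy_reg !(norm0_sqr Th_ok d0) /rel_entropy /ipv; congr (_ + _).
have nr := nice_dot (niceV_grad Th_ok VhBr) (niceV_grad Th_ok VhBr).
have ne := nice_dot (niceV_grad Th_ok VhBe) (niceV_grad Th_ok VhBe).
rewrite -(tintZ Th_ok d0 _ nr) -(tintZ Th_ok d0 _ ne).
rewrite -(tintD Th_ok d0); [|exact: niceZ|exact: niceZ].
rewrite -(tintD Th_ok d0); [|by apply: niceD; exact: niceZ|exact: nice_pot_fields].
apply: (tint_ext Th_ok d0) => x _; rewrite /pot_fields /pot /state.
by rewrite !addrA.
Qed.

(** Integrate [pf_coercive]. The lower bound on [lambda] outweighs the term in [alpha] and leaves at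
    least half of the squared norms of the rho and eta differences; the gradient terms are
    dropped. *)
Lemma rel_entropy_ge (lambda : R) : `|alpha| + 1 <= lambda -> 0 < gamma_rho M ->
  0 < gamma_eta M -> Num.min k 2^-1 * sq_dist t <= rel_entropy_reg M lambda u v t.
Proof.
move=> hl gr ge; rewrite rel_entropy_regE /sq_dist.
have nr := Vh_nice VhBr; have nt := Vh_nice VhBt; have ne := Vh_nice VhBe.
have pr := ip_ge0 Th_ok d0 (fun x => frho u t x - frho v t x).
have pt := ip_ge0 Th_ok d0 (fun x => ftheta u t x - ftheta v t x).
have pe := ip_ge0 Th_ok d0 (fun x => feta u t x - feta v t x).
have gr0 := ipv_ge0 Th_ok d0 (grad (fun x => frho u t x - frho v t x)).
have ge0 := ipv_ge0 Th_ok d0 (grad (fun x => feta u t x - feta v t x)).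
have P : k * ip l (fun x => ftheta u t x - ftheta v t x) (fun x => ftheta u t x - ftheta v t x)
   - alpha / 2 * (ip l (fun x => frho u t x - frho v t x) (fun x => frho u t x - frho v t x)
    + ip l (fun x => feta u t x - feta v t x) (fun x => feta u t x - feta v t x))
   <= tint l (pot_fields t).
  rewrite /ip.
  have nrr := niceM nr nr; have ntt := niceM nt nt; have nee := niceM ne ne.
  rewrite -(tintD Th_ok d0 nrr nee) -(tintZ Th_ok d0 _ ntt).
  rewrite -(tintZ Th_ok d0 _ (niceD nrr nee)).
  have n1 := niceZ k ntt; have n2 := niceZ (alpha / 2) (niceD nrr nee).
  rewrite -(tintB Th_ok d0 n1 n2); apply: (tint_le Th_ok d0) => [||x xG].
  - exact: niceB.
  - exact: nice_pot_fields.
  - by rewrite -!expr2; exact: (pf_coercive pf (adm_u adm xG) (adm_v adm xG)).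
move: (ip l _ _) (ip l (fun x => ftheta u t x - _) _) (ip l (fun x => feta u t x - _) _) (tint _ _)
  (ipv _ _ _) (ipv l (grad (fun x => feta u t x - _)) _) pr pt pe gr0 ge0 P.
move=> X Y Z W G G' X0 Y0 Z0 G0 G'0 P.
have m1 : Num.min k 2^-1 <= k by rewrite ge_min lexx.
have m2 : Num.min k 2^-1 <= 2^-1 by rewrite ge_min lexx orbT.
have al : alpha <= `|alpha| := ler_norm _.
have h1 : Num.min k 2^-1 * Y <= k * Y by rewrite ler_wpM2r.
have h2 : Num.min k 2^-1 * (X + Z) <= 2^-1 * (X + Z) by rewrite ler_wpM2r// addr_ge0.
have h3 : 2^-1 * (X + Z) <= (lambda - alpha) / 2 * (X + Z).
  by rewrite ler_wpM2r ?addr_ge0//; lra.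
have h4 : 0 <= gamma_rho M / 2 * G by rewrite mulr_ge0// divr_ge0// ltW.
have h5 : 0 <= gamma_eta M / 2 * G' by rewrite mulr_ge0// divr_ge0// ltW.
by lra.
Qed.

End fixed_time.
End relative_entropy.

Section differences.
Context (R : realType) (d : nat) (M : model R d) (u v : fields R d) (T : R) (nT n : nat).
Local Notation tn := (tn T nT).

Definition diff_rho (t : R) x := frho u t x - frho v t x.
Definition diff_theta (t : R) x := ftheta u t x - ftheta v t x.
Definition diff_eta (t : R) x := feta u t x - feta v t x.
Definition incr_rho x := diff_rho (tn n.+1) x - diff_rho (tn n) x.
Definition incr_theta x := diff_theta (tn n.+1) x - diff_theta (tn n) x.
Definition incr_eta x := diff_eta (tn n.+1) x - diff_eta (tn n) x.
Definition incr_energy x := dn T nT (energy M u) n x - dn T nT (energy M v) n x.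
Definition diff_split i x := split_der T nT M i u n x - split_der T nT M i v n x.

End differences.

Definition volume (R : realType) (d : nat) (l : R) : R := tint l (fun _ : 'rV[R]_d => 1).

(** * Entropy balance of one time step *)

Section entropy_step.
Context (R : realType) (d : nat) (M : model R d) (Th : seq (simplex R d)).
Context (alpha B k : R) (a b : 'rV[R]_3).
Local Notation l := (edge M).
Local Notation nice := (nice l Th).
Local Notation gpts := (gpts l Th).
Hypotheses (Th_ok : triangulation l Th) (d0 : (0 < d)%N).
Hypotheses (pok : potential_ok M alpha) (pf : potential_facts M alpha a b B k).
Hypothesis a0 : 0 < a 0 itheta.
Context (T : R) (nT n : nat) (u v : fields R d) (p : taylor_points R d).
Local Notation tn := (tn T nT).
Local Notation dn := (dn T nT).
Local Notation t0 := (tn n).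
Local Notation t1 := (tn n.+1).
Local Notation adm := (admissible M Th a b u v).
Hypotheses (adm0 : adm t0) (adm1 : adm t1).
Hypothesis int : intermediate T nT M u p n.

Local Opaque pder st.

Local Notation dr := (diff_rho u v).
Local Notation dt := (diff_theta u v).
Local Notation de := (diff_eta u v).

Let nr0 : nice (dr t0) := Vh_nice (VhBr adm0).
Let nr1 : nice (dr t1) := Vh_nice (VhBr adm1).
Let nt0 : nice (dt t0) := Vh_nice (VhBt adm0).
Let nt1 : nice (dt t1) := Vh_nice (VhBt adm1).
Let ne0 : nice (de t0) := Vh_nice (VhBe adm0).
Let ne1 : nice (de t1) := Vh_nice (VhBe adm1).

Lemma box_between r0 r1 t0' t1' e0 e1 r t e : box a b (st r0 t0' e0) -> box a b (st r1 t1' e1) ->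
  between r0 r1 r -> between t0' t1' t -> between e0 e1 e -> box a b (st r t e).
Proof.
move=> h0 h1 br bt be; apply: (between_box h0 h1).
by apply: forall3; rewrite !stE.
Qed.

Lemma taylor_points_box x : gpts x ->
  [/\ box a b (st (frho u t0 x) (xi1 p n x) (feta u t0 x)),
      box a b (st (chi3 p n x) (ftheta u t1 x) (chi4 p n x)) &
      box a b (st (chi1 p n x) (ftheta u t1 x) (chi2 p n x))].
Proof.
move=> xG; have [_ /(_ x)/=[[/on_segment_between s1 _] [/on_segment_wvec[s2 s3] _]
  [/on_segment_wvec[s4 s5] _]]] := int.
have h0 := adm_u adm0 xG; have h1 := adm_u adm1 xG.
have [rl rr] := between_refl (frho u t0 x) (frho u t1 x).
have [tl tr] := between_refl (ftheta u t0 x) (ftheta u t1 x).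
have [el er] := between_refl (feta u t0 x) (feta u t1 x).
by split; apply: (box_between h0 h1).
Qed.

(** Polarisation for an implicit increment; the squared increment it produces is the quadratic part
    of the numerical dissipation. *)
Lemma ip_polar w0 w1 : nice w0 -> nice w1 ->
  ip l w1 w1 - ip l w0 w0 + ip l (fun x => w1 x - w0 x) (fun x => w1 x - w0 x)
  = 2 * ip l w1 (fun x => w1 x - w0 x).
Proof.
move=> n0 n1; have nd := niceB n1 n0.
by rewrite !(ipBr Th_ok d0)// !(ipBl Th_ok d0)// (ipC Th_ok d0 w0 w1); ring.
Qed.

Lemma ipv_polar w0 w1 : Vh l Th w0 -> Vh l Th w1 ->
  ipv l (grad w1) (grad w1) - ipv l (grad w0) (grad w0)
  + ipv l (grad (fun x => w1 x - w0 x)) (grad (fun x => w1 x - w0 x))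
  = 2 * ipv l (grad w1) (grad (fun x => w1 x - w0 x)).
Proof.
move=> h0 h1; have nd := niceV_grad Th_ok (VhB h1 h0).
have n0 := niceV_grad Th_ok h0; have n1 := niceV_grad Th_ok h1.
have n00 := nice_dot n0 n0; have n11 := nice_dot n1 n1; have ndd := nice_dot nd nd.
rewrite /ipv -(tintB Th_ok d0 n11 n00) -(tintD Th_ok d0 (niceB n11 n00) ndd).
rewrite -(tintZ Th_ok d0 _ (nice_dot n1 nd)); apply: (tint_ext Th_ok d0) => x [_ xS].
rewrite (Vh_gradB Th_ok h1 h0 xS) !dotE mulr_sumr -sumrB -big_split; apply: eq_bigr => i _ /=.
by rewrite !mxE; move: (pder _ _ _) (pder _ _ _) => p1 p2; ring.
Qed.

Local Notation ddr := (incr_rho u v T nT n).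
Local Notation ddt := (incr_theta u v T nT n).
Local Notation dde := (incr_eta u v T nT n).

Let H x := hessw (psi_vex M) (st (chi3 p n x) (ftheta u t1 x) (chi4 p n x))
  - hessw (psi_cav M) (st (chi1 p n x) (ftheta u t1 x) (chi2 p n x)).

Let nice_wvec f g : nice f -> nice g -> niceV l Th (fun x => wvec (f x) (g x)).
Proof.
move=> nf ng; case=> [[|[|//]] i].
  by apply: nice_ext nf => x _; rewrite mxE.
by apply: nice_ext ng => x _; rewrite mxE.
Qed.

Let measurable_gset_rv (f : 'rV[R]_d -> R) : measurable_fun setT (f \o @rv R d) ->
  measurable_fun (gset l Th) (f \o @rv R d).
Proof. by move=> mf; apply: (measurable_funS measurableT) mf. Qed.

Lemma nice_hess : nice (fun x => dot (H x *m wvec (ddr x) (dde x)) (wvec (ddr x) (dde x))).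
Proof.
have nw : niceV l Th (fun x => wvec (ddr x) (dde x)).
  by apply: nice_wvec; exact: niceB.
have [[m1 m2 m3 m4 m5] _] := int; have [mt _] := Vh_nice (adm_ut adm1).
apply: (nice_dot _ nw); apply: (niceVM _ nw) => i j.
have nv : nice (fun x => foldr (@pder R 3) (psi_vex M) [:: iw i; iw j]
    (st (chi3 p n x) (ftheta u t1 x) (chi4 p n x))).
  apply: (nice_derivs a0 (psi_vex_smooth pok) (pf_vex pf)) => //.
  - exact: measurable_gset_rv.
  - exact: measurable_gset_rv.
  - by move=> x /taylor_points_box[].
have nc : nice (fun x => foldr (@pder R 3) (psi_cav M) [:: iw i; iw j]
    (st (chi1 p n x) (ftheta u t1 x) (chi2 p n x))).
  apply: (nice_derivs a0 (psi_cav_smooth pok) (pf_cav pf)) => //.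
  - exact: measurable_gset_rv.
  - exact: measurable_gset_rv.
  - by move=> x /taylor_points_box[].
by apply: nice_ext (niceB nv nc) => x _; rewrite !mxE.
Qed.

Lemma nice_psi_tt : nice (fun x => pder itheta (pder itheta (psi M))
  (st (frho u t0 x) (xi1 p n x) (feta u t0 x))).
Proof.
have [[m1 _ _ _ _] _] := int.
have [mr _] := Vh_nice (adm_ur adm0); have [me _] := Vh_nice (adm_ue adm0).
apply: (@nice_derivs _ _ _ _ B a b a0 (psi M) [:: itheta; itheta]) => //.
- exact: psi_smooth pok.
- exact: pf_psi pf.
- exact: measurable_gset_rv.
- by move=> x /taylor_points_box[].
Qed.

Local Notation dE := (incr_energy M u v T nT n).
Local Notation dS := (diff_split M u v T nT n).

Lemma nice_denergy : nice dE.
Proof.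
have pu t := @nice_state_u _ _ M Th _ _ _ a0 u v (psi M) [:: itheta] t (psi_smooth pok) (pf_psi pf) isT.
have pv t := @nice_state_v _ _ M Th _ _ _ a0 u v (psi M) [:: itheta] t (psi_smooth pok) (pf_psi pf) isT.
have := niceB (niceB (pu _ adm1) (pu _ adm0)) (niceB (pv _ adm1) (pv _ adm0)).
exact.
Qed.

Lemma state_mixed_box x : gpts x ->
  box a b (st (frho u t0 x) (ftheta u t1 x) (feta u t0 x)) /\
  box a b (st (frho v t0 x) (ftheta v t1 x) (feta v t0 x)).
Proof.
move=> xG; have hu0 := adm_u adm0 xG; have hu1 := adm_u adm1 xG.
have hv0 := adm_v adm0 xG; have hv1 := adm_v adm1 xG.
by split; apply: forall3; rewrite !stE; [have := hu0 irho|have := hu1 itheta|have := hu0 ieta|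
  have := hv0 irho|have := hv1 itheta|have := hv0 ieta]; rewrite /state !stE.
Qed.

Lemma nice_split_u i : nice (split_der T nT M i u n).
Proof.
have vu := nice_state_u (s := [:: i]) a0 (psi_vex_smooth pok) (pf_vex pf) isT adm1.
have [ur _] := Vh_nice (adm_ur adm0); have [ut _] := Vh_nice (adm_ut adm1).
have [ue _] := Vh_nice (adm_ue adm0).
have cu := @nice_derivs _ _ M Th B a b a0 (psi_cav M) [:: i] _ _ _ (psi_cav_smooth pok)
  (pf_cav pf) isT ur ut ue (fun x xG => proj1 (state_mixed_box xG)).
by apply: niceD.
Qed.

Lemma nice_split_v i : nice (split_der T nT M i v n).
Proof.
have vv := nice_state_v (s := [:: i]) a0 (psi_vex_smooth pok) (pf_vex pf) isT adm1.
have [vr _] := Vh_nice (adm_vr adm0); have [vt _] := Vh_nice (adm_vt adm1).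
have [ve _] := Vh_nice (adm_ve adm0).
have cv := @nice_derivs _ _ M Th B a b a0 (psi_cav M) [:: i] _ _ _ (psi_cav_smooth pok)
  (pf_cav pf) isT vr vt ve (fun x xG => proj2 (state_mixed_box xG)).
by apply: niceD.
Qed.

Lemma nice_dsplit i : nice (dS i).
Proof. by apply: niceB; [exact: nice_split_u|exact: nice_split_v]. Qed.

Let psi_tt x := pder itheta (pder itheta (psi M))
  (st (frho u t0 x) (xi1 p n x) (feta u t0 x)).
Let sq t x := dr t x * dr t x + dt t x * dt t x + de t x * de t x.

Let l1_sq (r t e : R) : l1 (st r t e) ^+ 2 <= 3 * (r * r + t * t + e * e).
Proof.
rewrite l1_st -!expr2 -(real_normK (num_real r)) -(real_normK (num_real t)).
rewrite -(real_normK (num_real e)); move: `|r| `|t| `|e| => A A' A''.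
rewrite -subr_ge0 (_ : _ - _ = (A - A') ^+ 2 + (A' - A'') ^+ 2 + (A - A'') ^+ 2); last by ring.
by rewrite !addr_ge0 ?sqr_ge0.
Qed.

(** Splits the third order remainder: after integration and with [m] of order [tau], the first term
    feeds the Gronwall argument and the second is a local error of order [tau ^+ 3]. *)
Let cubic_le (s0 s1 s m Q0 Q1 : R) : 0 <= s -> s <= m -> s0 ^+ 2 <= 3 * Q0 -> s1 ^+ 2 <= 3 * Q1 ->
  (s0 + s1 + m) * (s0 + s1 + m) * s <= 9 * m * (Q0 + Q1) + 3 * m ^+ 3.
Proof.
move=> s0p sm h0 h1; have m0 : 0 <= m by lra.
have q : (s0 + s1 + m) * (s0 + s1 + m) <= 9 * (Q0 + Q1) + 3 * m ^+ 2.
  have e1 := sqr_ge0 (s0 - s1); have e2 := sqr_ge0 (s0 - m); have e3 := sqr_ge0 (s1 - m).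
  by move: e1 e2 e3 h0 h1; rewrite !sqrrB !expr2; lra.
have q0 : 0 <= (s0 + s1 + m) * (s0 + s1 + m) by rewrite -expr2 sqr_ge0.
apply: (le_trans (ler_wpM2l q0 sm)); apply: (le_trans (ler_wpM2r m0 q)).
by rewrite le_eqVlt; apply/orP; left; apply/eqP; ring.
Qed.

Lemma pot_step_fields (m : R) x : gpts x ->
  `|dn (frho v) n x| + `|dn (ftheta v) n x| + `|dn (feta v) n x| <= m ->
  pot_fields M u v t1 x - pot_fields M u v t0 x - 2^-1 * (psi_tt x * ddt x * ddt x)
  + 2^-1 * dot (H x *m wvec (ddr x) (dde x)) (wvec (ddr x) (dde x))
  <= - (dE x * dt t1 x) + dS irho x * ddr x + dS ieta x * dde x
     + 91 * B * (9 * m * (sq t0 x + sq t1 x) + 3 * m ^+ 3).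
Proof.
move=> xG vm; have [_ /(_ x)/=[[/on_segment_between s1 T1] [/on_segment_wvec[s2 s3] T2]
  [/on_segment_wvec[s4 s5] T3]]] := int.
have Bp := pf_B pf.
have vE : l1 (st (frho v t1 x) (ftheta v t1 x) (feta v t1 x) -
    st (frho v t0 x) (ftheta v t0 x) (feta v t0 x)) <= m.
  by rewrite st_diff l1_st.
have := @pot_step R a b B (psi M) (psi_vex M) (psi_cav M) (pf_psi pf) (pf_vex pf) (pf_cav pf)
  (ltW Bp) (pf_psi_sym pf) (pf_vex_sym pf) (pf_cav_sym pf) (pf_split0 pf) (pf_split1 pf)
  (pf_split2 pf) _ _ _ _ _ _ _ _ _ _ _ _ _ _ _ _ _ _ (adm_u adm0 xG) (adm_u adm1 xG)
  (adm_v adm0 xG) (adm_v adm1 xG) s1 s2 s3 s4 s5 T1 T2 T3 (lerD (lexx _) vE).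
move=> h; rewrite -[psi_tt x * _ * _]mulrA -[ddt x * _]expr2 -[- (dE x * _)]mulNr -[91 * B * _]mulrA.
apply: (le_trans h); apply: lerD; first exact: lexx.
apply: ler_wpM2l => //; rewrite -[leLHS]mulrA -[leLHS]mulrA.
apply: ler_wpM2l; first exact: ltW.
rewrite [leLHS]mulrA.
by apply: cubic_le => //; [exact: l1_ge0|rewrite st_diff; exact: l1_sq..].
Qed.

Let sqE t : adm t -> tint l (sq t) = sq_dist M u v t /\ nice (sq t).
Proof.
move=> h; have nr := Vh_nice (VhBr h); have nt := Vh_nice (VhBt h).
have ne := Vh_nice (VhBe h).
have nrr := niceM nr nr; have ntt := niceM nt nt; have nee := niceM ne ne.
split; last exact: niceD (niceD nrr ntt) nee.
by rewrite /sq_dist /ip -(tintD Th_ok d0 nrr ntt) -(tintD Th_ok d0 (niceD nrr ntt) nee).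
Qed.

Lemma pot_step_integral (m : R) : (forall x, gpts x ->
    `|dn (frho v) n x| + `|dn (ftheta v) n x| + `|dn (feta v) n x| <= m) ->
  tint l (pot_fields M u v t1) - tint l (pot_fields M u v t0)
  - 2^-1 * ip l (fun x => psi_tt x * ddt x) ddt
  + 2^-1 * tint l (fun x => dot (H x *m wvec (ddr x) (dde x)) (wvec (ddr x) (dde x)))
  <= - ip l dE (dt t1) + ip l (dS irho) ddr + ip l (dS ieta) dde
     + 91 * B * (9 * m * (sq_dist M u v t0 + sq_dist M u v t1)
                 + 3 * m ^+ 3 * volume d l).
Proof.
move=> hm; have [<- ns0] := sqE adm0; have [<- ns1] := sqE adm1.
have np1 := nice_pot_fields pok pf a0 adm1; have np0 := nice_pot_fields pok pf a0 adm0.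
have ntd : nice ddt := niceB nt1 nt0.
have nrd : nice ddr := niceB nr1 nr0.
have ned : nice dde := niceB ne1 ne0.
have nt : nice (fun x => psi_tt x * ddt x * ddt x) := niceM (niceM nice_psi_tt ntd) ntd.
have nE := niceM nice_denergy nt1.
have nSr := niceM (nice_dsplit irho) nrd; have nSe := niceM (nice_dsplit ieta) ned.
have n1 : nice (fun _ : 'rV[R]_d => 1) := nice_cst l Th 1.
have nH := nice_hess.
have nL := niceD (niceB (niceB np1 np0) (niceZ 2^-1 nt)) (niceZ 2^-1 nH).
have nC := niceZ (91 * B) (niceD (niceZ (9 * m) (niceD ns0 ns1)) (niceZ (3 * m ^+ 3) n1)).
have nR := niceD (niceD (niceD (niceN nE) nSr) nSe) nC.
have := tint_le Th_ok d0 nL nR _.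
rewrite (tintD Th_ok d0 (niceB (niceB np1 np0) (niceZ _ nt)) (niceZ _ nH)).
rewrite (tintB Th_ok d0 (niceB np1 np0) (niceZ _ nt)) (tintB Th_ok d0 np1 np0).
rewrite !(tintZ Th_ok d0 _ nt, tintZ Th_ok d0 _ nH).
rewrite (tintD Th_ok d0 (niceD (niceD (niceN nE) nSr) nSe) nC).
rewrite (tintD Th_ok d0 (niceD (niceN nE) nSr) nSe) (tintD Th_ok d0 (niceN nE) nSr).
rewrite (tintN Th_ok d0 nE) (tintZ Th_ok d0 _ (niceD (niceZ (9 * m) (niceD ns0 ns1)) (niceZ (3 * m ^+ 3) n1))).
rewrite (tintD Th_ok d0 (niceZ (9 * m) (niceD ns0 ns1)) (niceZ (3 * m ^+ 3) n1)).
rewrite (tintZ Th_ok d0 _ (niceD ns0 ns1)) (tintZ Th_ok d0 _ n1) (tintD Th_ok d0 ns0 ns1).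
apply => x xG; rewrite mulr1; exact: pot_step_fields (hm x xG).
Qed.

Let collect (g g' c G1 G0 Gd Gm G1' G0' Gd' Gm' r1 r0 rd rm e1 e0 ed em P1 P0 I J E Sr Se C
    Nr Ne mr me : R) :
  G1 - G0 + Gd = 2 * Gm -> G1' - G0' + Gd' = 2 * Gm' ->
  r1 - r0 + rd = 2 * rm -> e1 - e0 + ed = 2 * em ->
  Nr ^+ 2 = Gd -> Ne ^+ 2 = Gd' -> mr ^+ 2 = rd -> me ^+ 2 = ed ->
  P1 - P0 - 2^-1 * I + 2^-1 * J <= - E + Sr + Se + C ->
  (g / 2 * G1 + g' / 2 * G1' + P1 + c / 2 * (r1 + e1))
  - (g / 2 * G0 + g' / 2 * G0' + P0 + c / 2 * (r0 + e0))
  + (g / 2 * Nr ^+ 2 + g' / 2 * Ne ^+ 2 - 2^-1 * I + 2^-1 * J + c / 2 * mr ^+ 2 + c / 2 * me ^+ 2)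
  <= g * Gm + g' * Gm' + c * rm + c * em - E + Sr + Se + C.
Proof.
move=> hG hG' hr he -> -> -> -> P.
have : g / 2 * (G1 - G0 + Gd) = g / 2 * (2 * Gm) by rewrite hG.
have : g' / 2 * (G1' - G0' + Gd') = g' / 2 * (2 * Gm') by rewrite hG'.
have : c / 2 * (r1 - r0 + rd) = c / 2 * (2 * rm) by rewrite hr.
have : c / 2 * (e1 - e0 + ed) = c / 2 * (2 * em) by rewrite he.
by lra.
Qed.

(** The polarised gradient and [lambda] terms are added to the integrated pointwise inequality;
    together they contain every term of the numerical dissipation exactly once. *)
Lemma entropy_step (lambda m : R) : (forall x, gpts x ->
    `|dn (frho v) n x| + `|dn (ftheta v) n x| + `|dn (feta v) n x| <= m) ->
  rel_entropy_reg M lambda u v t1 - rel_entropy_reg M lambda u v t0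
  + num_dissipation T nT M lambda u v p n <=
  gamma_rho M * ipv l (grad (dr t1)) (grad ddr) + gamma_eta M * ipv l (grad (de t1)) (grad dde)
  + lambda * ip l (dr t1) ddr + lambda * ip l (de t1) dde
  - ip l dE (dt t1) + ip l (dS irho) ddr + ip l (dS ieta) dde
  + 91 * B * (9 * m * (sq_dist M u v t0 + sq_dist M u v t1) + 3 * m ^+ 3 * volume d l).
Proof.
move=> hm.
rewrite (rel_entropy_regE Th_ok d0 pok pf a0 adm1) (rel_entropy_regE Th_ok d0 pok pf a0 adm0).
exact: (collect _ _ _ (ipv_polar (VhBr adm0) (VhBr adm1)) (ipv_polar (VhBe adm0) (VhBe adm1))
  (ip_polar nr0 nr1) (ip_polar ne0 ne1) (norm0v_sqr Th_ok d0 (grad ddr))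
  (norm0v_sqr Th_ok d0 (grad dde)) (norm0_sqr Th_ok d0 ddr) (norm0_sqr Th_ok d0 dde)
  (pot_step_integral hm)).
Qed.

End entropy_step.

(** * Size of the split derivatives and sign of the numerical dissipation *)

Section entropy_step_bounds.
Context (R : realType) (d : nat) (M : model R d) (Th : seq (simplex R d)).
Context (alpha B k : R) (a b : 'rV[R]_3).
Local Notation l := (edge M).
Local Notation nice := (nice l Th).
Local Notation gpts := (gpts l Th).
Hypotheses (Th_ok : triangulation l Th) (d0 : (0 < d)%N).
Hypotheses (pok : potential_ok M alpha) (pf : potential_facts M alpha a b B k).
Hypothesis a0 : 0 < a 0 itheta.
Context (T : R) (nT n : nat) (u v : fields R d) (p : taylor_points R d).
Local Notation t0 := (tn T nT n).
Local Notation t1 := (tn T nT n.+1).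
Local Notation adm := (admissible M Th a b u v).
Hypotheses (adm0 : adm t0) (adm1 : adm t1).
Local Notation dr := (diff_rho u v).
Local Notation dt := (diff_theta u v).
Local Notation de := (diff_eta u v).

Local Opaque pder st.

Let lip f i r t e r' t' e' : derivs_bounded (box a b) f B ->
  box a b (st r t e) -> box a b (st r' t' e') ->
  `|pder i f (st r' t' e') - pder i f (st r t e)| <= B * (`|r' - r| + `|t' - t| + `|e' - e|).
Proof.
move=> fB z z'; rewrite -l1_st -st_diff; apply: (@pder_lipschitz R 3 (pder i f) a b) => // y yb j.
have [_ h] := fB [:: i] y yb isT; have [h2 _] := fB [:: j; i] y yb isT.
by split; [exact: h|exact: h2].
Qed.

(** The new temperature enters both summands, so its coefficient is [6 + 6 = 12] times [B ^+ 2]; the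
    other variables are majorised accordingly. *)
Let sq_le (X Y r0 r1 t0 t1 e0 e1 : R) : 0 < B -> `|X| <= B * (`|r0| + `|t1| + `|e0|) ->
  `|Y| <= B * (`|r1| + `|t1| + `|e1|) ->
  (X + Y) * (X + Y) <=
  12 * B ^+ 2 * (r0 * r0 + t0 * t0 + e0 * e0 + (r1 * r1 + t1 * t1 + e1 * e1)).
Proof.
move=> Bp hX hY.
have sq Z (z1 z2 z3 : R) : `|Z| <= B * (`|z1| + `|z2| + `|z3|) ->
    Z ^+ 2 <= 3 * (B ^+ 2 * (z1 * z1 + z2 * z2 + z3 * z3)).
  move=> h; have : `|Z| ^+ 2 <= (B * (`|z1| + `|z2| + `|z3|)) ^+ 2.
    by rewrite ler_sqr ?nnegrE// (le_trans _ h).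
  rewrite real_normK ?num_real// exprMn => /le_trans; apply.
  rewrite [leRHS]mulrCA; apply: ler_wpM2l; first exact: sqr_ge0.
  rewrite -!expr2 -(real_normK (num_real z1)) -(real_normK (num_real z2)).
  rewrite -(real_normK (num_real z3)); move: `|z1| `|z2| `|z3| => A A' A''.
  rewrite -subr_ge0 (_ : _ - _ = (A - A') ^+ 2 + (A' - A'') ^+ 2 + (A - A'') ^+ 2); last by ring.
  by rewrite !addr_ge0 ?sqr_ge0.
have {}hX := sq _ _ _ _ hX; have {}hY := sq _ _ _ _ hY.
have B2 : 0 <= B ^+ 2 := sqr_ge0 B.
have h : (X + Y) * (X + Y) <= 2 * X ^+ 2 + 2 * Y ^+ 2.
  by rewrite -subr_ge0 (_ : _ - _ = (X - Y) ^+ 2) ?sqr_ge0//; ring.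
have h0 : 0 <= B ^+ 2 * (t0 * t0) by rewrite mulr_ge0// -expr2 sqr_ge0.
have h1 : 0 <= B ^+ 2 * (r0 * r0) by rewrite mulr_ge0// -expr2 sqr_ge0.
have h2 : 0 <= B ^+ 2 * (e0 * e0) by rewrite mulr_ge0// -expr2 sqr_ge0.
have h3 : 0 <= B ^+ 2 * (r1 * r1) by rewrite mulr_ge0// -expr2 sqr_ge0.
have h4 : 0 <= B ^+ 2 * (e1 * e1) by rewrite mulr_ge0// -expr2 sqr_ge0.
by move: h h0 h1 h2 h3 h4 hX hY; lra.
Qed.

Lemma diff_split_bound i :
  ip l (diff_split M u v T nT n i) (diff_split M u v T nT n i)
  <= 12 * B ^+ 2 * (sq_dist M u v t0 + sq_dist M u v t1).
Proof.
have nr0 : nice (dr t0) := Vh_nice (VhBr adm0).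
have nr1 : nice (dr t1) := Vh_nice (VhBr adm1).
have nt0 : nice (dt t0) := Vh_nice (VhBt adm0).
have nt1 : nice (dt t1) := Vh_nice (VhBt adm1).
have ne0 : nice (de t0) := Vh_nice (VhBe adm0).
have ne1 : nice (de t1) := Vh_nice (VhBe adm1).
have nS := nice_dsplit pok pf a0 adm0 adm1 i.
have nrr0 := niceM nr0 nr0; have nrr1 := niceM nr1 nr1.
have ntt0 := niceM nt0 nt0; have ntt1 := niceM nt1 nt1.
have nee0 := niceM ne0 ne0; have nee1 := niceM ne1 ne1.
have nq0 := niceD (niceD nrr0 ntt0) nee0; have nq1 := niceD (niceD nrr1 ntt1) nee1.
rewrite /sq_dist /ip -(tintD Th_ok d0 nrr0 ntt0) -(tintD Th_ok d0 nrr1 ntt1).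
rewrite -(tintD Th_ok d0 (niceD nrr0 ntt0) nee0) -(tintD Th_ok d0 (niceD nrr1 ntt1) nee1).
rewrite -(tintD Th_ok d0 nq0 nq1) -(tintZ Th_ok d0 _ (niceD nq0 nq1)).
apply: (tint_le Th_ok d0 (niceM nS nS) (niceZ _ (niceD nq0 nq1))) => x xG.
have [mu mv] := state_mixed_box adm0 adm1 xG.
have hc := lip i (pf_cav pf) mv mu.
have hv := lip i (pf_vex pf) (adm_v adm1 xG) (adm_u adm1 xG).
have Bp := pf_B pf.
pose X := pder i (psi_cav M) (st (frho u t0 x) (ftheta u t1 x) (feta u t0 x))
  - pder i (psi_cav M) (st (frho v t0 x) (ftheta v t1 x) (feta v t0 x)).
pose Y := pder i (psi_vex M) (state u t1 x) - pder i (psi_vex M) (state v t1 x).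
have E : diff_split M u v T nT n i x = X + Y.
  rewrite /diff_split /split_der /X /Y.
  by move: (pder _ _ _) (pder _ _ _) (pder _ _ _) (pder _ _ _) => A A' C C'; ring.
by rewrite E; apply: sq_le; [exact: Bp|exact: hc|exact: hv].
Qed.

(** The intermediate points stay in the box, where [pf_theta] and [pf_hess] fix the signs of the
    potential terms. *)
Lemma num_dissipation_ge0 (lambda : R) : intermediate T nT M u p n ->
  0 < gamma_rho M -> 0 < gamma_eta M -> 0 <= lambda ->
  0 <= num_dissipation T nT M lambda u v p n.
Proof.
move=> int gr ge l0.
have h1 := ipv_ge0 Th_ok d0 (grad (incr_rho u v T nT n)).
have h2 := ipv_ge0 Th_ok d0 (grad (incr_eta u v T nT n)).
have h3 := sqr_ge0 (norm0 l (incr_rho u v T nT n)).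
have h4 := sqr_ge0 (norm0 l (incr_eta u v T nT n)).
have I0 : 0 <= - ip l (fun x => pder itheta (pder itheta (psi M))
    (st (frho u t0 x) (xi1 p n x) (feta u t0 x)) * incr_theta u v T nT n x)
    (incr_theta u v T nT n).
  have nt := niceB (Vh_nice (VhBt adm1)) (Vh_nice (VhBt adm0)).
  have np := nice_psi_tt pok pf a0 adm0 adm1 int.
  rewrite /ip -(tintN Th_ok d0 (niceM (niceM np nt) nt)); apply: (tint_ge0 Th_ok d0) => x xG.
  rewrite -mulrA -mulNr mulr_ge0//; last by rewrite -expr2 sqr_ge0.
  rewrite oppr_ge0; apply: (pf_theta pf).
  by have [] := taylor_points_box adm0 adm1 int xG.
have J0 : 0 <= tint l (fun x =>
      dot ((hessw (psi_vex M) (st (chi3 p n x) (ftheta u t1 x) (chi4 p n x))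
            - hessw (psi_cav M) (st (chi1 p n x) (ftheta u t1 x) (chi2 p n x)))
           *m wvec (incr_rho u v T nT n x) (incr_eta u v T nT n x))
        (wvec (incr_rho u v T nT n x) (incr_eta u v T nT n x))).
  apply: (tint_ge0 Th_ok d0) => x xG; apply: (pf_hess pf).
  by have [] := taylor_points_box adm0 adm1 int xG.
have S g g' c G G' I J N N' : 0 <= g -> 0 <= g' -> 0 <= c -> 0 <= G -> 0 <= G' ->
    0 <= - I -> 0 <= J -> 0 <= N -> 0 <= N' ->
    0 <= g / 2 * G + g' / 2 * G' - 2^-1 * I + 2^-1 * J + c / 2 * N + c / 2 * N' :> R.
  move=> g0 g'0 c0 G0 G'0 I1 J1 N0 N'0.
  rewrite -mulrN; do ![apply: addr_ge0]; apply: mulr_ge0 => //; exact: divr_ge0.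
exact: (S _ _ _ _ _ _ _ _ _ (ltW gr) (ltW ge) l0 (sqr_ge0 _) (sqr_ge0 _) I0 J0 h3 h4).
Qed.

End entropy_step_bounds.

(** * Absorption of Young terms into the dissipation *)

Definition absorbing (R : realType) (lam0 K g lam B c CL : R) :=
  forall X m G E0 E1 P P' S R1 R3 R4 R5 F A1 A3 A4 f1 f1' f4 p1 p4 : R,
  [/\ 0 <= X, 0 <= m, 0 <= G, 0 <= E0 & 0 <= E1] ->
  [/\ 0 <= P, 0 <= P', 0 <= S & 0 <= R1] -> [/\ 0 <= R3, 0 <= R4 & 0 <= R5] ->
  (forall e, 0 < e -> F <= e * (K * X) + (4 * e)^-1 * (p1 + p4)) ->
  (forall e, 0 < e -> A1 <= e * (f1 + f1') + (4 * e)^-1 * R1) ->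
  (forall e, 0 < e -> A3 <= e * (E1 + X) + (4 * e)^-1 * R3) ->
  (forall e, 0 < e -> A4 <= e * f4 + (4 * e)^-1 * R4) ->
  (forall e, 0 < e -> g * G <= e * m + (4 * e)^-1 * E1 + P + S + 2^-1 * E1) ->
  m <= g * X + 5 * S + 5 * P + E1 -> S <= 12 * B ^+ 2 * (E0 + E1) ->
  p1 <= 2 * P' + 2 * (lam ^+ 2 * G) -> p4 <= 2 * R5 + 2 * (lam ^+ 2 * E1) ->
  f1 <= 3 * (m + P + lam ^+ 2 * E1) -> f1' <= 3 * (X + P' + lam ^+ 2 * G) ->
  f4 <= 3 * (X + R5 + lam ^+ 2 * E1) ->
  F + A1 + A3 + A4 <= lam0 / 2 * X + c * (E0 + E1) + CL * (R1 + (P + P') + R3 + R4 + R5).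

(** In [absorbing], [X] collects the squared norms controlled by the dissipation, [m] and [G] are
    those of the rho potential difference and of the gradient of the rho difference, [E0] and [E1]
    the squared distances, [S] that of the split derivative, and [P], [P'] and the [R] variables
    belong to the residuals. The weights must be chosen without circularity, because [m] is bounded
    through [X] while [G] is bounded only through [m]. First [e'] and [e] are fixed from [lam0], [K]
    and [g]; they determine the coefficient [K3] of [G]; then [e2] is taken small relative to [K3],
    so that little of [G] returns to [X] by way of [m]. *)
Lemma absorption (R : realType) (lam0 K g lam B : R) : 0 < lam0 -> 0 <= K -> 0 < g ->
  exists c CL : R, [/\ 0 <= c, 0 < CL & absorbing lam0 K g lam B c CL].
Proof.
move=> l0 K0 g0; rewrite /absorbing; set L := lam ^+ 2; have L0 : 0 <= L := sqr_ge0 lam.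
set B2 := B ^+ 2; have B20 : 0 <= B2 := sqr_ge0 B.
(* The budget for [X] is [lam0 / 2]: at most [lam0 / 8] comes from [F], [lam0 / 8] from [K3 * G],
   and less than [lam0 / 8] from the terms with weight [e]. *)
pose e' := lam0 / (8 * (K + 1)); pose e := lam0 / (64 * (1 + g)).
have e'0 : 0 < e' by rewrite divr_gt0// mulr_gt0// ltr_wpDl.
have e0 : 0 < e by rewrite divr_gt0// mulr_gt0// addr_gt0.
pose k1 := (4 * e')^-1; have k10 : 0 < k1 by rewrite invr_gt0 mulr_gt0.
pose k2 := (4 * e)^-1; have k20 : 0 < k2 by rewrite invr_gt0 mulr_gt0.
pose K3 := 2 * L * k1 + 3 * e * L.
have K30 : 0 <= K3.
  by rewrite addr_ge0//; apply: mulr_ge0 => //; [exact: mulr_ge0|exact: ltW|rewrite mulr_ge0// ltW].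
pose e2 := lam0 / (8 * (K3 + 1)).
have e20 : 0 < e2 by rewrite divr_gt0// mulr_gt0// ltr_wpDl.
pose h := (4 * e2)^-1; have h0 : 0 < h by rewrite invr_gt0 mulr_gt0.
(* The factor [y] converts [K3 * G] into a multiple of the available bound on [g * G]. *)
pose y := K3 / g; have y0 : 0 <= y := divr_ge0 K30 (ltW g0).
have yg : y * g = K3 by rewrite /y divfK// gt_eqF.
pose q := 3 * e + y * e2.
have ye2 : 0 <= y * e2 := mulr_ge0 y0 (ltW e20).
have q0 : 0 <= q by rewrite /q; lra.
have e'K : e' * K <= lam0 / 8.
  rewrite /e' mulrAC ler_pdivrMr ?mulr_gt0 ?ltr_wpDl//.
  by rewrite (_ : lam0 / 8 * _ = lam0 * (K + 1)); [rewrite ler_wpM2l ?ltW//; lra|field].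
have eg : 64 * (e * (1 + g)) = lam0.
  by rewrite /e; field; rewrite gt_eqF// addr_gt0.
have K3e : K3 * e2 <= lam0 / 8.
  rewrite /e2 mulrA ler_pdivrMr ?mulr_gt0 ?ltr_wpDl//.
  by rewrite (_ : lam0 / 8 * _ = (K3 + 1) * lam0); [rewrite ler_wpM2r ?ltW//; lra|field].
pose q1 := 2 * (L * k1) + 6 * (e * L) + e + y * h + y * 2^-1 + q.
pose q2 := y + 5 * q.
have Lk : 0 <= L * k1 := mulr_ge0 L0 (ltW k10).
have eL : 0 <= e * L := mulr_ge0 (ltW e0) L0.
have yh : 0 <= y * h := mulr_ge0 y0 (ltW h0).
have q20 : 0 <= q2 by rewrite /q2; lra.
have q10 : 0 <= q1 by rewrite /q1; lra.
exists (q1 + 12 * B2 * q2), (q2 + 3 * e + 2 * k1 + 3 * e + k2); split.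
- by apply: addr_ge0 => //; apply: mulr_ge0 => //; exact: mulr_ge0.
- by lra.
move=> X m G E0 E1 P P' S R1 R3 R4 R5 F A1 A3 A4 f1 f1' f4 p1 p4.
move=> [X0 m0 G0 E00 E10] [P0 P'0 S0 R10] [R30 R40 R50].
move=> /(_ _ e'0) hF /(_ _ e0) hA1 /(_ _ e0) hA3 /(_ _ e0) hA4 /(_ _ e20) hG hm hS hp1 hp4 hf1 hf1' hf4.
rewrite -/k1 in hF; rewrite -/k2 in hA1 hA3 hA4; rewrite -/h in hG.
have s1 : F + A1 + A3 + A4 <= (e' * K) * X
    + (7 * (e * X) + 3 * (e * m) + K3 * G + (2 * (L * k1) + 6 * (e * L) + e) * E1
    + 3 * e * P + (2 * k1 + 3 * e) * (P' + R5) + k2 * (R1 + R3 + R4)).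
  have kp : k1 * (p1 + p4) <= k1 * (2 * P' + 2 * (L * G) + (2 * R5 + 2 * (L * E1))).
    by apply: ler_wpM2l; [exact: ltW|rewrite lerD].
  have ef : e * (f1 + f1') <= e * (3 * (m + P + L * E1) + 3 * (X + P' + L * G)).
    by apply: ler_wpM2l; [exact: ltW|rewrite lerD].
  have ef4 : e * f4 <= e * (3 * (X + R5 + L * E1)) by apply: ler_wpM2l; [exact: ltW|].
  have := lerD (lerD (lerD (le_trans hF (lerD (lexx _) kp)) (le_trans hA1 (lerD ef (lexx _))))
    hA3) (le_trans hA4 (lerD ef4 (lexx _))).
  move=> /le_trans; apply; rewrite le_eqVlt; apply/orP; left; apply/eqP.
  by rewrite /K3; ring.
have yG : K3 * G <= y * (e2 * m + h * E1 + P + S + 2^-1 * E1).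
  by rewrite -yg -mulrA; apply: ler_wpM2l.
have qm : q * m <= q * (g * X + 5 * S + 5 * P + E1) by apply: ler_wpM2l.
have s2 : 3 * (e * m) + K3 * G <= q * g * X + (y * h + y * 2^-1 + q) * E1 + q2 * S + q2 * P.
  rewrite (@le_trans _ _ (q * m + y * (h * E1 + P + S + 2^-1 * E1)))//.
    apply: (le_trans (lerD (lexx _) yG)); rewrite le_eqVlt; apply/orP; left; apply/eqP.
    by rewrite /q; ring.
  apply: (le_trans (lerD qm (lexx _))); rewrite le_eqVlt; apply/orP; left; apply/eqP.
  by rewrite /q2; ring.
have s3 : (e' * K) * X + 7 * (e * X) + q * g * X <= lam0 / 2 * X.
  rewrite mulrA -!mulrDl; apply: ler_wpM2r => //.
  have -> : q * g = 3 * (e * g) + K3 * e2 by rewrite -yg /q; ring.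
  have egp : 0 <= e * g := mulr_ge0 (ltW e0) (ltW g0).
  have eg' : 64 * e + 64 * (e * g) = lam0 by rewrite -[RHS]eg; ring.
  by move: e'K K3e eg' egp (ltW e0); clear; move: (e' * K) (K3 * e2) (e * g) => z1 z2 z3; lra.
have s4 : F + A1 + A3 + A4 <= lam0 / 2 * X + (q1 * E1 + q2 * S
    + (q2 + 3 * e) * P + (2 * k1 + 3 * e) * (P' + R5) + k2 * (R1 + R3 + R4)).
  have := lerD s1 (lerD s2 s3); rewrite -subr_ge0 => H.
  by rewrite -subr_ge0; apply: (le_trans H); rewrite le_eqVlt; apply/orP; left; apply/eqP; rewrite /q1; ring.
apply: (le_trans s4); rewrite -[leRHS]addrA lerD2l.
have s5 : q1 * E1 + q2 * S <= (q1 + 12 * B2 * q2) * (E0 + E1).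
  have h1 : 0 <= q1 * E0 := mulr_ge0 q10 E00.
  have h2 : q2 * S <= q2 * (12 * B2 * (E0 + E1)) by apply: ler_wpM2l.
  apply: (le_trans (lerD (lexx _) h2)); rewrite -subr_ge0; apply: (le_trans h1).
  by rewrite le_eqVlt; apply/orP; left; apply/eqP; ring.
rewrite -3!addrA addrA; apply: lerD => //.
have mono (x y' z : R) : 0 <= x -> y' <= z -> y' * x <= z * x := fun x0 => @ler_wpM2r _ x x0 y' z.
have u1 : (q2 + 3 * e) * P <= (q2 + 3 * e + 2 * k1 + 3 * e + k2) * P.
  by apply: mono => //; lra.
have u2 : (2 * k1 + 3 * e) * (P' + R5) <= (q2 + 3 * e + 2 * k1 + 3 * e + k2) * (P' + R5).
  by apply: mono; [exact: addr_ge0|lra].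
have u3 : k2 * (R1 + R3 + R4) <= (q2 + 3 * e + 2 * k1 + 3 * e + k2) * (R1 + R3 + R4).
  by apply: mono; [do 2![apply: addr_ge0 => //]|lra].
have := lerD u1 (lerD u2 u3) => /le_trans; apply.
by rewrite le_eqVlt; apply/orP; left; apply/eqP; ring.
Qed.

(** * Testing the three evolution equations together *)

Section testing.
Context (R : realType) (d : nat) (M : model R d) (Th : seq (simplex R d)).
Context (alpha B k : R) (a b : 'rV[R]_3).
Local Notation l := (edge M).
Local Notation nice := (nice l Th).
Local Notation gpts := (gpts l Th).
Local Notation Vh := (Vh l Th).
Hypotheses (Th_ok : triangulation l Th) (d0 : (0 < d)%N).
Implicit Types (g phi : 'rV[R]_d -> R).

Definition slots g1 g2 g3 (x : 'rV[R]_d) : 'cV[R]_(d + (d + 1)) :=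
  col_mx (grad g1 x) (col_mx (grad g2 x) (g3 x)%:M).

Lemma dotC n (F G : 'cV[R]_n) : dot F G = dot G F.
Proof. by rewrite !dotE; apply: eq_bigr => i _; rewrite mulrC. Qed.

Lemma dotBl n (F F' G : 'cV[R]_n) : dot (F - F') G = dot F G - dot F' G.
Proof. by rewrite !dotE -sumrB; apply: eq_bigr => i _; rewrite !mxE mulrBl. Qed.

Lemma dotDr n (F G G' : 'cV[R]_n) : dot F (G + G') = dot F G + dot F G'.
Proof. by rewrite !dotE -big_split; apply: eq_bigr => i _; rewrite !mxE mulrDr. Qed.

Lemma niceV_col_mx m n (F : 'rV[R]_d -> 'cV[R]_m) (G : 'rV[R]_d -> 'cV[R]_n) :
  niceV l Th F -> niceV l Th G -> niceV l Th (fun x => col_mx (F x) (G x)).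
Proof.
move=> nF nG i; rewrite -(splitK i); case: (fintype.split i) => j /=.
  by apply: nice_ext (nF j) => x _; rewrite col_mxEu.
by apply: nice_ext (nG j) => x _; rewrite col_mxEd.
Qed.

Lemma niceV_scalar g : nice g -> niceV l Th (fun x => (g x)%:M : 'cV[R]_1).
Proof. by move=> ng i; apply: nice_ext ng => x _; rewrite ord1 mxE eqxx mulr1n. Qed.

Lemma niceV_slots g1 g2 g3 : Vh g1 -> Vh g2 -> nice g3 -> niceV l Th (slots g1 g2 g3).
Proof.
move=> h1 h2 n3; apply: niceV_col_mx; first exact: niceV_grad.
by apply: niceV_col_mx; [exact: niceV_grad|exact: niceV_scalar].
Qed.

Lemma slotsB g1 g2 g3 h1 h2 h3 x : Vh g1 -> Vh g2 -> Vh h1 -> Vh h2 -> gpts x ->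
  slots (fun y => g1 y - h1 y) (fun y => g2 y - h2 y) (fun y => g3 y - h3 y) x =
  slots g1 g2 g3 x - slots h1 h2 h3 x.
Proof.
move=> v1 v2 w1 w2 [_ xS]; rewrite /slots (Vh_gradB Th_ok v1 w1 xS) (Vh_gradB Th_ok v2 w2 xS).
by rewrite !opp_col_mx !add_col_mx raddfB.
Qed.

Lemma slotsD g1 g2 g3 h1 h3 x : Vh g1 -> Vh h1 -> gpts x ->
  slots (fun y => g1 y + h1 y) g2 (fun y => g3 y + h3 y) x =
  slots g1 g2 g3 x + col_mx (grad h1 x) (col_mx 0 (h3 x)%:M).
Proof.
move=> v1 w1 [_ xS]; rewrite /slots (Vh_gradD Th_ok v1 w1 xS).
by rewrite !add_col_mx raddfD addr0.
Qed.

Variable z : 'rV[R]_d -> 'rV[R]_(mob_dim d).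
Hypothesis nA : forall i j, nice (fun x => Lfull M (z x) i j).

Let W g1 g2 g3 x := Lfull M (z x) *m slots g1 g2 g3 x.

Lemma niceV_flux g1 g2 g3 : Vh g1 -> Vh g2 -> nice g3 -> niceV l Th (W g1 g2 g3).
Proof. by move=> *; apply: niceVM => //; exact: niceV_slots. Qed.

(** With the energy equation subtracted, the signs match the off-diagonal blocks of [Lfull], and the
    three flux terms become one bilinear form in the slots. *)
Lemma flux_test g1 g2 g3 f1 f2 f3 : Vh g1 -> Vh g2 -> nice g3 -> Vh f1 -> Vh f2 -> nice f3 ->
  ipv l (fun x => L11 M (z x) *m grad g1 x - L12 M (z x) *m grad g2 x
           + g3 x *: L13 M (z x)) (grad f1)
  - ipv l (fun x => L12 M (z x) *m grad g1 x - L22 M (z x) *m grad g2 x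
           + g3 x *: L23 M (z x)) (grad f2)
  + ip l (fun x => dot (L13 M (z x)) (grad g1 x) - dot (L23 M (z x)) (grad g2 x)
           + L33 M (z x) * g3 x) f3
  = tint l (fun x => dot (W g1 g2 g3 x) (slots f1 f2 f3 x)).
Proof.
move=> h1 h2 n3 k1 k2 m3; have nW := niceV_flux h1 h2 n3.
have WE x : W g1 g2 g3 x = _ := Lfull_mul M (z x) (grad g1 x) (grad g2 x) (g3 x).
have nF1 : niceV l Th (fun x => L11 M (z x) *m grad g1 x - L12 M (z x) *m grad g2 x
           + g3 x *: L13 M (z x)).
  by move=> i; apply: nice_ext (nW (lshift _ i)) => x _; rewrite WE col_mxEu.
have nF2 : niceV l Th (fun x => L12 M (z x) *m grad g1 x - L22 M (z x) *m grad g2 x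
           + g3 x *: L23 M (z x)).
  move=> i; apply: nice_ext (niceN (nW (rshift _ (lshift _ i)))) => x _.
  by rewrite WE col_mxEd col_mxEu mxE opprK.
have nF3 : nice (fun x => dot (L13 M (z x)) (grad g1 x) - dot (L23 M (z x)) (grad g2 x)
           + L33 M (z x) * g3 x).
  apply: nice_ext (nW (rshift _ (rshift _ 0))) => x _.
  by rewrite WE col_mxEd col_mxEd mxE eqxx mulr1n.
have n1 := nice_dot nF1 (niceV_grad Th_ok k1); have n2 := nice_dot nF2 (niceV_grad Th_ok k2).
rewrite /ipv /ip -(tintB Th_ok d0 n1 n2) -(tintD Th_ok d0 (niceB n1 n2) (niceM nF3 m3)).
apply: (tint_ext Th_ok d0) => x _; rewrite WE /slots !dot_col_mx dot_scalar addrA.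
congr (_ + _ + _); rewrite !dotE -sumrN; apply: eq_bigr => i _.
by rewrite [in RHS]mxE mulNr.
Qed.

Lemma fluxB g1 g2 g3 h1 h2 h3 (F : 'rV[R]_d -> 'cV[R]_(d + (d + 1))) :
  Vh g1 -> Vh g2 -> Vh g3 -> Vh h1 -> Vh h2 -> Vh h3 -> niceV l Th F ->
  tint l (fun x => dot (W g1 g2 g3 x) (F x)) - tint l (fun x => dot (W h1 h2 h3 x) (F x)) =
  tint l (fun x => dot (W (fun y => g1 y - h1 y) (fun y => g2 y - h2 y)
    (fun y => g3 y - h3 y) x) (F x)).
Proof.
move=> v1 v2 v3 w1 w2 w3 nF.
have n1 := nice_dot (niceV_flux v1 v2 (Vh_nice v3)) nF.
have n2 := nice_dot (niceV_flux w1 w2 (Vh_nice w3)) nF.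
rewrite -(tintB Th_ok d0 n1 n2); apply: (tint_ext Th_ok d0) => x xG.
by rewrite /W slotsB// mulmxBr dotBl.
Qed.

End testing.

(** Such facts isolate the linear arithmetic of a proof on plain variables, out of sight of
    integrals. *)
Fact combine_weak (R : realFieldType) (xu xv yu yv zu zv au av bu bv cu cv wu wv w p q s : R) :
  xu - xv = p -> yu - yv = q -> zu - zv = s -> xu + au = 0 -> yu + bu = 0 -> zu + cu = 0 ->
  au - bu + cu = wu -> av - bv + cv = wv -> wu - wv = w ->
  p - q + s + w = - (xv + av) + (yv + bv) - (zv + cv).
Proof. by lra. Qed.

Fact combine_potential (R : realFieldType) (g mu mv m gu gv G su sv s q : R) :
  mu - mv = m -> gu - gv = G -> su - sv = s ->
  mu - g * gu - su = 0 -> mv - g * gv - sv = q -> m - g * G - s = - q.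
Proof. by move=> <- <- <- hu <-; rewrite -[RHS]add0r -hu; ring. Qed.

(** * Error equations: scheme minus perturbed system *)

Section weak_equations.
Context (R : realType) (d : nat) (M : model R d) (Th : seq (simplex R d)).
Context (alpha B k : R) (a b : 'rV[R]_3).
Local Notation l := (edge M).
Local Notation nice := (nice l Th).
Local Notation gpts := (gpts l Th).
Local Notation Vh := (Vh l Th).
Hypotheses (Th_ok : triangulation l Th) (d0 : (0 < d)%N).
Hypotheses (pok : potential_ok M alpha) (pf : potential_facts M alpha a b B k).
Hypothesis a0 : 0 < a 0 itheta.
Context (T : R) (nT n : nat) (u v : fields R d).
Local Notation tau := (tau T nT).
Local Notation t0 := (tn T nT n).
Local Notation t1 := (tn T nT n.+1).
Local Notation dn := (dn T nT).
Local Notation adm := (admissible M Th a b u v).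
Hypotheses (adm0 : adm t0) (adm1 : adm t1).
Variable z : 'rV[R]_d -> 'rV[R]_(mob_dim d).
Hypothesis nA : forall i j, nice (fun x => Lfull M (z x) i j).
Hypotheses (hmu : Vh (fmu_rho u t1)) (hmv : Vh (fmu_rho v t1))
  (hnu : Vh (fmu_eta u t1)) (hnv : Vh (fmu_eta v t1)).
Variables r1 r2 r3 r4 r5 : 'rV[R]_d -> R.
Hypotheses (equ : step_eqs T nT M Th z u n (fun=> 0) (fun=> 0) (fun=> 0) (fun=> 0) (fun=> 0))
  (eqv : step_eqs T nT M Th z v n (ip l r1) (ip l r2) (ip l r3) (ip l r4) (ip l r5)).

Local Opaque pder st.

Definition diff_mu (t : R) x := fmu_rho u t x - fmu_rho v t x.
Definition diff_nu (t : R) x := fmu_eta u t x - fmu_eta v t x.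

Local Notation dr := (diff_rho u v).
Local Notation dt := (diff_theta u v).
Local Notation de := (diff_eta u v).
Local Notation ddr := (incr_rho u v T nT n).
Local Notation ddt := (incr_theta u v T nT n).
Local Notation dde := (incr_eta u v T nT n).
Local Notation dE := (incr_energy M u v T nT n).
Local Notation dS := (diff_split M u v T nT n).
Local Notation dm := (diff_mu t1).
Local Notation dN := (diff_nu t1).

Let ip_dtau g g' (phi : 'rV[R]_d -> R) : nice (dn g n) -> nice (dn g' n) -> nice phi ->
  ip l (dtau T nT g n) phi - ip l (dtau T nT g' n) phi =
  tau^-1 * ip l (fun x => dn g n x - dn g' n x) phi.
Proof.
move=> ng ng' nphi; have nd := niceB ng ng'.
rewrite -(ipZl Th_ok d0 _ nd nphi).
have tE h : nice (dn h n) -> nice (dtau T nT h n).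
  by move=> nh; apply: nice_ext (niceZ tau^-1 nh) => x _; rewrite /dtau mulrC.
rewrite -(ipBl Th_ok d0 (tE _ ng) (tE _ ng') nphi).
by apply: (ip_ext Th_ok d0) => // x _; rewrite /dtau mulrBr ![tau^-1 * _]mulrC.
Qed.

(** Both systems use the same mobility argument [z], so the difference of the fluxes is the flux of
    the difference although the coefficients are nonlinear. The sign pattern is that of
    [flux_test]. *)
Lemma weak_increments f1 f2 f3 : Vh f1 -> Vh f2 -> Vh f3 ->
  tau^-1 * (ip l ddr f1 - ip l dE f2 + ip l dde f3)
  + tint l (fun x => dot (Lfull M (z x) *m slots dm (dt t1) dN x) (slots f1 f2 f3 x))
  = - ip l r1 f1 + ip l r3 f2 - ip l r4 f3.
Proof.
move=> h1 h2 h3.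
have n1 := Vh_nice h1; have n2 := Vh_nice h2; have n3 := Vh_nice h3.
have [u1 _ _ _ _] := equ h1; have [_ _ u3 _ _] := equ h2; have [_ _ _ u4 _] := equ h3.
have [v1 _ _ _ _] := eqv h1; have [_ _ v3 _ _] := eqv h2; have [_ _ _ v4 _] := eqv h3.
rewrite -v1 -v3 -v4.
have Wu := flux_test Th_ok d0 nA hmu (adm_ut adm1) (Vh_nice hnu) h1 h2 n3.
have Wv := flux_test Th_ok d0 nA hmv (adm_vt adm1) (Vh_nice hnv) h1 h2 n3.
have Wd := fluxB Th_ok d0 nA hmu (adm_ut adm1) hnu hmv (adm_vt adm1) hnv
  (niceV_slots Th_ok h1 h2 n3).
have nE t := @nice_state_u _ _ M Th _ _ _ a0 u v (psi M) [:: itheta] t (psi_smooth pok) (pf_psi pf) isT.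
have nE' t := @nice_state_v _ _ M Th _ _ _ a0 u v (psi M) [:: itheta] t (psi_smooth pok) (pf_psi pf) isT.
have Tr : ip l (dtau T nT (frho u) n) f1 - ip l (dtau T nT (frho v) n) f1 = tau^-1 * ip l ddr f1.
  rewrite ip_dtau//; last 2 first.
  - by apply: niceB; apply: Vh_nice; [exact: adm_ur adm1|exact: adm_ur adm0].
  - by apply: niceB; apply: Vh_nice; [exact: adm_vr adm1|exact: adm_vr adm0].
  congr (_ * _); apply: (ip_ext Th_ok d0) => // x _.
  by rewrite /Defs.dn /incr_rho /diff_rho; ring.
have Te : ip l (dtau T nT (feta u) n) f3 - ip l (dtau T nT (feta v) n) f3 = tau^-1 * ip l dde f3.
  rewrite ip_dtau//; last 2 first.
  - by apply: niceB; apply: Vh_nice; [exact: adm_ue adm1|exact: adm_ue adm0].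
  - by apply: niceB; apply: Vh_nice; [exact: adm_ve adm1|exact: adm_ve adm0].
  congr (_ * _); apply: (ip_ext Th_ok d0) => // x _.
  by rewrite /Defs.dn /incr_eta /diff_eta; ring.
have TE : ip l (dtau T nT (energy M u) n) f2 - ip l (dtau T nT (energy M v) n) f2 = tau^-1 * ip l dE f2.
  rewrite ip_dtau//.
  - exact: niceB (nE _ adm1) (nE _ adm0).
  - exact: niceB (nE' _ adm1) (nE' _ adm0).
rewrite mulrDr mulrBr.
exact: (combine_weak Tr TE Te u1 u3 u4 Wu Wv Wd).
Qed.

Let ipv_gradB f g h : Vh f -> Vh g -> Vh h ->
  ipv l (grad (fun x => f x - g x)) (grad h) = ipv l (grad f) (grad h) - ipv l (grad g) (grad h).
Proof.
move=> hf hg hh; have nh := niceV_grad Th_ok hh.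
rewrite /ipv -(tintB Th_ok d0 (nice_dot (niceV_grad Th_ok hf) nh) (nice_dot (niceV_grad Th_ok hg) nh)).
by apply: (tint_ext Th_ok d0) => x [_ xS]; rewrite (Vh_gradB Th_ok hf hg xS) dotBl.
Qed.

(** Used with three test functions: the increment of the rho difference, the rho difference, and the
    potential difference. *)
Lemma weak_potential_rho f : Vh f ->
  ip l dm f - gamma_rho M * ipv l (grad (dr t1)) (grad f) - ip l (dS irho) f = - ip l r2 f.
Proof.
move=> h; have nf := Vh_nice h.
have [_ eu _ _ _] := equ h; have [_ ev _ _ _] := eqv h.
have M1 := ipBl Th_ok d0 (Vh_nice hmu) (Vh_nice hmv) nf.
have G1 := ipv_gradB (adm_ur adm1) (adm_vr adm1) h.
have S1 := ipBl Th_ok d0 (nice_split_u pok pf a0 adm0 adm1 irho) (nice_split_v pok pf a0 adm0 adm1 irho) nf.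
exact: (combine_potential (esym M1) (esym G1) (esym S1) eu ev).
Qed.

Lemma weak_potential_eta f : Vh f ->
  ip l dN f - gamma_eta M * ipv l (grad (de t1)) (grad f) - ip l (dS ieta) f = - ip l r5 f.
Proof.
move=> h; have nf := Vh_nice h.
have [_ _ _ _ eu] := equ h; have [_ _ _ _ ev] := eqv h.
have M1 := ipBl Th_ok d0 (Vh_nice hnu) (Vh_nice hnv) nf.
have G1 := ipv_gradB (adm_ue adm1) (adm_ve adm1) h.
have S1 := ipBl Th_ok d0 (nice_split_u pok pf a0 adm0 adm1 ieta) (nice_split_v pok pf a0 adm0 adm1 ieta) nf.
exact: (combine_potential (esym M1) (esym G1) (esym S1) eu ev).
Qed.
End weak_equations.

(** * Squared norms of the corrected test functions *)

Section step_estimate.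
Context (R : realType) (d : nat) (M : model R d) (Th : seq (simplex R d)).
Context (alpha B k : R) (a b : 'rV[R]_3).
Local Notation l := (edge M).
Local Notation nice := (nice l Th).
Local Notation gpts := (gpts l Th).
Local Notation Vh := (Vh l Th).
Hypotheses (Th_ok : triangulation l Th) (d0 : (0 < d)%N) (l0 : 0 < l).

Lemma ip_add2 v w (c : R) : nice v -> nice w ->
  ip l (fun x => v x + c * w x) (fun x => v x + c * w x) <=
  2 * ip l v v + 2 * (c ^+ 2 * ip l w w).
Proof.
move=> nv nw; have ns := niceD nv (niceZ c nw).
have nvv := niceM nv nv; have nww := niceM nw nw.
have nc := niceZ (c ^+ 2) nww.
rewrite /ip -(tintZ Th_ok d0 (c ^+ 2) nww) -(tintZ Th_ok d0 _ nvv) -(tintZ Th_ok d0 _ nc).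
rewrite -(tintD Th_ok d0 (niceZ _ nvv) (niceZ _ nc)).
apply: (tint_le Th_ok d0 (niceM ns ns) (niceD (niceZ _ nvv) (niceZ _ nc))) => x _.
rewrite -subr_ge0 (_ : _ - _ = (v x - c * w x) ^+ 2) ?sqr_ge0//.
by move: (v x) (w x) => p q; ring.
Qed.

Lemma ip_add3 u v w (c : R) : nice u -> nice v -> nice w ->
  ip l (fun x => u x + (v x + c * w x)) (fun x => u x + (v x + c * w x)) <=
  3 * (ip l u u + ip l v v + c ^+ 2 * ip l w w).
Proof.
move=> nu nv nw; have ns := niceD nu (niceD nv (niceZ c nw)).
have nuu := niceM nu nu; have nvv := niceM nv nv; have nww := niceM nw nw.
have nc := niceZ (c ^+ 2) nww.
rewrite /ip -(tintZ Th_ok d0 (c ^+ 2) nww) -(tintD Th_ok d0 nuu nvv).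
rewrite -(tintD Th_ok d0 (niceD nuu nvv) nc) -(tintZ Th_ok d0 _ (niceD (niceD nuu nvv) nc)).
apply: (tint_le Th_ok d0 (niceM ns ns) (niceZ _ (niceD (niceD nuu nvv) nc))) => x _.
move: (u x) (v x) (w x) => o p q.
rewrite -subr_ge0 (_ : _ - _ = (o - p) ^+ 2 + (o - c * q) ^+ 2 + (p - c * q) ^+ 2); last by ring.
by rewrite !addr_ge0 ?sqr_ge0.
Qed.

Let ipv_sum f g : Vh f -> Vh g ->
  ipv l (grad f) (grad g) = \sum_i ip l (pder i f) (pder i g).
Proof.
move=> hf hg.
have n i : nice (fun x => pder i f x * pder i g x).
  by apply: niceM; apply: nice_ext (niceV_grad Th_ok _ i) => [x _|]; rewrite ?mxE.
rewrite /ipv /ip.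
have : forall s : seq 'I_d, tint l (fun x => \sum_(i <- s) pder i f x * pder i g x) =
    \sum_(i <- s) tint l (fun x => pder i f x * pder i g x).
  elim=> [|i s IH].
    rewrite big_nil (tint_ext Th_ok d0 (g := fun=> 0 * 0)) => [|x _]; last by rewrite big_nil mulr0.
    by rewrite (tintZ Th_ok d0 _ (nice_cst l Th 0)) mul0r.
  rewrite big_cons -IH -(tintD Th_ok d0 (n i) (nice_sum s n)).
  by apply: (tint_ext Th_ok d0) => x _; rewrite big_cons.
move=> <-; apply: (tint_ext Th_ok d0) => x _; rewrite dotE.
by apply: eq_bigr => i _; rewrite !mxE.
Qed.

Let pder_comb f g (c : R) i x : Vh f -> Vh g -> gpts x ->
  pder i (fun y => f y + c * g y) x = pder i f x + c * pder i g x.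
Proof.
move=> hf hg [_ xS]; have := Vh_gradD Th_ok hf (VhZ c hg) xS.
rewrite (Vh_gradZ Th_ok c hg xS) => /matrixP/(_ i 0); rewrite !mxE.
exact.
Qed.

Let nice_pder f i : Vh f -> nice (pder i f).
Proof. by move=> hf; apply: nice_ext (niceV_grad Th_ok hf i) => x _; rewrite mxE. Qed.

Lemma ipv_add2 v w (c : R) : Vh v -> Vh w ->
  ipv l (grad (fun x => v x + c * w x)) (grad (fun x => v x + c * w x)) <=
  2 * ipv l (grad v) (grad v) + 2 * (c ^+ 2 * ipv l (grad w) (grad w)).
Proof.
move=> hv hw; have hs := VhD hv (VhZ c hw).
rewrite !ipv_sum// !mulr_sumr -big_split; apply: ler_sum => i _.
rewrite (ip_ext Th_ok d0 (fun x xG => pder_comb c i hv hw xG) (fun x xG => pder_comb c i hv hw xG)).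
by apply: ip_add2; exact: nice_pder.
Qed.

Lemma ipv_add3 u v w (c : R) : Vh u -> Vh v -> Vh w ->
  ipv l (grad (fun x => u x + (v x + c * w x))) (grad (fun x => u x + (v x + c * w x))) <=
  3 * (ipv l (grad u) (grad u) + ipv l (grad v) (grad v) + c ^+ 2 * ipv l (grad w) (grad w)).
Proof.
move=> hu hv hw; have hs := VhD hv (VhZ c hw).
have hs2 := VhD hu hs; rewrite !ipv_sum//.
rewrite [c ^+ 2 * _]mulr_sumr -!big_split mulr_sumr; apply: ler_sum => i _ /=.
have E x : gpts x -> pder i (fun x => u x + (v x + c * w x)) x
    = pder i u x + (pder i v x + c * pder i w x).
  move=> xG; rewrite -pder_comb//; have [_ xS] := xG.
  by have := Vh_gradD Th_ok hu hs xS => /matrixP/(_ i 0); rewrite !mxE.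
rewrite (ip_ext Th_ok d0 E E); apply: ip_add3; exact: nice_pder.
Qed.

End step_estimate.

(** Half of the dissipation pays for the share of [X] left by the absorption; the other half stays
    on the left. *)
Fact combine_dissipation (R : realFieldType) (w t D Q X Y lam err : R) : 0 < t ->
  w + t * D <= t * Q + err -> lam * X <= D -> Q <= lam / 2 * X + Y ->
  w + t / 2 * D <= t * Y + err.
Proof.
move=> t0 h hD hQ; have {}hQ : Q <= 2^-1 * D + Y.
  by apply: (le_trans hQ); rewrite lerD2r mulrAC mulrC ler_wpM2l.
have := ler_wpM2l (ltW t0) hQ; rewrite mulrDr mulrA => h2.
by move: h h2; rewrite (_ : t * D = t / 2 * D + t / 2 * D);
  [move: (t / 2 * D) (t * Q) (t * Y) => z1 z2 z3; lra|field].
Qed.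

Fact combine_grad (R : realFieldType) (mr gG sr qr em z z' S P r E : R) :
  mr - gG - sr = - qr -> mr <= em + z -> - sr <= S + 4^-1 * r -> qr <= P + 4^-1 * r ->
  z <= z' -> r <= E -> gG <= em + z' + P + S + 2^-1 * E.
Proof. by lra. Qed.

Fact combine_increment (R : realFieldType) (w1 w0 N D t F A C E gr ge sr se mr mn qr qe lr le x1 x3 x4 err : R) :
  0 < t -> w1 - w0 + N <= gr + ge + lr + le - E + sr + se + err ->
  mr - gr - sr = - qr -> mn - ge - se = - qe ->
  t^-1 * (A - E + C) + (D + F) = - x1 + x3 - x4 ->
  A = mr + (qr + lr) -> C = mn + (qe + le) ->
  w1 - w0 + N + t * D <= t * (- F + -1 * x1 + x3 + -1 * x4) + err.
Proof.
move=> t0 h hr he hw hA hC.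
have {}hw : A - E + C = t * (- x1 + x3 - x4 - D - F).
  have -> : - x1 + x3 - x4 - D - F = t^-1 * (A - E + C) by move: hw; move: (t^-1 * _) => q; lra.
  by rewrite mulVKf// gt_eqF.
have {hw} : t * D + (A - E + C) = t * (- F + -1 * x1 + x3 + -1 * x4) by rewrite hw; ring.
by move: (t * D) (t * (- F + -1 * x1 + x3 + -1 * x4)) => tD tx; lra.
Qed.

Fact two_halves (R : realFieldType) (z E P S : R) :
  z + 2^-1 * E + P + S + 2^-1 * E = z + E + P + S.
Proof. by lra. Qed.

Fact combine_mass (R : realFieldType) (m g G Gm Xm X S P E sm rm : R) :
  0 <= g -> m - g * Gm - sm = - rm -> Gm <= 2^-1 * G + 2^-1 * Xm ->
  Xm <= X -> sm <= 2 * S + 8^-1 * m -> - rm <= 2 * P + 8^-1 * m ->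
  g * G <= 2^-1 * m + E + P + S -> m <= g * X + 5 * S + 5 * P + E.
Proof.
move=> g0 h1 h2 h3 h4 h5 h6.
have {}h2 : g * Gm <= 2^-1 * (g * G) + 2^-1 * (g * Xm).
  by apply: (le_trans (ler_wpM2l g0 h2)); rewrite le_eqVlt; apply/orP; left; apply/eqP; ring.
have : g * Xm <= g * X by rewrite ler_wpM2l.
by move: h1 h2 h6; move: (g * Gm) (g * G) (g * Xm) (g * X) => z1 z2 z3 z4; lra.
Qed.

(** * Stability estimate for one time step *)

Section step_estimate.
Context (R : realType) (d : nat) (M : model R d) (Th : seq (simplex R d)).
Context (alpha B k : R) (a b : 'rV[R]_3).
Local Notation l := (edge M).
Local Notation nice := (nice l Th).
Local Notation gpts := (gpts l Th).
Local Notation Vh := (Vh l Th).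
Hypotheses (Th_ok : triangulation l Th) (d0 : (0 < d)%N) (l0 : 0 < l).
Hypotheses (pok : potential_ok M alpha) (pf : potential_facts M alpha a b B k).
Hypothesis a0 : 0 < a 0 itheta.
Hypothesis gr0 : 0 < gamma_rho M.
Context (T : R) (nT n : nat) (u v : fields R d) (p : taylor_points R d).
Local Notation tau := (tau T nT).
Hypothesis tau0 : 0 < tau.
Local Notation t0 := (tn T nT n).
Local Notation t1 := (tn T nT n.+1).
Local Notation dn := (dn T nT).
Local Notation adm := (admissible M Th a b u v).
Hypotheses (adm0 : adm t0) (adm1 : adm t1).
Hypothesis int : intermediate T nT M u p n.
Variable z : 'rV[R]_d -> 'rV[R]_(mob_dim d).
Hypothesis nA : forall i j, nice (fun x => Lfull M (z x) i j).
Variables lam0 BL : R.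
Hypothesis lam00 : 0 < lam0.
Hypothesis ell : forall x (xi : 'cV[R]_(d + (d + 1))),
  lam0 * dot xi xi <= dot xi (Lfull M (z x) *m xi).
Hypothesis ABL : forall x i j, `|Lfull M (z x) i j| <= BL.
Hypotheses (hmu : Vh (fmu_rho u t1)) (hmv : Vh (fmu_rho v t1))
  (hnu : Vh (fmu_eta u t1)) (hnv : Vh (fmu_eta v t1)).
Variables r1 r2 r3 r4 r5 : 'rV[R]_d -> R.
Hypotheses (hr1 : Vh r1) (hr2 : Vh r2) (hr3 : Vh r3) (hr4 : Vh r4) (hr5 : Vh r5).
Hypotheses (equ : step_eqs T nT M Th z u n (fun=> 0) (fun=> 0) (fun=> 0) (fun=> 0) (fun=> 0))
  (eqv : step_eqs T nT M Th z v n (ip l r1) (ip l r2) (ip l r3) (ip l r4) (ip l r5)).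
Variable lambda : R.

Local Opaque pder st.
Local Notation dr := (diff_rho u v).
Local Notation dt := (diff_theta u v).
Local Notation de := (diff_eta u v).
Local Notation ddr := (incr_rho u v T nT n).
Local Notation dde := (incr_eta u v T nT n).
Local Notation dE := (incr_energy M u v T nT n).
Local Notation dS := (diff_split M u v T nT n).
Local Notation dm := (diff_mu u v t1).
Local Notation dN := (diff_nu u v t1).

Let hdr : Vh (dr t1) := VhBr adm1.
Let hdt : Vh (dt t1) := VhBt adm1.
Let hde : Vh (de t1) := VhBe adm1.
Let hddr : Vh ddr := VhB hdr (VhBr adm0).
Let hdde : Vh dde := VhB hde (VhBe adm0).
Let hdm : Vh dm := VhB hmu hmv.
Let hdN : Vh dN := VhB hnu hnv.
(** By the rho potential equation tested with the increment of rho, the gradient, split derivative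
    and [lambda] terms of [entropy_step] add up to the pairing of that increment with [dm + s1];
    likewise for eta with [dN + s4]. This dictates the test functions [f1] and [f4]. As [f1] also
    meets a flux through its gradient, [r2] is measured in H1, while [r5] enters in L2. *)
Let s1 x := r2 x + lambda * dr t1 x.
Let s4 x := r5 x + lambda * de t1 x.
Let hs1 : Vh s1 := VhD hr2 (VhZ lambda hdr).
Let hs4 : Vh s4 := VhD hr5 (VhZ lambda hde).
Let f1 x := dm x + s1 x.
Let f4 x := dN x + s4 x.
Let hf1 : Vh f1 := VhD hdm hs1.
Let hf4 : Vh f4 := VhD hdN hs4.
Let W x := Lfull M (z x) *m slots dm (dt t1) dN x.
Let nW : niceV l Th W := niceV_flux Th_ok nA hdm hdt (Vh_nice hdN).
Let D := dissipation T nT M z u v n.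
Let X := ipv l (grad dm) (grad dm) + ipv l (grad (dt t1)) (grad (dt t1)) + ip l dN dN.
Let Psi x : 'cV[R]_(d + (d + 1)) := col_mx (grad s1 x) (col_mx 0 (s4 x)%:M).

Let nPsi : niceV l Th Psi.
Proof.
apply: niceV_col_mx; first exact: niceV_grad.
apply: niceV_col_mx; last exact: niceV_scalar (Vh_nice hs4).
by move=> i; apply: nice_ext (nice_cst l Th 0) => x _; rewrite mxE.
Qed.

Let nxi : niceV l Th (slots dm (dt t1) dN) := niceV_slots Th_ok hdm hdt (Vh_nice hdN).

Lemma slots_energy :
  tint l (fun x => dot (slots dm (dt t1) dN x) (slots dm (dt t1) dN x)) = X.
Proof.
have n1 := nice_dot (niceV_grad Th_ok hdm) (niceV_grad Th_ok hdm).
have n2 := nice_dot (niceV_grad Th_ok hdt) (niceV_grad Th_ok hdt).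
have n3 := niceM (Vh_nice hdN) (Vh_nice hdN).
rewrite /X /ipv /ip -(tintD Th_ok d0 n1 n2) -(tintD Th_ok d0 (niceD n1 n2) n3).
by apply: (tint_ext Th_ok d0) => x _; rewrite /slots !dot_col_mx dot_scalar addrA.
Qed.

Lemma dissipation_ge : lam0 * X <= D.
Proof.
rewrite -slots_energy -(tintZ Th_ok d0 _ (nice_dot nxi nxi)).
by apply: (tint_le Th_ok d0 (niceZ _ (nice_dot nxi nxi)) (nice_dot nxi nW)) => x _; exact: ell.
Qed.

(** The test slots exceed the slots of the difference by [Psi]; the difference itself reproduces the
    dissipation. *)
Lemma flux_split : tint l (fun x => dot (W x) (slots f1 (dt t1) f4 x)) =
  D + tint l (fun x => dot (W x) (Psi x)).
Proof.
rewrite -(tintD Th_ok d0 (nice_dot nxi nW) (nice_dot nW nPsi)).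
apply: (tint_ext Th_ok d0) => x xG; rewrite (slotsD Th_ok _ _ _ hdm hs1 xG) dotDr.
by rewrite dotC.
Qed.

Lemma flux_bound (e : R) : 0 < e -> - tint l (fun x => dot (W x) (Psi x)) <=
  e * (((d + (d + 1))%:R * BL) ^+ 2 * X)
  + (4 * e)^-1 * (ipv l (grad s1) (grad s1) + ip l s4 s4).
Proof.
move=> e0; set K := (_ * BL) ^+ 2.
have n1 := nice_dot (niceV_grad Th_ok hs1) (niceV_grad Th_ok hs1).
have n2 := niceM (Vh_nice hs4) (Vh_nice hs4).
have nx := nice_dot nxi nxi.
rewrite -slots_energy -(tintZ Th_ok d0 K nx) -(tintZ Th_ok d0 e (niceZ K nx)).
rewrite -(tintD Th_ok d0 n1 n2) -(tintZ Th_ok d0 (4 * e)^-1 (niceD n1 n2)).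
rewrite -(tintD Th_ok d0 (niceZ e (niceZ K nx)) (niceZ _ (niceD n1 n2))).
rewrite -(tintN Th_ok d0 (nice_dot nW nPsi)).
apply: (tint_le Th_ok d0 (niceN (nice_dot nW nPsi))
  (niceD (niceZ e (niceZ K nx)) (niceZ _ (niceD n1 n2)))) => x _.
have h := dot_young (- W x) (Psi x) e0.
have W2 : dot (- W x) (- W x) = dot (W x) (W x).
  by rewrite !dotE; apply: eq_bigr => i _; rewrite !mxE mulrNN.
have WP : dot (- W x) (Psi x) = - dot (W x) (Psi x).
  by rewrite !dotE -sumrN; apply: eq_bigr => i _; rewrite !mxE mulNr.
have PP : dot (Psi x) (Psi x) = dot (grad s1 x) (grad s1 x) + s4 x * s4 x.
  rewrite /Psi !dot_col_mx dot_scalar (_ : dot 0 0 = 0) ?add0r//.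
  by rewrite dotE big1// => i _; rewrite mxE mul0r.
rewrite WP W2 PP in h; apply: (le_trans h); apply: lerD => //.
apply: ler_wpM2l; first exact: ltW.
by apply: dot_mulmx_le => i j; exact: ABL.
Qed.

(** In [entropy_step], the potential equations turn the derivative terms into pairings of the
    increments with [f1] and [f4], and the evolution equations then replace these increments by
    fluxes and residuals. *)
Lemma entropy_increment (m : R) : (forall x, gpts x ->
    `|dn (frho v) n x| + `|dn (ftheta v) n x| + `|dn (feta v) n x| <= m) ->
  rel_entropy_reg M lambda u v t1 - rel_entropy_reg M lambda u v t0
  + num_dissipation T nT M lambda u v p n + tau * D <=
  tau * (- tint l (fun x => dot (W x) (Psi x)) + ip l r1 (fun x => -1 * f1 x)
    + ip l r3 (dt t1) + ip l r4 (fun x => -1 * f4 x))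
  + 91 * B * (9 * m * (sq_dist M u v t0 + sq_dist M u v t1) + 3 * m ^+ 3 * volume d l).
Proof.
move=> hm; have ES := entropy_step Th_ok d0 pok pf a0 adm0 adm1 int lambda hm.
have PR := weak_potential_rho Th_ok d0 pok pf a0 adm0 adm1 hmu hmv equ eqv hddr.
have PE := weak_potential_eta Th_ok d0 pok pf a0 adm0 adm1 hnu hnv equ eqv hdde.
have WI := weak_increments Th_ok d0 pok pf a0 adm0 adm1 nA hmu hmv hnu hnv equ eqv hf1 hdt hf4.
rewrite flux_split in WI.
rewrite (ipZr Th_ok d0 _ (Vh_nice hr1) (Vh_nice hf1)) (ipZr Th_ok d0 _ (Vh_nice hr4) (Vh_nice hf4)).
have I1 : ip l ddr f1 = ip l dm ddr + (ip l r2 ddr + lambda * ip l (dr t1) ddr).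
  have nd := Vh_nice hddr.
  rewrite (ipDr Th_ok d0 nd (Vh_nice hdm) (Vh_nice hs1)) (ipC Th_ok d0 ddr).
  rewrite (ipDr Th_ok d0 nd (Vh_nice hr2) (niceZ _ (Vh_nice hdr))) (ipC Th_ok d0 ddr r2).
  by rewrite (ipZr Th_ok d0 _ nd (Vh_nice hdr)) (ipC Th_ok d0 ddr (dr t1)).
have I4 : ip l dde f4 = ip l dN dde + (ip l r5 dde + lambda * ip l (de t1) dde).
  have nd := Vh_nice hdde.
  rewrite (ipDr Th_ok d0 nd (Vh_nice hdN) (Vh_nice hs4)) (ipC Th_ok d0 dde).
  rewrite (ipDr Th_ok d0 nd (Vh_nice hr5) (niceZ _ (Vh_nice hde))) (ipC Th_ok d0 dde r5).
  by rewrite (ipZr Th_ok d0 _ nd (Vh_nice hde)) (ipC Th_ok d0 dde (de t1)).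
exact: (combine_increment tau0 ES PR PE WI I1 I4).
Qed.

Let ip_youngN f g (e : R) : nice f -> nice g -> 0 < e ->
  - ip l f g <= e * ip l f f + (4 * e)^-1 * ip l g g.
Proof.
move=> nf ng e0; have := ip_young Th_ok d0 nf (niceN ng) e0.
rewrite (_ : ip l f (fun x => - g x) = - ip l f g).
  rewrite (_ : ip l (fun x => - g x) _ = ip l g g)//.
  by apply: (tint_ext Th_ok d0) => x _; rewrite mulrNN.
rewrite -mulN1r -(ipZr Th_ok d0 _ nf ng); apply: (ip_ext Th_ok d0) => // x _.
by rewrite mulN1r.
Qed.

Let E0 := sq_dist M u v t0.
Let E1 := sq_dist M u v t1.
Let m := ip l dm dm.
Let G := ipv l (grad (dr t1)) (grad (dr t1)).
Let S := ip l (dS irho) (dS irho).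
Let P := ip l r2 r2.

Let sq_dist_parts : [/\ 0 <= ip l (dr t1) (dr t1), 0 <= ip l (dt t1) (dt t1),
  0 <= ip l (de t1) (de t1) & E1 = ip l (dr t1) (dr t1) + ip l (dt t1) (dt t1)
    + ip l (de t1) (de t1)].
Proof. by split; [exact: (ip_ge0 Th_ok d0)..|]. Qed.

(** The rho potential equation tested with the rho difference. The weight of [m] stays free:
    [mu_bound] takes one half, the absorption a small value. *)
Lemma grad_rho_bound (e : R) : 0 < e ->
  gamma_rho M * G <= e * m + (4 * e)^-1 * E1 + P + S + 2^-1 * E1.
Proof.
move=> e0; have [pr pt pe EE] := sq_dist_parts.
have H := weak_potential_rho Th_ok d0 pok pf a0 adm0 adm1 hmu hmv equ eqv hdr.
have nS := nice_dsplit pok pf a0 adm0 adm1 irho.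
have y1 := ip_young Th_ok d0 (Vh_nice hdm) (Vh_nice hdr) e0.
have y2 := ip_youngN nS (Vh_nice hdr) ltr01.
have y3 := ip_young Th_ok d0 (Vh_nice hr2) (Vh_nice hdr) ltr01.
have y4 : (4 * e)^-1 * ip l (dr t1) (dr t1) <= (4 * e)^-1 * E1.
  by apply: ler_wpM2l; [rewrite invr_ge0 mulr_ge0// ltW|rewrite EE -addrA lerDl addr_ge0].
have y5 : ip l (dr t1) (dr t1) <= E1 by rewrite EE -addrA lerDl addr_ge0.
rewrite mulr1 mul1r in y2; rewrite mulr1 mul1r in y3.
exact: (combine_grad H y1 y2 y3 y4 y5).
Qed.

(** The dissipation sees only the gradient of [dm]. Its L2 norm is recovered by testing the rho
    potential equation with [dm] itself; with [grad_rho_bound] at weight one half, the right side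
    contains half of [m], which moves to the left. *)
Lemma mu_bound : m <= gamma_rho M * X + 5 * S + 5 * P + E1.
Proof.
have H := weak_potential_rho Th_ok d0 pok pf a0 adm0 adm1 hmu hmv equ eqv hdm.
have nS := nice_dsplit pok pf a0 adm0 adm1 irho.
have half : 0 < 2^-1 :> R by [].
have h42 : (4 * 2^-1)^-1 = 2^-1 :> R by field.
have h48 : (4 * 2)^-1 = 8^-1 :> R by field.
have two : 0 < 2 :> R by [].
have y1 := ipv_young Th_ok d0 (niceV_grad Th_ok hdr) (niceV_grad Th_ok hdm) half.
have y2 := ip_young Th_ok d0 nS (Vh_nice hdm) two.
have y3 := ip_youngN (Vh_nice hr2) (Vh_nice hdm) two.
have y4 := grad_rho_bound half.
rewrite h42 in y1; rewrite h42 in y4; rewrite h48 in y2; rewrite h48 in y3.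
apply: (combine_mass (ltW gr0) H y1 _ y2 y3).
- by rewrite /X -addrA lerDl addr_ge0//; [exact: (ipv_ge0 Th_ok d0)|exact: (ip_ge0 Th_ok d0)].
- by rewrite two_halves in y4.
Qed.

(** The residuals [r1] and [r3] are paired with functions whose H1 norms are bounded by the
    dissipation, the squared distances, [r2] and the quantities in [absorbing], so their dual norms
    suffice; [r4] is paired with [f4], estimated in L2 only. *)
Lemma step_estimate (c CL mv : R) :
  absorbing lam0 (((d + (d + 1))%:R * BL) ^+ 2) (gamma_rho M) lambda B c CL ->
  (forall x, gpts x -> `|dn (frho v) n x| + `|dn (ftheta v) n x| + `|dn (feta v) n x| <= mv) ->
  rel_entropy_reg M lambda u v t1 - rel_entropy_reg M lambda u v t0
  + num_dissipation T nT M lambda u v p n + tau / 2 * D <=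
  tau * (c * (E0 + E1) + CL * (norm_m1 l r1 ^+ 2 + norm1 l r2 (grad r2) ^+ 2
    + norm_m1 l r3 ^+ 2 + norm0 l r4 ^+ 2 + norm0 l r5 ^+ 2))
  + 91 * B * (9 * mv * (E0 + E1) + 3 * mv ^+ 3 * volume d l).
Proof.
move=> ab hm; have EI := entropy_increment hm; have DX := dissipation_ge.
have [pr pt pe EE] := sq_dist_parts.
rewrite (norm1_sqr Th_ok d0) !(norm0_sqr Th_ok d0).
have eq_le (y y' : R) : y = y' -> y <= y' by move=> ->.
have N f : 0 <= ip l f f := ip_ge0 Th_ok d0 f.
have NV f : 0 <= ipv l (grad f) (grad f) := ipv_ge0 Th_ok d0 (grad f).
have ip1N f : Vh f -> ip l (fun x => -1 * f x) (fun x => -1 * f x) = ip l f f.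
  move=> hf; apply: (tint_ext Th_ok d0) => x _.
  by rewrite mulrACA mulrNN !mul1r.
have ipv1N f : Vh f -> ipv l (grad (fun x => -1 * f x)) (grad (fun x => -1 * f x))
    = ipv l (grad f) (grad f).
  move=> hf; apply: (tint_ext Th_ok d0) => x [_ xS].
  rewrite (Vh_gradZ Th_ok _ hf xS) !dotE; apply: eq_bigr => i _.
  by rewrite !mxE mulrACA mulrNN !mul1r.
have lamE f : 0 <= f -> f <= E1 -> lambda ^+ 2 * f <= lambda ^+ 2 * E1.
  by move=> _ h; apply: ler_wpM2l => //; exact: sqr_ge0.
have rE : ip l (dr t1) (dr t1) <= E1 by rewrite EE -addrA lerDl addr_ge0.
have tE : ip l (dt t1) (dt t1) <= E1 by rewrite EE addrAC lerDr addr_ge0.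
have eE : ip l (de t1) (de t1) <= E1 by rewrite EE lerDr addr_ge0.
have E00 : 0 <= E0 by rewrite /E0 /sq_dist !addr_ge0.
have E10 : 0 <= E1 by rewrite EE !addr_ge0.
have X0 : 0 <= X by rewrite /X !addr_ge0.
have dmX : ipv l (grad dm) (grad dm) <= X by rewrite /X -addrA lerDl addr_ge0.
have dtX : ipv l (grad (dt t1)) (grad (dt t1)) <= X by rewrite /X addrAC lerDr addr_ge0.
have dNX : ip l dN dN <= X by rewrite /X lerDr addr_ge0.
have h1 e : 0 < e -> ip l r1 (fun x => -1 * f1 x) <=
    e * (ip l f1 f1 + ipv l (grad f1) (grad f1)) + (4 * e)^-1 * norm_m1 l r1 ^+ 2.
  move=> e0; apply: (le_trans (norm_m1_dual Th_ok d0 l0 hr1 (VhZ (-1) hf1) e0)).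
  apply: lerD; last exact: lexx.
  apply: ler_wpM2l; first exact: ltW.
  by apply: lerD; apply: eq_le; [exact: (ip1N f1 hf1)|exact: (ipv1N f1 hf1)].
have h3 e : 0 < e -> ip l r3 (dt t1) <= e * (E1 + X) + (4 * e)^-1 * norm_m1 l r3 ^+ 2.
  move=> e0; apply: (le_trans (norm_m1_dual Th_ok d0 l0 hr3 hdt e0)).
  apply: lerD; last exact: lexx.
  by apply: ler_wpM2l; [exact: ltW|exact: lerD tE dtX].
have h4 e : 0 < e -> ip l r4 (fun x => -1 * f4 x) <= e * ip l f4 f4 + (4 * e)^-1 * ip l r4 r4.
  move=> e0; rewrite (ipC Th_ok d0).
  apply: (le_trans (ip_young Th_ok d0 (Vh_nice (VhZ (-1) hf4)) (Vh_nice hr4) e0)).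
  apply: lerD; last exact: lexx.
  apply: ler_wpM2l; first exact: ltW.
  by apply: eq_le; exact: (ip1N f4 hf4).
have key := ab X m G E0 E1 P (ipv l (grad r2) (grad r2)) S (norm_m1 l r1 ^+ 2)
  (norm_m1 l r3 ^+ 2) (ip l r4 r4) (ip l r5 r5) _ _ _ _ _ _ _ _ _
  (And5 X0 (N dm) (NV (dr t1)) E00 E10) (And4 (N r2) (NV r2) (N _) (sqr_ge0 _))
  (And3 (sqr_ge0 _) (N r4) (N r5)) flux_bound h1 h3 h4 grad_rho_bound mu_bound
  (diff_split_bound Th_ok d0 pok pf a0 adm0 adm1 irho)
  (ipv_add2 Th_ok d0 lambda hr2 hdr) _ _ _ _.
apply: (combine_dissipation tau0 EI DX); rewrite addrA; apply: key.
- apply: (le_trans (ip_add2 Th_ok d0 lambda (Vh_nice hr5) (Vh_nice hde))).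
  apply: lerD; first exact: lexx.
  by apply: ler_wpM2l => //; exact: lamE pe eE.
- apply: (le_trans (ip_add3 Th_ok d0 lambda (Vh_nice hdm) (Vh_nice hr2) (Vh_nice hdr))).
  apply: ler_wpM2l => //; apply: lerD; first exact: lexx.
  exact: lamE pr rE.
- apply: (le_trans (ipv_add3 Th_ok d0 lambda hdm hr2 hdr)).
  apply: ler_wpM2l => //; apply: lerD; last exact: lexx.
  by apply: lerD; [exact: dmX|exact: lexx].
- apply: (le_trans (ip_add3 Th_ok d0 lambda (Vh_nice hdN) (Vh_nice hr5) (Vh_nice hde))).
  apply: ler_wpM2l => //; apply: lerD; last exact: lamE pe eE.
  by apply: lerD; [exact: dNX|exact: lexx].
Qed.

End step_estimate.

(** * Discrete Gronwall inequality for arbitrary step size *)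

Section gronwall.
Context (R : realType) (T q c2 c3 CL Emax tau : R) (nT : nat).
Variables W E D N Res : nat -> R.
Hypotheses (tau0 : 0 < tau) (tauT : nT%:R * tau = T).
Hypotheses (q0 : 0 <= q) (c20 : 0 <= c2) (c30 : 0 <= c3) (CL0 : 0 <= CL)
  (Emax0 : 0 <= Emax).
Hypothesis W0 : forall k, (k <= nT)%N -> 0 <= W k.
Hypothesis E0 : forall k, (k <= nT)%N -> E k <= Emax.
Hypothesis EW : forall k, (k <= nT)%N -> c2 * E k <= q * W k.
Hypotheses (D0 : forall k, (k < nT)%N -> 0 <= D k) (N0 : forall k, (k < nT)%N -> 0 <= N k)
  (Res0 : forall k, (k < nT)%N -> 0 <= Res k).
Hypothesis step : forall k, (k < nT)%N ->
  W k.+1 - W k + N k + tau / 2 * D k <=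
  tau * (c2 * (E k + E k.+1) + CL * Res k) + c3 * tau ^+ 3.

Let Y n := W n + \sum_(0 <= k < n) tau / 2 * D k + \sum_(0 <= k < n) N k.
Let b k := tau * (CL * Res k) + c3 * tau ^+ 3.

Let YS n : Y n.+1 = Y n + (W n.+1 - W n + N n + tau / 2 * D n).
Proof. by rewrite /Y !big_nat_recr//=; ring. Qed.

Let WY n : (n <= nT)%N -> W n <= Y n.
Proof.
move=> nn; rewrite /Y -addrA lerDl addr_ge0//; rewrite big_nat; apply: sumr_ge0 => k /= kn.
  by rewrite mulr_ge0 ?divr_ge0 ?(ltW tau0)// D0// (leq_trans kn).
by rewrite N0// (leq_trans kn).
Qed.

Let b0 k : (k < nT)%N -> 0 <= b k.
Proof.
move=> kn; rewrite /b addr_ge0//; first by rewrite !mulr_ge0 ?(ltW tau0) ?Res0.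
by rewrite mulr_ge0// exprn_ge0// ltW.
Qed.

Let tauT_le n : (n <= nT)%N -> n%:R * tau <= T.
Proof. by move=> nn; rewrite -tauT ler_wpM2r ?ler_nat// ltW. Qed.

Let sum_b n : (n <= nT)%N ->
  \sum_(0 <= k < n) b k <= tau * \sum_(0 <= k < n) CL * Res k + T * c3 * tau ^+ 2.
Proof.
move=> nn; rewrite /b big_split /= -mulr_sumr lerD2l big_const_nat subn0 iter_addr_0.
have -> : c3 * tau ^+ 3 *+ n = (n%:R * tau) * (c3 * tau ^+ 2) by rewrite -mulr_natl; ring.
by rewrite -[leRHS]mulrA ler_wpM2r ?tauT_le// mulr_ge0// sqr_ge0.
Qed.

(** For [x] between 0 and one half, [(1 + x) / (1 - x) <= 1 + 4 * x] and [1 / (1 - x) <= 2], which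
    makes the implicit inequality explicit. *)
Let small_step k : (k < nT)%N -> q * tau <= 2^-1 -> Y k.+1 <= (1 + 4 * (q * tau)) * Y k + 2 * b k.
Proof.
move=> kn; have : 0 <= q * tau := mulr_ge0 q0 (ltW tau0).
move Ex : (q * tau) => x x0 h.
have y0 : 0 <= Y k := le_trans (W0 (ltnW kn)) (WY (ltnW kn)).
have bk := b0 kn.
have s : Y k.+1 <= Y k + x * (Y k + Y k.+1) + b k.
  rewrite {1}YS -[leRHS]addrA lerD2l (le_trans (step kn))// /b mulrDr -[leLHS]addrA lerD2r.
  rewrite [x * _](_ : _ = tau * (q * Y k + q * Y k.+1)); last by rewrite -Ex; ring.
  rewrite ler_wpM2l ?(ltW tau0)// mulrDr lerD// (le_trans (EW _))// ?(ltnW kn)//.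
    by rewrite ler_wpM2l// WY// ltnW.
  by rewrite ler_wpM2l// WY.
have x1 : 0 < 1 - x by lra.
rewrite -(ler_pM2l x1) (@le_trans _ _ ((1 + x) * Y k + b k))//.
  by rewrite mulrBl mul1r mulrDl mul1r; move: s; rewrite mulrDr; move: (x * Y k) (x * Y k.+1) => z z'; lra.
have h1 : (1 + x) * Y k <= (1 - x) * (1 + 4 * x) * Y k.
  rewrite ler_wpM2r// -subr_ge0 (_ : _ - _ = 2 * x * (1 - 2 * x)); last by ring.
  by rewrite !mulr_ge0//; lra.
have h2 : b k <= (1 - x) * 2 * b k by rewrite ler_peMl//; lra.
by rewrite [leRHS]mulrDr ![(1 - x) * (_ * _)]mulrA lerD.
Qed.

Let iterate n : (n <= nT)%N -> q * tau <= 2^-1 ->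
  Y n <= (1 + 4 * (q * tau)) ^+ n * (W 0 + 2 * \sum_(0 <= k < n) b k).
Proof.
move=> + h; have x1 : 1 <= 1 + 4 * (q * tau) by rewrite lerDl !mulr_ge0// ltW.
elim: n => [|n IH] nn.
  by rewrite expr0 mul1r /Y !big_nil !addr0 mulr0 addr0.
rewrite (le_trans (small_step nn h))// big_nat_recr//= [2 * (_ + b n)]mulrDr [W 0 + _]addrA [leRHS]mulrDr.
apply: lerD.
  rewrite exprS -mulrA ler_wpM2l ?(le_trans ler01)//.
  exact: IH (ltnW nn).
by rewrite ler_peMl ?mulr_ge0 ?b0// exprn_ege1.
Qed.

(** Here the squared distances are replaced by their a priori bound [Emax], so no smallness of the
    step enters. *)
Let large_step n : (n <= nT)%N ->
  Y n <= W 0 + n%:R * tau * (2 * c2 * Emax) + \sum_(0 <= k < n) b k.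
Proof.
elim: n => [|n IH] nn; first by rewrite /Y !big_nil !mul0r !addr0.
rewrite YS big_nat_recr//=.
have h1 : c2 * (E n + E n.+1) <= 2 * c2 * Emax.
  by rewrite [2 * c2]mulrC -mulrA ler_wpM2l// mulr_natl mulr2n lerD ?E0// ltnW.
have h2 := ler_wpM2l (ltW tau0) h1.
have h3 : W n.+1 - W n + N n + tau / 2 * D n <= tau * (2 * c2 * Emax) + b n.
  apply: (le_trans (step nn)); rewrite mulrDr /b addrA.
  by apply: lerD => //; apply: lerD.
apply: (le_trans (lerD (IH (ltnW nn)) h3)); rewrite le_eqVlt; apply/orP; left; apply/eqP.
by rewrite -[n.+1%:R]natr1; ring.
Qed.

(** If [q * tau] is at most one half, iterate [small_step] and bound the power by an exponential.
    Otherwise [1 <= 4 * (q * tau) ^+ 2], so the constant [T * (2 * c2 * Emax)] from [large_step] is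
    itself at most a multiple of [tau ^+ 2]. *)
Lemma discrete_gronwall n : (n <= nT)%N ->
  W n + \sum_(0 <= k < n) tau / 2 * D k + \sum_(0 <= k < n) N k <=
  (expR (4 * q * T) * (1 + 2 * T * c3) + 8 * T * c2 * Emax * q ^+ 2) * (W 0 + tau ^+ 2)
  + tau * \sum_(0 <= k < n) 2 * expR (4 * q * T) * CL * Res k.
Proof.
move=> nn; rewrite -/(Y n).
have T0 : 0 <= T by rewrite -tauT mulr_ge0// ltW.
have e1 : 1 <= expR (4 * q * T) by rewrite -expR0 ler_expR !mulr_ge0.
set e := expR _ in e1 *.
have w0 : 0 <= W 0 := W0 (leq0n _).
have S0 : 0 <= tau * \sum_(0 <= k < n) CL * Res k.
  rewrite mulr_ge0 ?(ltW tau0)// big_nat; apply: sumr_ge0 => k /= kn.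
  by rewrite mulr_ge0// Res0// (leq_trans kn).
have -> : tau * \sum_(0 <= k < n) 2 * e * CL * Res k
    = 2 * e * (tau * \sum_(0 <= k < n) CL * Res k).
  by rewrite [RHS]mulrCA [X in _ = _ * X]mulr_sumr; congr (_ * _); apply: eq_bigr => k _; rewrite mulrA.
have t2 : 0 <= tau ^+ 2 := sqr_ge0 _.
have sb := sum_b nn.
move: S0 sb; set S := tau * _ => S0 sb.
have Tc : 0 <= T * c3 by rewrite mulr_ge0.
have CE : 0 <= 8 * T * c2 * Emax * q ^+ 2 by rewrite !mulr_ge0// sqr_ge0.
have [h|h] := lerP (q * tau) 2^-1.
  have ex : (1 + 4 * (q * tau)) ^+ n <= e.
    apply: (@le_trans _ _ (expR (4 * (q * tau)) ^+ n)).
      by rewrite lerXn2r ?nnegrE ?expR_ge0 ?addr_ge0 ?mulr_ge0 ?(ltW tau0)// expR_ge1Dx.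
    rewrite -expRM_natl ler_expR (_ : n%:R * _ = 4 * q * (n%:R * tau)); last by ring.
    by rewrite ler_wpM2l ?mulr_ge0// tauT_le.
  have sum0 : 0 <= W 0 + 2 * \sum_(0 <= k < n) b k.
    rewrite addr_ge0// mulr_ge0// big_nat; apply: sumr_ge0 => k /= kn.
    by rewrite b0// (leq_trans kn).
  apply: (le_trans (iterate nn h)); apply: (le_trans (ler_wpM2r sum0 ex)).
  have e0 : 0 <= e := le_trans ler01 e1.
  apply: (@le_trans _ _ (e * (W 0 + 2 * (S + T * c3 * tau ^+ 2)))).
    by rewrite ler_wpM2l// lerD2l ler_wpM2l.
  rewrite -subr_ge0 (_ : _ - _ = e * (2 * (T * c3) * W 0) + e * tau ^+ 2
    + 8 * T * c2 * Emax * q ^+ 2 * (W 0 + tau ^+ 2)); last by ring.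
  have TW : 0 <= 2 * (T * c3) * W 0 by rewrite mulr_ge0// mulr_ge0.
  apply: addr_ge0; last exact: mulr_ge0 CE (addr_ge0 w0 t2).
  by apply: addr_ge0; [exact: mulr_ge0 e0 TW|exact: mulr_ge0 e0 t2].
apply: (le_trans (large_step nn)).
have h1 : n%:R * tau * (2 * c2 * Emax) <= 8 * T * c2 * Emax * q ^+ 2 * tau ^+ 2.
  have q1 : 1 <= 4 * (q * tau) ^+ 2.
    have : 2^-1 * 2^-1 <= (q * tau) * (q * tau) by apply: ler_pM => //; exact: ltW.
    by rewrite expr2; lra.
  apply: (@le_trans _ _ (T * (2 * c2 * Emax))).
    by rewrite ler_wpM2r ?tauT_le ?mulr_ge0.
  rewrite (_ : 8 * T * c2 * Emax * q ^+ 2 * tau ^+ 2 = T * (2 * c2 * Emax) * (4 * (q * tau) ^+ 2)); last by ring.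
  by rewrite ler_peMr ?mulr_ge0.
apply: (le_trans (lerD (lerD (lexx _) h1) sb)).
rewrite -subr_ge0 (_ : _ - _ = (e - 1) * W 0 + e * (2 * (T * c3)) * W 0
  + 8 * T * c2 * Emax * q ^+ 2 * W 0 + e * tau ^+ 2 + (e - 1) * (T * c3 * tau ^+ 2)
  + e * (T * c3 * tau ^+ 2) + (e - 1) * S + e * S); last by ring.
have e0 : 0 <= e := le_trans ler01 e1.
have e10 : 0 <= e - 1 by rewrite subr_ge0.
have TW : 0 <= 2 * (T * c3) by rewrite mulr_ge0.
have Tt : 0 <= T * c3 * tau ^+ 2 := mulr_ge0 Tc t2.
have add (x y : R) : 0 <= x -> 0 <= y -> 0 <= x + y := @addr_ge0 _ x y.
have mul (x y : R) : 0 <= x -> 0 <= y -> 0 <= x * y := @mulr_ge0 _ x y.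
exact: (add _ _ (add _ _ (add _ _ (add _ _ (add _ _ (add _ _ (add _ _ (mul _ _ e10 w0)
  (mul _ _ (mul _ _ e0 TW) w0)) (mul _ _ CE w0)) (mul _ _ e0 t2)) (mul _ _ e10 Tt))
  (mul _ _ e0 Tt)) (mul _ _ e10 S0)) (mul _ _ e0 S0)).
Qed.

End gronwall.

(** * Uniform bounds at the grid times *)

Section grid_bounds.
Context (R : realType) (d : nat) (l T : R) (Th : seq (simplex R d)) (nT : nat).
Hypotheses (l0 : 0 < l) (T0 : 0 < T) (nT0 : (0 < nT)%N).
Local Notation tau := (tau T nT).
Local Notation tn := (tn T nT).
Local Notation gpts := (gpts l Th).
Local Notation space_time := (cube_measure l d \x itv_measure 0 T)%E.

Lemma tn_itv k : (k <= nT)%N -> 0 <= tn k <= T.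
Proof. by move=> kn; rewrite tn_ge0//= tn_le. Qed.

Lemma Pi1c_Vh_pos g : Pi1c T nT (Vh_pos l Th) g -> Pi1c T nT (Vh l Th) g.
Proof. by move=> [h1 h2]; split=> // t /h1[]. Qed.

Lemma Pi1c_grid g k : Pi1c T nT (Vh l Th) g -> (k <= nT)%N -> Vh l Th (g (tn k)).
Proof. by move=> [h _] kn; apply: h; exact: tn_itv. Qed.

Let grid_bound g (C : R) N k x : Pi1c T nT (Vh l Th) g -> measurable N -> space_time N = 0%E ->
  (forall y t, ~ N (y, t) -> `|g t (rv y)| <= C) -> (k <= nT)%N -> gpts x ->
  `|g (tn k) x| <= C.
Proof.
move=> gP mN N0 NP; have cont j : (j <= nT)%N -> continuous (g (tn j)).
  by move=> jn; have [] := Pi1c_grid gP jn.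
have PL j : (j < nT)%N -> gpts x -> `|g (tn j) x| <= C /\ `|g (tn j.+1) x| <= C.
  move=> jn [xp _]; apply: (piecewise_linear_bound l0 T0 nT0 mN N0 NP jn) => //.
  - by apply: cont; exact: ltnW.
  - exact: cont.
  - by move=> s y s01; have [_] := gP; apply.
by case: k => [|k] kn xG; [have [] := PL _ nT0 xG|have [] := PL _ kn xG].
Qed.

Lemma norm_oo_grid g1 g2 g3 (C : R) k x : Pi1c T nT (Vh l Th) g1 -> Pi1c T nT (Vh l Th) g2 ->
  Pi1c T nT (Vh l Th) g3 -> (norm_oo T l g1 g2 g3 <= C%:E)%E -> (k <= nT)%N -> gpts x ->
  [/\ `|g1 (tn k) x| <= C, `|g2 (tn k) x| <= C & `|g3 (tn k) x| <= C].
Proof.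
move=> h1 h2 h3 /(norm_oo_ae l0 T0)[N [mN N0 NP]] kn xG.
by split; [apply: (grid_bound h1 mN N0)|apply: (grid_bound h2 mN N0)|
  apply: (grid_bound h3 mN N0)] => // y t /NP[].
Qed.

(** A function constant in time is piecewise linear on the grid, so the grid bound at time 0
    applies; this serves the difference quotients of the perturbed solution. *)
Lemma norm_oo_static f1 f2 f3 (C : R) x : Vh l Th f1 -> Vh l Th f2 -> Vh l Th f3 ->
  (norm_oo T l (fun=> f1) (fun=> f2) (fun=> f3) <= C%:E)%E -> gpts x ->
  [/\ `|f1 x| <= C, `|f2 x| <= C & `|f3 x| <= C].
Proof.
move=> h1 h2 h3 hC xG.
have st f : Vh l Th f -> Pi1c T nT (Vh l Th) (fun=> f).
  by move=> hf; split=> // n s y _ _; ring.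
exact: (@norm_oo_grid _ _ _ C 0%N x (st _ h1) (st _ h2) (st _ h3) hC).
Qed.

Lemma norm_oo_ge0 (g1 g2 g3 : R -> 'rV[R]_d -> R) : (0 <= norm_oo T l g1 g2 g3)%E.
Proof. exact: Lnorm_ge0. Qed.

Lemma Vh_dtau g n : Pi1c T nT (Vh l Th) g -> (n < nT)%N -> Vh l Th (dtau T nT g n).
Proof.
move=> gP nn; have h := VhZ tau^-1 (VhB (Pi1c_grid gP nn) (Pi1c_grid gP (ltnW nn))).
rewrite (_ : dtau T nT g n = fun x => tau^-1 * (g (tn n.+1) x - g (tn n) x))//.
by apply/funext => x; rewrite /dtau mulrC.
Qed.

Lemma dn_bound (g : R -> 'rV[R]_d -> R) n (C : R) x : 0 < tau -> `|dtau T nT g n x| <= C -> `|dn T nT g n x| <= C * tau.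
Proof. by move=> t0; rewrite /dtau normrM normfV (gtr0_norm t0) ler_pdivrMr. Qed.

End grid_bounds.

(** * Admissibility of the grid states and choice of the constants *)

Section assembly.
Context (R : realType) (d : nat) (M : model R d) (Th : seq (simplex R d)).
Local Notation l := (edge M).
Local Notation gpts := (gpts l Th).
Context (T c C : R) (nT : nat) (u v : fields R d).
Hypotheses (Th_ok : triangulation l Th) (d0 : (0 < d)%N) (l0 : 0 < l).
Hypotheses (T0 : 0 < T) (c0 : 0 < c) (nT0 : (0 < nT)%N).
Local Notation tn := (tn T nT).
Local Notation lo := (st (- C) c (- C)).
Local Notation hi := (st C C C).

Lemma admissible_grid k : fields_in T nT l Th u -> fields_in T nT l Th v ->
  (norm_oo T l (frho u) (ftheta u) (feta u) <= C%:E)%E ->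
  (norm_oo T l (frho v) (ftheta v) (feta v) <= C%:E)%E ->
  (forall t x, 0 <= t <= T -> c <= ftheta u t x /\ c <= ftheta v t x) ->
  (k <= nT)%N -> admissible M Th lo hi u v (tn k).
Proof.
move=> [ur /Pi1c_Vh_pos ut ue _ _] [vr /Pi1c_Vh_pos vt ve _ _] hu hv hth kn.
have tk := tn_itv T0 nT0 kn.
have bx r t e : `|r| <= C -> `|t| <= C -> `|e| <= C -> c <= t -> box lo hi (st r t e).
  rewrite !ler_norml => /andP[? ?] /andP[? ?] /andP[? ?] ?.
  by apply: forall3; rewrite !stE; apply/andP.
split; try exact: (Pi1c_grid T0 nT0).
- move=> x xG; have [h1 h2 h3] := norm_oo_grid l0 T0 nT0 ur ut ue hu kn xG.
  by apply: bx => //; have [] := hth _ x tk.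
- move=> x xG; have [h1 h2 h3] := norm_oo_grid l0 T0 nT0 vr vt ve hv kn xG.
  by apply: bx => //; have [] := hth _ x tk.
Qed.

(** Three components, each differing by at most [2 * C]; this is the a priori bound used for large
    time steps. *)
Lemma sq_dist_bound t : admissible M Th lo hi u v t ->
  sq_dist M u v t <= 12 * C ^+ 2 * volume d l.
Proof.
move=> ad; have n1 : nice l Th (fun _ : 'rV[R]_d => 1) := nice_cst l Th 1.
have b f g : Vh l Th (fun x => f x - g x) ->
    (forall x, gpts x -> `|f x| <= C /\ `|g x| <= C) ->
    ip l (fun x => f x - g x) (fun x => f x - g x) <= 4 * C ^+ 2 * volume d l.
  move=> /Vh_nice nf fg; rewrite /volume -(tintZ Th_ok d0 _ n1).
  apply: (tint_le Th_ok d0 (niceM nf nf) (niceZ _ n1)) => x /fg[fC gC].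
  rewrite mulr1 -expr2 -(real_normK (num_real (f x - g x))).
  rewrite (_ : 4 * C ^+ 2 = (C + C) ^+ 2); last by ring.
  have h : `|f x - g x| <= C + C by rewrite (le_trans (ler_normB _ _))// lerD.
  by rewrite ler_sqr ?nnegrE// (le_trans _ h).
have w i x : gpts x -> `|state u t x 0 i| <= C /\ `|state v t x 0 i| <= C.
  move=> xG; have := adm_u ad xG i; have := adm_v ad xG i; have cp := c0; move: i.
  apply: forall3; rewrite /state !stE !ler_norml => /andP[? ?] /andP[? ?]; split;
    by apply/andP; split; lra.
have wr x : gpts x -> `|frho u t x| <= C /\ `|frho v t x| <= C.
  by move=> /(w irho); rewrite /state !stE.
have wt x : gpts x -> `|ftheta u t x| <= C /\ `|ftheta v t x| <= C.
  by move=> /(w itheta); rewrite /state !stE.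
have we x : gpts x -> `|feta u t x| <= C /\ `|feta v t x| <= C.
  by move=> /(w ieta); rewrite /state !stE.
rewrite (_ : 12 * C ^+ 2 * _ = 4 * C ^+ 2 * volume d l + 4 * C ^+ 2 * volume d l
  + 4 * C ^+ 2 * volume d l); last by ring.
apply: lerD; last exact: b (VhBe ad) we.
by apply: lerD; [exact: b (VhBr ad) wr|exact: b (VhBt ad) wt].
Qed.

Lemma nice_mobility Theta (p q : nat -> R) n i j : mobility_ok M Theta -> open Theta ->
  (forall x, Theta (comb T nT p q (ftheta u) n x)) -> fields_in T nT l Th u -> (n < nT)%N ->
  nice l Th (fun x => Lfull M (mob_at T nT p q u n x) i j).
Proof.
move=> mo oT th [ur /Pi1c_Vh_pos ut ue _ _] nn.
have co g : Pi1c T nT (Vh l Th) g -> Vh l Th (comb T nT p q g n).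
  move=> gP; apply: VhD; apply: VhZ; apply: (Pi1c_grid T0 nT0) => //; exact: ltnW.
by apply: (Lfull_nice Th_ok i j mo oT th); exact: co.
Qed.

Lemma mob_theta_at (p q : nat -> R) n x :
  mob_theta (mob_at T nT p q u n x) = comb T nT p q (ftheta u) n x.
Proof. by rewrite /mob_theta /mob_at /mob_arg !row_mxKr row_mxKl mxE eqxx mulr1n. Qed.

End assembly.

Theorem theorem13 (R : realType) (alpha : R) :
  exists2 lambda_min : R, 0 <= lambda_min &
  forall (lambda : R), lambda_min <= lambda ->
  forall (d : nat) (M : model R d) (Theta : set R) (T c_oo C_oo : R),
  d = 2%N \/ d = 3%N ->
  0 < edge M -> 0 < gamma_rho M -> 0 < gamma_eta M ->
  open Theta -> (forall t, 0 < t -> Theta t) -> mobility_ok M Theta ->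
  potential_ok M alpha ->
  0 < T -> 0 < c_oo -> 0 < C_oo ->
  exists C CL : R, 0 < C /\ 0 < CL /\
  forall (Th : seq (simplex R d)) (nT : nat) (a b : nat -> R)
    (u v : fields R d) (r1 r2 r3 r4 r5 : R -> 'rV[R]_d -> R)
    (p : taylor_points R d),
  let l := edge M in
  let tau := tau T nT in
  let tn := tn T nT in
  let z := mob_at T nT a b u in
  triangulation l Th -> (0 < nT)%N ->
  fields_in T nT l Th u -> fields_in T nT l Th v ->
  (forall n x, (n < nT)%N -> Theta (comb T nT a b (ftheta u) n x)) ->
  (forall n, (n < nT)%N -> step_eqs T nT M Th (z n) u n
     (fun=> 0) (fun=> 0) (fun=> 0) (fun=> 0) (fun=> 0)) ->
  [/\ Pi0 T nT (Vh l Th) r1, Pi0 T nT (Vh l Th) r2, Pi0 T nT (Vh l Th) r3,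
      Pi0 T nT (Vh l Th) r4 & Pi0 T nT (Vh l Th) r5] ->
  (forall n, (n < nT)%N -> step_eqs T nT M Th (z n) v n
     (ip l (r1 (tn n.+1))) (ip l (r2 (tn n.+1))) (ip l (r3 (tn n.+1)))
     (ip l (r4 (tn n.+1))) (ip l (r5 (tn n.+1)))) ->
  (forall n, (n < nT)%N ->
     (norm_oo T l (frho u) (ftheta u) (feta u) +
      norm_oo T l (frho v) (ftheta v) (feta v) +
      norm_oo T l (fun=> dtau T nT (frho v) n) (fun=> dtau T nT (ftheta v) n)
        (fun=> dtau T nT (feta v) n) <= C_oo%:E)%E) ->
  (forall t x, 0 <= t <= T -> c_oo <= ftheta u t x /\ c_oo <= ftheta v t x) ->
  (forall n, (n < nT)%N -> intermediate T nT M u p n) ->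
  forall n, (n < nT)%N ->
    rel_entropy_reg M lambda u v (tn n.+1)
    + \sum_(0 <= k < n.+1) tau / 2 * dissipation T nT M (z k) u v k
    + \sum_(0 <= k < n.+1) num_dissipation T nT M lambda u v p k
    <= C * rel_entropy_reg M lambda u v 0 + C * tau ^+ 2
       + tau * \sum_(0 <= k < n.+1) CL *
         (norm_m1 l (r1 (tn k.+1)) ^+ 2
          + norm1 l (r2 (tn k.+1)) (grad (r2 (tn k.+1))) ^+ 2
          + norm_m1 l (r3 (tn k.+1)) ^+ 2
          + norm0 l (r4 (tn k.+1)) ^+ 2 + norm0 l (r5 (tn k.+1)) ^+ 2).
Proof.
(* The threshold of [rel_entropy_ge], dependent on [alpha] alone. *)
exists (`|alpha| + 1); first by rewrite addr_ge0.
move=> lambda hl d M Theta T c_oo C_oo d23 l0 gr0 ge0 oT posT mo pok T0 c0 C0.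
have d0 : (0 < d)%N by case: d23 => ->.
(* The box of all states allowed by the two bounds. Every constant below is fixed from this box, the
   model, [T] and [lambda], before mesh, time step and fields are introduced. *)
pose lo := st (- C_oo) c_oo (- C_oo); pose hi := st C_oo C_oo C_oo.
have a0 : 0 < lo 0 itheta by rewrite stE.
have [B [k pf]] := potential_factsP hi pok a0.
have [lam0 [lam1 [lam00 _ ell]]] := mob_elliptic mo.
have [BL BLP] := mob_bounded mo.
have [c [CL [cge0 CL0 ab]]] := absorption lambda B lam00
  (sqr_ge0 ((d + (d + 1))%:R * BL)) gr0.
have Bp := pf_B pf; have kp := pf_k pf.
pose vol := volume d (edge M).
pose kap := Num.min k 2^-1; have kap0 : 0 < kap by rewrite lt_min kp /= invr_gt0 ltr0n.
(* Three components of the perturbed solution, each moving by at most [C_oo * tau] in one step. *)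
pose kv := 3 * C_oo; have kv0 : 0 < kv by rewrite mulr_gt0.
have lambda0 : 0 <= lambda by rewrite (le_trans _ hl)// addr_ge0.
(* These are the coefficients in [step_estimate] with [mv = kv * tau], where [819 = 91 * 9] and
   [273 = 91 * 3]. The absolute value of [vol] is taken because its sign is derived with a
   triangulation, introduced only later. *)
pose c2 := c + 819 * B * kv; pose c3 := 273 * B * kv ^+ 3 * `|vol|.
have c20 : 0 <= c2 := addr_ge0 cge0 (mulr_ge0 (mulr_ge0 (ler0n R 819) (ltW Bp)) (ltW kv0)).
have c30 : 0 <= c3 := mulr_ge0 (mulr_ge0 (mulr_ge0 (ler0n R 273) (ltW Bp))
  (exprn_ge0 3 (ltW kv0))) (normr_ge0 vol).
(* Coercivity with constant [kap] turns [c2] times the squared distance into at most [q] times the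
   relative entropy. *)
pose q := c2 / kap; have q0 : 0 <= q by rewrite divr_ge0// ltW.
pose Emax := 12 * C_oo ^+ 2 * `|vol|.
have Emax0 : 0 <= Emax := mulr_ge0 (mulr_ge0 (ler0n R 12) (sqr_ge0 C_oo)) (normr_ge0 vol).
pose C := expR (4 * q * T) * (1 + 2 * T * c3) + 8 * T * c2 * Emax * q ^+ 2.
have Cp : 0 < C.
  apply: ltr_wpDr.
    exact: mulr_ge0 (mulr_ge0 (mulr_ge0 (mulr_ge0 (ler0n R 8) (ltW T0)) c20) Emax0) (sqr_ge0 q).
  apply: mulr_gt0; first exact: expR_gt0.
  apply: ltr_wpDr => //; exact: mulr_ge0 (mulr_ge0 (ler0n R 2) (ltW T0)) c30.
exists C, (2 * expR (4 * q * T) * CL); split=> //; split; first by rewrite !mulr_gt0 ?expR_gt0.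
move=> Th nT aa bb u v r1 r2 r3 r4 r5 p l tau tn z Th_ok nT0 fu fv thT equ.
move=> [Pr1 Pr2 Pr3 Pr4 Pr5] eqv hoo hth int n nn.
have tau0 : 0 < tau := tau_gt0 T0 nT0.
have hooS m : (m < nT)%N -> [/\ (norm_oo T l (frho u) (ftheta u) (feta u) <= C_oo%:E)%E,
    (norm_oo T l (frho v) (ftheta v) (feta v) <= C_oo%:E)%E &
    (norm_oo T l (fun=> dtau T nT (frho v) m) (fun=> dtau T nT (ftheta v) m)
        (fun=> dtau T nT (feta v) m) <= C_oo%:E)%E].
  move=> mn; have H := hoo m mn; move: H.
  have p1 := norm_oo_ge0 l T (frho u) (ftheta u) (feta u).
  have p2 := norm_oo_ge0 l T (frho v) (ftheta v) (feta v).
  have p3 := norm_oo_ge0 l T (fun=> dtau T nT (frho v) m) (fun=> dtau T nT (ftheta v) m)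
        (fun=> dtau T nT (feta v) m).
  move=> H; split; apply: le_trans H.
  - by rewrite -addeA leeDl// adde_ge0.
  - by rewrite addeAC leeDr// adde_ge0.
  - by rewrite leeDr// adde_ge0.
have [hu hv _] := hooS _ nn.
have ad m : (m <= nT)%N -> admissible M Th lo hi u v (tn m).
  by move=> mn; exact: (admissible_grid l0 T0 nT0 fu fv hu hv hth mn).
have vol0 : 0 <= vol by apply: (tint_ge0 Th_ok d0) => x _.
have tn0 : tn 0%N = 0 by rewrite /tn /Defs.tn mul0r.
have dnb m : (m < nT)%N -> forall x, gpts l Th x ->
    `|dn T nT (frho v) m x| + `|dn T nT (ftheta v) m x| + `|dn T nT (feta v) m x| <= kv * tau.
  move=> mn x xG; have [vr /Pi1c_Vh_pos vt ve _ _] := fv.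
  have [_ _ h] := hooS m mn.
  have [b1 b2 b3] := norm_oo_static l0 T0 nT0 (Vh_dtau T0 nT0 vr mn) (Vh_dtau T0 nT0 vt mn)
    (Vh_dtau T0 nT0 ve mn) h xG.
  rewrite (_ : kv * tau = C_oo * tau + C_oo * tau + C_oo * tau); last by rewrite /kv; ring.
  by rewrite !lerD//; exact: dn_bound.
have thz m x : (m < nT)%N -> Theta (mob_theta (z m x)).
  by move=> mn; rewrite mob_theta_at; exact: thT.
have [_ _ _ mur nur] := fu; have [_ _ _ mvr nvr] := fv.
have ell' m : (m < nT)%N -> forall x xi, lam0 * dot xi xi <= dot xi (Lfull M (z m x) *m xi).
  by move=> mn x xi; have /andP[] := ell _ (thz m x mn) xi.
have E0 m : 0 <= sq_dist M u v (tn m) by rewrite /sq_dist !addr_ge0//; exact: (ip_ge0 Th_ok d0).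
have EW m : (m <= nT)%N -> kap * sq_dist M u v (tn m) <= rel_entropy_reg M lambda u v (tn m).
  by move=> mn; exact: (rel_entropy_ge Th_ok d0 pok pf a0 (ad m mn) hl gr0 ge0).
pose Res m := norm_m1 l (r1 (tn m.+1)) ^+ 2
          + norm1 l (r2 (tn m.+1)) (grad (r2 (tn m.+1))) ^+ 2
          + norm_m1 l (r3 (tn m.+1)) ^+ 2
          + norm0 l (r4 (tn m.+1)) ^+ 2 + norm0 l (r5 (tn m.+1)) ^+ 2.
rewrite -mulrDr.
have -> : rel_entropy_reg M lambda u v 0 = rel_entropy_reg M lambda u v (tn 0%N) by rewrite tn0.
apply: (@discrete_gronwall R T q c2 c3 CL Emax tau nT
  (fun m => rel_entropy_reg M lambda u v (tn m)) (fun m => sq_dist M u v (tn m))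
  (fun m => dissipation T nT M (z m) u v m) (fun m => num_dissipation T nT M lambda u v p m)
  Res) => // [||m mn|m mn|m mn|m mn|m mn|m mn|m mn].
- by rewrite /tau /Defs.tau mulrC divfK// pnatr_eq0 -lt0n.
- exact: ltW.
- by apply: le_trans (EW m mn); rewrite mulr_ge0// ltW.
- by rewrite /Emax ger0_norm//; exact: (sq_dist_bound Th_ok d0 c0 (ad m mn)).
- by rewrite /q mulrAC ler_pdivlMr// -mulrA ler_wpM2l// mulrC; exact: EW.
- apply: (tint_ge0 Th_ok d0) => x _; apply: le_trans (ell' m mn x _).
  by rewrite mulr_ge0 ?(ltW lam00)// dot_ge0.
- exact: (num_dissipation_ge0 Th_ok d0 pok pf a0 (ad m (ltnW mn)) (ad m.+1 mn) (int m mn)).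
- by rewrite /Res !addr_ge0 ?sqr_ge0.
have S := step_estimate Th_ok d0 l0 pok pf a0 gr0 tau0 (ad m (ltnW mn)) (ad m.+1 mn) (int m mn)
  (fun i j => nice_mobility Th_ok T0 nT0 i j mo oT (fun x => thT m x mn) fu mn) (ell' m mn)
  (fun x => BLP _ (thz m x mn)) (proj1 (mur m mn)) (proj1 (mvr m mn)) (proj1 (nur m mn))
  (proj1 (nvr m mn)) (proj1 (Pr1 m mn)) (proj1 (Pr2 m mn)) (proj1 (Pr3 m mn))
  (proj1 (Pr4 m mn)) (proj1 (Pr5 m mn)) (equ m mn) (eqv m mn) ab (dnb m mn).
apply: (le_trans S); rewrite le_eqVlt; apply/orP; left; apply/eqP.
rewrite -/vol -/(Res m) /c2 /c3 (ger0_norm vol0).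
move: (sq_dist _ _ _ _) (sq_dist _ _ _ _) (Res m) => e1 e2 rs.
rewrite -/tau; clearbody tau kv vol; ring.
Qed.
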